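(* Let $d\ge1$, $\mu\in\mathbb{R}^d$, $A$ a $d\times d$ symmetric positive definite matrix, and $R$ a $d\times d$ reflection nonsingular $\mathcal{M}$-matrix satisfying Assumption (C), with $\overline{R}=RC$ and $\Omega=\overline{R}^{-1}$. Let $c_+$ and $c_-$ be the maximum and minimum of $x'\Omega A\Omega x/x'\Omega x$ over $x\in\mathbb{R}^d_+\setminus\{0\}$. (i) If $\mathrm{tr}(\Omega A)\ge 2c_+$, then $\mathrm{SRBM}^d(R,\mu,A)$ does not hit the corner. (ii) If $0\le\mathrm{tr}(\Omega A)<2c_-$, then $\mathrm{SRBM}^d(R,\mu,A)$ hits the corner.
   Context: Let $S=\mathbb{R}^d_+$, $S_i=\{x\in S: x_i=0\}$, and for $I\subseteq\{1,\dots,d\}$, $S_I=\{x\in S: x_i=0 \ \forall i\in I\}$. A $d\times d$ matrix $R=(r_{ij})$ is a reflection nonsingular $\mathcal{M}$-matrix if $r_{ii}=1$, $r_{ij}\le 0$ for $i\ne j$, and the spectral radius of $I_d-R$ is less than $1$; it satisfies Assumption (C) if there is a diagonal $C=\mathrm{diag}(c_1,\dots,c_d)$, $c_i>0$, with $RC$ symmetric. $\mathrm{SRBM}^d(R,\mu,A)$ started at $z\in S$: a continuous adapted $S$-valued process $Z$ with $Z(t)=B(t)+RL(t)$, where $B$ is a Brownian motion in $\mathbb{R}^d$ with drift $\mu$, covariance matrix $A$, $B(0)=z$, and $L=(L_1,\dots,L_d)'$ is continuous adapted with each $L_k$ nondecreasing, $L_k(0)=0$, $\int_0^\infty Z_k(t)\,dL_k(t)=0$.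 For reflection nonsingular $\mathcal{M}$-matrices $R$ it exists and is pathwise unique for every $z$; write $\mathbb{P}_z$ for its law. The SRBM does not hit $S_I$ (avoids $S_I$) if $\mathbb{P}_z(\exists t>0: Z(t)\in S_I)=0$ for every $z\in S$, and hits $S_I$ if this probability is positive for every $z\in S$. Hitting the corner means hitting $S_{\{1,\dots,d\}}=\{0\}$. *)

(* Defs.v *)
From HB Require Import structures.
From mathcomp Require Import all_boot all_order all_algebra.
From mathcomp Require Import all_classical all_reals all_analysis.
From mathcomp Require Import complex.
Import Order.TTheory GRing.Theory Num.Theory.
Import numFieldTopology.Exports numFieldNormedType.Exports.

Set Implicit Arguments.
Unset Strict Implicit.
Unset Printing Implicit Defensive.

Local Open Scope classical_set_scope.
Local Open Scope ring_scope.

Definition diagC {R : realType} {n : nat} (c : 'I_n -> R) : 'M[R]_n :=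
  diag_mx (\row_i c i).

Definition spectral_radius_lt1 {R : realType} {n : nat} (M : 'M[R]_n) : Prop :=
  forall a : R[i], eigenvalue (map_mx (fun x : R => (x%:C)%C) M) a -> `|a| < 1.

Definition reflection_M_matrix {R : realType} {n : nat} (Rm : 'M[R]_n) : Prop :=
  [/\ (forall i, Rm i i = 1),
      (forall i j, i != j -> Rm i j <= 0) &
      spectral_radius_lt1 (1%:M - Rm)].

(* Assumption (C) (stated for completeness; the theorem quantifies over
   the diagonal witness C directly). *)
Definition assumption_C {R : realType} {n : nat} (Rm : 'M[R]_n) : Prop :=
  exists c : 'I_n -> R, (forall i, 0 < c i) /\
    (Rm *m diagC c)^T = Rm *m diagC c.

Definition sym_pos_def {R : realType} {n : nat} (A : 'M[R]_n) : Prop :=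
  A^T = A /\ forall x : 'cV[R]_n, x != 0 -> 0 < (x^T *m A *m x) 0 0.

Definition orthant {R : realType} {n : nat} : set 'cV[R]_n :=
  [set x | forall i, 0 <= x i 0].

Definition rayleigh_ratio {R : realType} {n : nat} (Om A : 'M[R]_n)
    (x : 'cV[R]_n) : R :=
  (x^T *m Om *m A *m Om *m x) 0 0 / (x^T *m Om *m x) 0 0.

Definition ratio_set {R : realType} {n : nat} (Om A : 'M[R]_n) : set R :=
  [set rayleigh_ratio Om A x | x in orthant `\ 0].

(* c_+ and c_- : max and min of the ratio over R^n_+ \ {0}
   (attained; written as sup / inf). *)
Definition c_plus {R : realType} {n : nat} (Om A : 'M[R]_n) : R :=
  sup (ratio_set Om A).
Definition c_minus {R : realType} {n : nat} (Om A : 'M[R]_n) : R :=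
  inf (ratio_set Om A).

Section Stoch.
Context {R : realType} {d : measure_display} {T : measurableType d}.

Definition is_filtration (F : R -> set (set T)) : Prop :=
  [/\ (forall t, sigma_algebra setT (F t)),
      (forall t, F t `<=` measurable) &
      (forall s t, 0 <= s -> s <= t -> F s `<=` F t)].

Definition measurable_wrt (G : set (set T)) (X : T -> R) : Prop :=
  forall Y : set R, measurable Y -> G (X @^-1` Y).

Context {n : nat}.

Definition continuous_paths (X : R -> T -> 'cV[R]_n) : Prop :=
  forall (w : T) (i : 'I_n),
    {within [set t : R | 0 <= t], continuous (fun t => X t w i 0)}.

Definition adapted (F : R -> set (set T)) (X : R -> T -> 'cV[R]_n) : Prop :=
  forall t, 0 <= t -> forall i : 'I_n, measurable_wrt (F t) (fun w => X t w i 0).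

(* B is an (F_t)-Brownian motion in R^n with drift mu, covariance A,
   B(0) = z: continuous adapted paths, and for 0 <= s < t the increment
   B(t) - B(s) is independent of F_s and Gaussian N((t-s) mu, (t-s) A)
   (i.e. every linear functional u'(B(t)-B(s)), u <> 0, is normal with mean
   (t-s) u'mu and variance (t-s) u'Au). *)
Definition brownian_motion (P : probability T R) (F : R -> set (set T))
    (mu : 'cV[R]_n) (A : 'M[R]_n) (z : 'cV[R]_n)
    (B : R -> T -> 'cV[R]_n) : Prop :=
  [/\ (forall w, B 0 w = z),
      continuous_paths B,
      adapted F B,
      (forall s t, 0 <= s -> s < t -> forall u : 'cV[R]_n, u != 0 ->
         forall Y : set R, measurable Y ->
           P [set w | Y ((u^T *m (B t w - B s w)) 0 0)] =
           normal_prob ((t - s) * (u^T *m mu) 0 0)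
                       (Num.sqrt ((t - s) * (u^T *m A *m u) 0 0)) Y) &
      (forall s t, 0 <= s -> s < t -> forall G, F s G ->
         forall Ys : 'I_n -> set R, (forall i, measurable (Ys i)) ->
           let E := [set w | forall i, Ys i (B t w i 0 - B s w i 0)] in
           P (G `&` E) = (P G * P E)%E)].

End Stoch.

Definition ext0 {R : realType} (f : R -> R) : R -> R :=
  fun t => if t < 0 then 0 else f t.

(* Lebesgue--Stieltjes integral  \int_{[0,oo)} g dL  for L nondecreasing,
   (right-)continuous on [0,oo) with L(0) = 0, built on the library's
   Lebesgue--Stieltjes measure of ext0 L (the value 0 is returned in the
   degenerate case where ext0 L is not a cumulative function; this case
   never occurs under the SRBM hypotheses below). *)
Definition stieltjes_int {R : realType} (L g : R -> R) : \bar R :=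
  match pselect ({homo ext0 L : x y / x <= y} /\
                 (forall x, ext0 L @ at_right x --> ext0 L x)) with
  | left h =>
      let LC : cumulative R R :=
        HB.pack_for (cumulative R R) (ext0 L)
          (@isCumulative.Build R _ R (ext0 L) (proj1 h) (proj2 h)) in
      (\int[lebesgue_stieltjes_measure LC]_(x in [set t : R | (0 <= t)%R])
          (g x)%:E)%E
  | right _ => 0%E
  end.

Section SRBM.
Context {R : realType} {d : measure_display} {T : measurableType d} {n : nat}.

Definition is_SRBM (Rm : 'M[R]_n) (mu : 'cV[R]_n) (A : 'M[R]_n)
    (z : 'cV[R]_n) (P : probability T R) (F : R -> set (set T))
    (B L Z : R -> T -> 'cV[R]_n) : Prop :=
  [/\ is_filtration F /\ brownian_motion P F mu A z B,
      [/\ continuous_paths Z, adapted F Z &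
           (forall t w, 0 <= t -> forall i, 0 <= Z t w i 0)],
      (forall t w, 0 <= t -> Z t w = B t w + Rm *m L t w),
      continuous_paths L /\ adapted F L &
      (forall w (k : 'I_n),
         [/\ L 0 w k 0 = 0,
             (forall s t, 0 <= s -> s <= t -> L s w k 0 <= L t w k 0) &
             stieltjes_int (fun t => L t w k 0) (fun t => Z t w k 0) = 0%E])].

Definition hits_corner (Z : R -> T -> 'cV[R]_n) : set T :=
  [set w | exists t, 0 < t /\ Z t w = 0].

End SRBM.

(* Main.v *)
(**
Write [Om = (R C)^-1] and [V x = x' Om x].  As [Om R = C^-1] is diagonal, the
reflection changes [V (Z)] only through [sum_i Z_i dL_i / c_i], which vanishes
because [Z_i = 0] whenever [L_i] grows.  Hence [g (V (Z))] evolves as it would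
for the Brownian motion alone, with generator
   [g' (V) (tr (Om A) + 2 x' Om mu) + 2 g'' (V) x' Om A Om x],
where [c_- V <= x' Om A Om x <= c_+ V] on the orthant.  No stochastic calculus
is needed for this: sum the increments of [g (V (Z))] over a grid, expand each
to second order using independence and the Gaussian moments, and let the mesh
tend to 0.  The reflection errors vanish in the limit pathwise, by uniform
continuity, and boundedly.

(i) For [g = exp (- a v)] with [a] large, the generator is very negative near
the corner, so [Z] cannot stay there.  From a state with [V >= dl], the test
function [ln ((1 + V) / (e + V))], corrected by a multiple of
[exp (- sqrt (V + e))] that absorbs the drift [mu], has bounded expectation up to
the exit from a compact set but is of order [ln (1 / e)] when [V <= e]; let
[e] tend to 0.

(ii) For [g = exp (- lam (V + eta e) ^ p)] with suitable small [p], [eta] and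
large [lam], the generator is bounded below by a positive constant on
[e <= V <= M].  So [Z] leaves this slab in finite time, and the value of [g] at
the start forces a probability of leaving through [V < e] that is bounded away
from 0 as [e] tends to 0.
*)
Require Import Defs.
From HB Require Import structures.
From mathcomp Require Import all_boot all_order all_algebra.
From mathcomp Require Import all_classical all_reals all_analysis.
From mathcomp Require Import complex measurable_realfun ring lra.
From mathcomp Require Import spectral sesquilinear.
Import Order.TTheory GRing.Theory Num.Theory.
Import numFieldTopology.Exports numFieldNormedType.Exports.
Local Open Scope classical_set_scope.
Local Open Scope ring_scope.

Set Implicit Arguments.
Unset Strict Implicit.
Unset Printing Implicit Defensive.

(** * Spectral bound for symmetric matrices *)

Local Open Scope sesquilinear_scope.

(** The grid replaces stopping times: a sum of increments is killed at the first grid time at which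
    the state has left a set [D t], and paths are compared with their grid traces only at the end,
    by continuity. [D t] bounds [L] as well as [V], because the reflection error of a path is
    controlled by the growth of [L]; this supplies the constant for bounded convergence. The test
    functions that are singular at 0 are shifted by a small parameter, which keeps three derivatives
    bounded on the half-line. Those bounds blow up as the shift tends to 0, but they only decide how
    fine the mesh must be: the constants of the generator estimates do not depend on the shift.
    Brownian motion is given by the laws of linear functionals and by independence on rectangles, so
    mixed moments come from polarisation, and independence has to be extended to bounded
    [F_s]-measurable factors. In (i) the start may be the corner itself, hence the need for the
    exponential test function; in (ii) the estimate starts at time 1, which makes the hitting time
    positive whatever the start. *)

Lemma symmetric_spectral_radius_psd (R : realType) (n : nat) (S : 'M[R]_n) :
  S^T = S -> spectral_radius_lt1 S ->
  forall x : 'rV[R]_n, (x *m S *m x^T) 0 0 <= (x *m x^T) 0 0.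
Proof.
move=> symS radS x.
pose cS := map_mx (real_complex R) S; pose cx := map_mx (real_complex R) x.
have real_map m p (M : 'M[R]_(m, p)) :
    (map_mx (real_complex R) M) \is a mxOver Num.real.
  by apply/mxOverP=> i j; rewrite mxE; apply/complex_realP; exists (M i j).
(* Over the complex numbers the matrix is Hermitian, hence unitarily diagonalisable with real
   eigenvalues, each at most its modulus; in the eigenbasis both sides become weighted sums of
   [|y_j|^2]. *)
have hermS : cS \is hermsymmx.
  apply: realsym_hermsym; last exact: real_map.
  by apply/is_hermitianmxP; rewrite expr0 scale1r map_mx_id// /cS map_trmx symS.
set P := spectralmx cS; set sp := spectral_diag cS.
have Punit : P \is unitarymx := spectral_unitarymx cS.
have cSE : cS = P ^t* *m diag_mx sp *m P.
  rewrite -invmx_unitary//.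
  have nS := hermitian_normalmx hermS.
  by have /orthomx_spectralP := nS.
have sp_real := hermitian_spectral_diag_real hermS.
have PPt : P *m P ^t* = 1%:M by apply/unitarymxP.
have sp_le1 j : sp 0 j <= 1.
  have eig : eigenvalue cS (sp 0 j).
    apply/eigenvalueP; exists (row j P).
      rewrite cSE !mulmxA -row_mul PPt row1.
      by rewrite -rowE row_diag_mx -scalemxAl -rowE.
    apply/eqP => Pj0.
    have : row j P *m P ^t* = 0 by rewrite Pj0 mul0mx.
    rewrite -row_mul PPt => /rowP/(_ j); rewrite !mxE eqxx/= => /eqP.
    by rewrite oner_eq0.
  have /ltW := radS _ eig.
  by apply: le_trans; apply: real_ler_norm; move/mxOverP : sp_real; exact.
have cxJ : map_mx Num.conj cx = cx by apply: realmxC; exact: real_map.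
have yE : P *m cx^T = (map_mx Num.conj (cx *m P ^t*))^T.
  by rewrite map_mxM cxJ -map_mx_comp map_mx_id; last exact: conjCK; rewrite trmx_mul trmxK.
set y := cx *m P ^t* in yE.
have E1 : (cx *m cS *m cx^T) 0 0 = \sum_j sp 0 j * `|y 0 j| ^+ 2.
  rewrite cSE !mulmxA -(mulmxA _ P) yE mul_mx_diag mxE; apply: eq_bigr => j _.
  by rewrite !mxE normCK mulrCA mulrA.
have E2 : (cx *m cx^T) 0 0 = \sum_j `|y 0 j| ^+ 2.
  have -> : cx *m cx^T = y *m (P *m cx^T).
    rewrite /y -[in RHS]mulmxA (mulmxA (P ^t*)) -(invmx_unitary Punit).
    by rewrite mulVmx ?mul1mx// unitarymx_unit.
  by rewrite yE mxE; apply: eq_bigr => j _; rewrite !mxE normCK.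
have : (cx *m cS *m cx^T) 0 0 <= (cx *m cx^T) 0 0.
  rewrite E1 E2; apply: ler_sum => j _.
  by rewrite ler_piMl// exprn_ge0.
by rewrite /cx /cS map_trmx -!map_mxM [X in X <= _]mxE [X in _ <= X]mxE lecR.
Qed.

(** * Quadratic forms and positivity of RC *)

Definition qform {R : realType} {n : nat} (M : 'M[R]_n) (x y : 'cV[R]_n) : R :=
  (x^T *m M *m y) 0 0.

Section MMatrix.
Context {R : realType} {n : nat} (Rm : 'M[R]_n) (c : 'I_n -> R).
Hypotheses (HR : reflection_M_matrix Rm) (c0 : forall i, 0 < c i)
  (symRC : (Rm *m diagC c)^T = Rm *m diagC c).

(** A nonzero row vector killed by [Rm] would be fixed by [1 - Rm], giving the eigenvalue 1 that the
    spectral radius excludes. *)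
Lemma reflection_M_matrix_unit : Rm *m diagC c \in unitmx.
Proof.
have Cu : diagC c \in unitmx.
  rewrite unitmxE det_diag unitfE; apply/prodf_neq0 => i _.
  by rewrite mxE gt_eqF.
rewrite unitmx_mul Cu andbT.
have [_ _ rad] := HR.
have [//|Rnu] := boolP (Rm \in unitmx).
have : ~~ row_free Rm by rewrite row_free_unit.
rewrite -kermx_eq0 => /rowV0Pn[v /sub_kermxP vR v0].
have : eigenvalue (map_mx (real_complex R) (1%:M - Rm)) 1.
  apply/eigenvalueP; exists (map_mx (real_complex R) v).
    by rewrite -map_mxM mulmxBr mulmx1 vR subr0 scale1r.
  by rewrite map_mx_eq0.
by move=> /rad; rewrite normr1 ltxx.
Qed.

(** With [D] the square root of [C], the matrix [S = D^-1 (1 - R) D] has the spectrum of [1 - R] and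
    is symmetric because [R C] is. The spectral bound says that [1 - S] is nonnegative, and
    [D (1 - S) D = R C]. *)
Lemma reflection_M_matrix_psd (x : 'cV[R]_n) : 0 <= qform (Rm *m diagC c) x x.
Proof.
pose s i := Num.sqrt (c i).
have s0 i : 0 < s i by rewrite sqrtr_gt0.
have ss i : s i * s i = c i by rewrite -expr2 sqr_sqrtr// ltW.
pose D := diagC s; pose D' := diagC (fun i => (s i)^-1).
have DD : D *m D = diagC c.
  by rewrite mulmx_diag; congr diag_mx; apply/rowP => j; rewrite !mxE.
have DD' : D *m D' = 1%:M.
  rewrite mulmx_diag -diag_const_mx; congr diag_mx; apply/rowP => j.
  by rewrite !mxE divff// gt_eqF.
have D'D : D' *m D = 1%:M.
  rewrite mulmx_diag -diag_const_mx; congr diag_mx; apply/rowP => j.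
  by rewrite !mxE mulVf// gt_eqF.
have [_ _ rad] := HR.
pose S := D' *m (1%:M - Rm) *m D.
have symS : S^T = S.
  have e : Rm *m D *m D = D *m D *m Rm^T.
    rewrite -mulmxA DD -[LHS]symRC trmx_mul; congr (_ *m _).
    exact: tr_diag_mx.
  have e2 : D' *m Rm *m D = D *m Rm^T *m D'.
    transitivity (D' *m (Rm *m D *m D) *m D').
      by rewrite -!mulmxA DD' mulmx1.
    by rewrite e !mulmxA D'D mul1mx.
  rewrite /S !trmx_mul !tr_diag_mx linearB/= trmx1 !mulmxBr !mulmxBl !mulmx1.
  by rewrite mul1mx mulmxBr -/(diagC s) -/(diagC _) -/D -/D' DD' D'D !mulmxA -e2.
have radS : spectral_radius_lt1 S.
  move=> a /eigenvalueP[v vS v0]; apply: rad; apply/eigenvalueP.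
  pose mc := map_mx (real_complex R) : 'M[R]_n -> _.
  exists (v *m mc D').
    transitivity (v *m mc S *m mc D').
      rewrite -!mulmxA -/(mc _) /mc -!map_mxM /S; congr (_ *m map_mx _ _).
      by rewrite -!mulmxA DD' mulmx1.
    by rewrite vS scalemxAl.
  apply: contra_neq v0 => vD.
  by rewrite -[v]mulmx1 -(map_mx1 (real_complex R)) -D'D map_mxM mulmxA vD mul0mx.
have := symmetric_spectral_radius_psd symS radS (x^T *m D).
rewrite trmx_mul trmxK tr_diag_mx -subr_ge0 => h.
suff -> : qform (Rm *m diagC c) x x =
  (x^T *m D *m (D *m x)) 0 0 - (x^T *m D *m S *m (D *m x)) 0 0 by [].
have -> : x^T *m D *m S *m (D *m x) = x^T *m D *m (D *m x) - x^T *m (Rm *m (D *m D)) *m x.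
  rewrite /S !mulmxBr !mulmxBl !mulmx1 mulmxBr D'D mulmx1 !mulmxA.
  by rewrite !mulmxBl -!(mulmxA _ D D') DD' mulmx1.
have subE (a b : 'M[R]_1) : (a - b) 0 0 = a 0 0 - b 0 0 by rewrite !mxE.
by rewrite subE subKr /qform DD.
Qed.

End MMatrix.

Section QuadraticForm.
Context {R : realType} {n : nat}.
Implicit Types (M : 'M[R]_n) (x y : 'cV[R]_n).

Lemma qformDl M x x' y : qform M (x + x') y = qform M x y + qform M x' y.
Proof. by rewrite /qform linearD/= !mulmxDl mxE. Qed.

Lemma qformDr M x y y' : qform M x (y + y') = qform M x y + qform M x y'.
Proof. by rewrite /qform mulmxDr mxE. Qed.

Lemma qformZr M x a y : qform M x (a *: y) = a * qform M x y.
Proof. by rewrite /qform -scalemxAr mxE. Qed.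

Lemma qformZl M a x y : qform M (a *: x) y = a * qform M x y.
Proof. by rewrite /qform linearZ/= -!scalemxAl mxE. Qed.

Lemma qformC M x y : M^T = M -> qform M x y = qform M y x.
Proof.
move=> sM; rewrite /qform.
rewrite -[in LHS](trmxK (x^T *m M *m y)) mxE.
by rewrite !trmx_mul trmxK sM mulmxA.
Qed.

Lemma qformE M x y : qform M x y = \sum_i \sum_j M i j * (x i 0 * y j 0).
Proof.
rewrite /qform mxE exchange_big/=; apply: eq_bigr => j _.
rewrite mxE big_distrl/=; apply: eq_bigr => i _.
by rewrite mxE mulrCA mulrA.
Qed.

Lemma qform_Cauchy_Schwarz M x y : M^T = M -> (forall u, 0 <= qform M u u) ->
  qform M x y ^+ 2 <= qform M x x * qform M y y.
Proof.
move=> sM psd.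
have key a b : 0 <= a ^+ 2 * qform M x x + 2 * a * b * qform M x y +
                    b ^+ 2 * qform M y y.
  have := psd (a *: x + b *: y).
  rewrite !(qformDl, qformDr, qformZl, qformZr) (qformC y x sM).
  by congr (_ <= _); ring.
have := psd x; have := psd y.
set p := qform M x x; set q := qform M y y; set r := qform M x y in key * => q0 p0.
have [p1|p1] := ltP 0 p.
  have := key (- r) p.
  rewrite -/p -/q -/r => h.
  have : 0 <= p * (p * q - r ^+ 2) by move: h; congr (_ <= _); ring.
  by rewrite pmulr_rge0// subr_ge0.
have p00 : p = 0 by apply/eqP; rewrite eq_le p1 p0.
rewrite p00 mul0r; have [->|r0] := eqVneq r 0; first by rewrite expr0n.
(* When [x] is isotropic but [r] is not 0, the form is affine in [a] at [b = 1]; this [a] gives it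
   the value -1. *)
have := key (- (q + 1) / (2 * r)) 1; rewrite -/p -/q -/r p00.
have -> : (- (q + 1) / (2 * r)) ^+ 2 * 0 + 2 * (- (q + 1) / (2 * r)) * 1 * r +
  1 ^+ 2 * q = -1 by field.
by rewrite ler0N1.
Qed.
End QuadraticForm.

(** * The Lyapunov function V *)

Section Lyapunov.
Context {R : realType} {n : nat} (Rm : 'M[R]_n) (c : 'I_n -> R).
Hypotheses (HR : reflection_M_matrix Rm) (c0 : forall i, 0 < c i)
  (symRC : (Rm *m diagC c)^T = Rm *m diagC c).
Let Om := invmx (Rm *m diagC c).
Let V (x : 'cV[R]_n) := qform Om x x.

Lemma Omega_sym : Om^T = Om.
Proof. by rewrite /Om trmx_inv symRC. Qed.

Lemma mulKOmega k (x : 'M[R]_(n, k)) : Rm *m diagC c *m (Om *m x) = x.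
Proof. exact: mulKVmx (reflection_M_matrix_unit HR c0) _. Qed.

Lemma Omega_psd x : 0 <= V x.
Proof.
have := reflection_M_matrix_psd HR c0 symRC (Om *m x).
by rewrite /V /qform trmx_mul Omega_sym -(mulmxA (x^T *m Om)) mulKOmega.
Qed.

(** Cauchy-Schwarz for [R C] between the basis vector [e_i] and [Om x], as the diagonal entries of
    [R C] are the [c i]. It yields both the definiteness of [V] and the boundedness of its level
    sets. *)
Lemma coord_sqr_le (x : 'cV[R]_n) i : x i 0 ^+ 2 <= c i * V x.
Proof.
have := qform_Cauchy_Schwarz (delta_mx i 0) (Om *m x) symRC
  (reflection_M_matrix_psd HR c0 symRC).
have -> : qform (Rm *m diagC c) (delta_mx i 0) (Om *m x) = x i 0.
  by rewrite /qform -(mulmxA (_^T)) mulKOmega trmx_delta -rowE mxE.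
have -> : qform (Rm *m diagC c) (Om *m x) (Om *m x) = V x.
  by rewrite /qform trmx_mul Omega_sym -(mulmxA (x^T *m Om)) mulKOmega.
have [Rii _ _] := HR.
have -> // : qform (Rm *m diagC c) (delta_mx i 0) (delta_mx i 0) = c i.
by rewrite /qform trmx_delta -rowE -colE mul_mx_diag !mxE Rii mul1r.
Qed.

Lemma V0_eq0 x : V x = 0 -> x = 0.
Proof.
move=> Vx0; apply/colP => i; rewrite mxE; apply/eqP; rewrite -sqrf_eq0.
by rewrite eq_le sqr_ge0 andbT; have := coord_sqr_le x i; rewrite Vx0 mulr0.
Qed.

Lemma V_gt0 x : x != 0 -> 0 < V x.
Proof.
by move=> x0; rewrite lt_neqAle Omega_psd andbT eq_sym; apply: contra_neq x0 => /V0_eq0.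
Qed.

Lemma OmegaR : Om *m Rm = diagC (fun i => (c i)^-1).
Proof.
have Mu := reflection_M_matrix_unit HR c0.
have CC : diagC c *m diagC (fun i => (c i)^-1) = 1%:M.
  rewrite mulmx_diag -diag_const_mx; congr diag_mx; apply/rowP => j.
  by rewrite !mxE divff// gt_eqF.
by rewrite -[LHS]mulmx1 -CC mulmxA -(mulmxA Om) mulVmx// mul1mx.
Qed.

(* The reflection terms cancel to first order because Om *m Rm is diagonal and
   z i * l i vanishes along the process. *)
Lemma V_reflection (z l : 'cV[R]_n) :
  V z - V (z - Rm *m l) = 2 * \sum_i z i 0 * l i 0 / c i -
    \sum_i \sum_j Rm i j / c i * (l i 0 * l j 0).
Proof.
have dE (x : 'cV[R]_n) i : (diagC (fun i => (c i)^-1) *m x) i 0 = x i 0 / c i.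
  by rewrite mul_diag_mx !mxE mulrC.
have E1 : qform Om z (Rm *m l) = \sum_i z i 0 * l i 0 / c i.
  rewrite /qform -mulmxA (mulmxA Om) OmegaR mxE; apply: eq_bigr => i _.
  by rewrite dE mxE mulrA.
have E2 : qform Om (Rm *m l) (Rm *m l) = \sum_i \sum_j Rm i j / c i * (l i 0 * l j 0).
  rewrite (_ : qform _ _ _ = ((Rm *m l)^T *m (Om *m Rm *m l)) 0 0); last first.
    by rewrite /qform !mulmxA.
  rewrite OmegaR mxE; apply: eq_bigr => i _.
  rewrite dE !mxE big_distrl/=; apply: eq_bigr => j _; by field; rewrite gt_eqF.
rewrite -E1 -E2 -(scaleN1r (Rm *m l)) /V !(qformDl, qformDr, qformZl, qformZr).
by rewrite (qformC (Rm *m l) z Omega_sym); ring.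
Qed.

Lemma V_increment (x b : 'cV[R]_n) :
  V (x + b) - V x = \sum_i 2 * (Om *m x) i 0 * b i 0 +
                    \sum_i \sum_j Om i j * (b i 0 * b j 0).
Proof.
rewrite -qformE (_ : \sum_i _ = 2 * qform Om x b).
  by rewrite /V !(qformDl, qformDr) (qformC b x Omega_sym); ring.
rewrite /qform mxE big_distrr/=; apply: eq_bigr => i _.
rewrite mulrA; congr (_ * _ * _).
have : (Om *m x)^T = x^T *m Om by rewrite trmx_mul Omega_sym.
by move/matrixP/(_ 0 i); rewrite mxE.
Qed.

Definition form_bound (M : 'M[R]_n) :=
  \sum_i \sum_j `|M i j| * (c i + c j).

(** The constant is crude, since only finiteness matters: it bounds the set of ratios from above, so
    that [sup] is a true least upper bound and not a default value. *)
Lemma qform_le_V M x : `|qform M x x| <= form_bound M * V x.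
Proof.
rewrite qformE big_distrl/=; apply: le_trans (ler_norm_sum _ _ _) _.
apply: ler_sum => i _; rewrite big_distrl/=.
apply: le_trans (ler_norm_sum _ _ _) _; apply: ler_sum => j _.
rewrite normrM -mulrA ler_wpM2l//.
have := coord_sqr_le x i; have := coord_sqr_le x j.
rewrite normrM mulrDl.
rewrite -(real_normK (num_real (x i 0))) -(real_normK (num_real (x j 0))).
nra.
Qed.

Variables (A : 'M[R]_n) (mu : 'cV[R]_n).
Hypothesis HA : sym_pos_def A.

Lemma Omega_A_bounds x : x \in @orthant R n ->
  c_minus Om A * V x <= qform A (Om *m x) (Om *m x) <= c_plus Om A * V x.
Proof.
move=> xS.
have qE y : (y^T *m Om *m A *m Om *m y) 0 0 = qform A (Om *m y) (Om *m y).
  by rewrite /qform trmx_mul Omega_sym !mulmxA.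
have [->|x0] := eqVneq x 0.
  by rewrite /V /qform !mulmx0 !mxE !mulr0 lexx.
have Vx := V_gt0 x0.
have rin : ratio_set Om A (rayleigh_ratio Om A x).
  by exists x => //; split => //; [exact/set_mem | exact/eqP].
have ub : has_ubound (ratio_set Om A).
  exists (form_bound (Om *m A *m Om)) => _ [y [_ /eqP y0] <-].
  rewrite /rayleigh_ratio ler_pdivrMr ?V_gt0//.
  have -> : (y^T *m Om *m A *m Om *m y) 0 0 = qform (Om *m A *m Om) y y.
    by rewrite /qform !mulmxA.
  exact: le_trans (ler_norm _) (qform_le_V _ _).
have lb : has_lbound (ratio_set Om A).
  exists 0 => _ [y [_ /eqP y0] <-].
  rewrite /rayleigh_ratio divr_ge0//; last exact: Omega_psd.
  rewrite qE; have [->|h] := eqVneq (Om *m y) 0.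
    by rewrite /qform mulmx0 mxE.
  by have [_ /(_ _ h) /ltW] := HA.
rewrite -qE; apply/andP; split.
  by rewrite -ler_pdivlMr//; exact: (ge_inf lb rin).
by rewrite -ler_pdivrMr//; exact: (ub_le_sup ub rin).
Qed.

Lemma drift_bound x : `|qform Om x mu| <= Num.sqrt (V mu) * Num.sqrt (V x).
Proof.
rewrite -sqrtrM ?Omega_psd// -sqrtr_sqr ler_wsqrtr// mulrC.
exact: qform_Cauchy_Schwarz Omega_sym Omega_psd.
Qed.

Lemma trace_sum : \tr (Om *m A) = \sum_i \sum_j Om i j * A i j.
Proof.
rewrite /mxtrace; apply: eq_bigr => i _; rewrite mxE; apply: eq_bigr => j _.
by have [sA _] := HA; rewrite -[in LHS]sA mxE.
Qed.

(** Positivity comes from the ratio at a basis vector, which lies in the orthant; under the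
    assumption of (i) it makes the trace positive. *)
Lemma c_plus_gt0 : (0 < n)%N -> 0 < c_plus Om A.
Proof.
move=> n0; pose e : 'cV[R]_n := delta_mx (Ordinal n0) 0.
have e0 : e != 0.
  by apply/eqP => /colP/(_ (Ordinal n0)); rewrite !mxE !eqxx => /eqP; rewrite oner_eq0.
have eS : e \in @orthant R n by apply/mem_set => i; rewrite mxE ler0n.
have /andP[_] := Omega_A_bounds eS.
have Oe : Om *m e != 0.
  apply: contra_neq e0 => h; by rewrite -[e]mulKOmega h mulmx0.
have [_ /(_ _ Oe)] := HA; rewrite -/(qform A _ _) => h /(lt_le_trans h).
by rewrite pmulr_lgt0// V_gt0.
Qed.
End Lyapunov.

(** * Transfer of integrals and expectations *)

Section TransferIntegral.
Context {R : realType}.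
Import HBNNSimple.

Let weighted_nnsfun d (T : measurableType d) (m : {measure set T -> \bar R})
    (X p : T -> R) (h : {nnsfun R >-> R}) :
  measurable_fun setT X -> measurable_fun setT p -> (forall x, 0 <= p x) ->
  (\int[m]_x (h (X x) * p x)%:E = \sum_(r \in range h)
     (r%:E * \int[m]_(x in X @^-1` (h @^-1` [set r])) (p x)%:E))%E.
Proof.
move=> mX mp p0.
transitivity (\int[m]_x (\sum_(r \in range h)
    (r * (\1_(h @^-1` [set r]) (X x) * p x))%:E))%E.
  apply: eq_integral => x _; rewrite EFinM fimfunE -fsumEFin//.
  rewrite ge0_mule_fsuml => [|r]; last exact: nnfun_muleindic_ge0.
  by apply: eq_fsbigr => r _; rewrite -EFinM mulrA.
have mind r : measurable_fun [set: T] (fun x => \1_(h @^-1` [set r]) (X x) * p x : R).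
  apply: measurable_funM => //.
  apply: measurableT_comp => //; apply: measurable_indic.
rewrite ge0_integral_fsum//=; last 2 first.
- by move=> r; apply/measurable_EFinP/measurable_funM.
- move=> r x _; rewrite lee_fin.
  have [->|r0] := eqVneq (\1_(h @^-1` [set r]) (X x) : R) 0; first by rewrite mul0r mulr0.
  rewrite mulr_ge0 ?mulr_ge0//.
  move: r0; rewrite indicE; case: (boolP (_ \in _)) => [|]; last by rewrite eqxx.
  by rewrite inE /= => <- _; exact: fun_ge0.
apply: eq_fsbigr => r; rewrite inE => -[y _ hy].
have r0 : 0 <= r by rewrite -hy; exact: fun_ge0.
under eq_integral do rewrite EFinM.
rewrite ge0_integralZl_EFin//; first last.
- exact/measurable_EFinP.
- by move=> x _; rewrite lee_fin mulr_ge0.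
congr (_ * _)%E; rewrite [RHS]integral_mkcond; apply: eq_integral => x _.
rewrite patchE indicE /=.
have -> : (x \in X @^-1` (h @^-1` [set r])) = (X x \in h @^-1` [set r]).
  by apply/idP/idP; rewrite !inE.
by case: ifPn => xr; rewrite ?mul1r ?mul0r.
Qed.

(** Two weighted image measures that agree on sets agree on nonnegative functions. The weights let
    one lemma serve for a law given by a density and for the positive and negative parts of a random
    variable, seen as densities on the same space. *)
Lemma ge0_integral_transfer d1 (T1 : measurableType d1) d2 (T2 : measurableType d2)
    (m1 : {measure set T1 -> \bar R}) (m2 : {measure set T2 -> \bar R})
    (X1 p1 : T1 -> R) (X2 p2 : T2 -> R) (f : R -> R) :
  measurable_fun setT X1 -> measurable_fun setT p1 -> (forall x, 0 <= p1 x) ->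
  measurable_fun setT X2 -> measurable_fun setT p2 -> (forall x, 0 <= p2 x) ->
  (forall E, measurable E -> \int[m1]_(x in X1 @^-1` E) (p1 x)%:E =
                             \int[m2]_(x in X2 @^-1` E) (p2 x)%:E)%E ->
  measurable_fun setT f -> (forall x, 0 <= f x) ->
  (\int[m1]_x (f (X1 x) * p1 x)%:E = \int[m2]_x (f (X2 x) * p2 x)%:E)%E.
Proof.
move=> mX1 mp1 p10 mX2 mp2 p20 eqE mf f0.
have mf' : measurable_fun setT (EFin \o f) by exact/measurable_EFinP.
pose h := nnsfun_approx measurableT mf'.
have hcvg d (T : measurableType d) (m : {measure set T -> \bar R}) (X p : T -> R) :
    measurable_fun setT X -> measurable_fun setT p -> (forall x, 0 <= p x) ->
    (\int[m]_x (f (X x) * p x)%:E =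
     lim (\int[m]_x (h n (X x) * p x)%:E @[n --> \oo]))%E.
  move=> mX mp p0; rewrite -monotone_convergence//=.
  - apply: eq_integral => x _; apply/esym/cvg_lim => //=.
    rewrite EFinM; under eq_fun do rewrite EFinM.
    apply: cvgeZr => //.
    by apply: (cvg_nnsfun_approx measurableT mf') => // y _; rewrite lee_fin.
  - move=> n; apply/measurable_EFinP/measurable_funM => //.
    exact: measurableT_comp.
  - by move=> n x _; rewrite lee_fin mulr_ge0.
  - move=> x _ a b ab; rewrite lee_fin ler_wpM2r//.
    exact/lefP/nd_nnsfun_approx.
rewrite !hcvg//; apply: congr_lim; apply/funext => n /=.
rewrite !weighted_nnsfun//; apply: eq_fsbigr => r _.
by rewrite eqE.
Qed.
End TransferIntegral.

Section Expectation.
Context {R : realType} {d : measure_display} {T : measurableType d}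
  (P : probability T R).
Implicit Types f g X Y : T -> R.

Definition L1 f := P.-integrable setT (EFin \o f).
Definition Ex f : R := \int[P]_w f w.

Lemma L1_measurable f : L1 f -> measurable_fun setT f.
Proof. by move=> /integrableP[/measurable_EFinP]. Qed.

Lemma L1_dominated f g : measurable_fun setT f -> (forall w, `|f w| <= g w) ->
  L1 g -> L1 f.
Proof.
move=> mf fg; apply: le_integrable => //; first exact/measurable_EFinP.
by move=> w _; rewrite /= lee_fin (le_trans (fg w))// ler_norm.
Qed.

Lemma L1_cst k : L1 (fun _ => k).
Proof. exact: finite_measure_integrable_cst. Qed.

Lemma L1_bounded f k : measurable_fun setT f -> (forall w, `|f w| <= k) -> L1 f.
Proof. by move=> mf fk; apply: L1_dominated (L1_cst k). Qed.

Lemma L1D f g : L1 f -> L1 g -> L1 (fun w => f w + g w).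
Proof. by move=> If Ig; exact: (integrableD _ If Ig). Qed.

Lemma L1Z k f : L1 f -> L1 (fun w => k * f w).
Proof.
move=> If; rewrite /L1 (_ : _ \o _ = (fun w => k%:E * (f w)%:E)%E).
  exact: integrableZl.
by apply/funext => w /=; rewrite EFinM.
Qed.

Lemma L1B f g : L1 f -> L1 g -> L1 (fun w => f w - g w).
Proof. by move=> If Ig; exact: (integrableB _ If Ig). Qed.

Lemma L1_norm f : L1 f -> L1 (fun w => `|f w|).
Proof. exact: integrable_norm. Qed.

Lemma L1_sum I (s : seq I) (F : I -> T -> R) :
  (forall i, L1 (F i)) -> L1 (fun w => \sum_(i <- s) F i w).
Proof.
move=> IF; rewrite /L1 (_ : _ \o _ = (fun w => \sum_(i <- s) (F i w)%:E)%E).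
  by apply: integrable_sum => // i _; exact: IF.
by apply/funext => w /=; rewrite sumEFin.
Qed.

Lemma L1_bmul f g k : measurable_fun setT f -> (forall w, `|f w| <= k) ->
  L1 g -> L1 (fun w => f w * g w).
Proof.
move=> mf fk Ig; apply: (@L1_dominated _ (fun w => k * `|g w|)).
- by apply: measurable_funM => //; exact: L1_measurable.
- by move=> w; rewrite normrM ler_wpM2r.
- exact/L1Z/L1_norm.
Qed.

Lemma ExD f g : L1 f -> L1 g -> Ex (fun w => f w + g w) = Ex f + Ex g.
Proof. exact: RintegralD. Qed.

Lemma ExB f g : L1 f -> L1 g -> Ex (fun w => f w - g w) = Ex f - Ex g.
Proof. exact: RintegralB. Qed.

Lemma ExZ k f : L1 f -> Ex (fun w => k * f w) = k * Ex f.
Proof. by move=> If; exact: RintegralZl. Qed.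

Lemma Ex_sum I (s : seq I) (F : I -> T -> R) : (forall i, L1 (F i)) ->
  Ex (fun w => \sum_(i <- s) F i w) = \sum_(i <- s) Ex (F i).
Proof.
move=> IF; elim: s => [|i s IH].
  rewrite big_nil /Ex (_ : (fun w => _) = cst 0).
    by rewrite Rintegral_cst// mul0r.
  by apply/funext => w; rewrite big_nil.
rewrite big_cons -IH -ExD//; last exact: L1_sum.
by congr Ex; apply/funext => w; rewrite big_cons.
Qed.

Lemma Ex_le f g : L1 f -> L1 g -> (forall w, f w <= g w) -> Ex f <= Ex g.
Proof. by move=> If Ig fg; exact: le_Rintegral. Qed.

Lemma Ex_cst k : Ex (fun _ => k) = k.
Proof.
have PT : P setT = 1%E by exact: probability_setT.
by rewrite /Ex Rintegral_cst// [X in fine X]PT mulr1.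
Qed.

Lemma Ex_ge0 f : (forall w, 0 <= f w) -> 0 <= Ex f.
Proof. by move=> f0; exact: Rintegral_ge0. Qed.

Lemma Ex_norm f : L1 f -> `|Ex f| <= Ex (fun w => `|f w|).
Proof. by move=> If; exact: le_normr_Rintegral. Qed.

Lemma Ex_indic A : measurable A -> (Ex \1_A)%:E = P A.
Proof.
move=> mA; rewrite /Ex /Rintegral integral_indic// setIT fineK//.
exact: fin_num_measure.
Qed.

Lemma Ex_cvg0 (F : nat -> T -> R) k : (forall N, measurable_fun setT (F N)) ->
  (forall N w, `|F N w| <= k) -> (forall w, F N w @[N --> \oo] --> (0 : R)) ->
  Ex (F N) @[N --> \oo] --> (0 : R).
Proof.
move=> mF Fk F0.
have F0e w : (F N w)%:E @[N --> \oo] --> (0%:E : \bar R).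
  by apply: cvg_EFin; [exact: nearW | exact: F0].
have [_ _] := @dominated_convergence _ _ _ P setT measurableT
  (fun N w => (F N w)%:E) (cst 0%E) (cst k%:E)
  (fun N => (measurable_EFinP _ _).2 (mF N)) (measurable_cst _)
  (aeW P (fun w _ => F0e w)) (L1_cst k) (aeW P (fun w N _ => Fk N w)).
rewrite integral0.
exact: fine_cvg.
Qed.

Lemma ge0_L1_Ex f r : measurable_fun setT f -> (forall w, 0 <= f w) ->
  (\int[P]_w (f w)%:E = r%:E)%E -> L1 f /\ Ex f = r.
Proof.
move=> mf f0 fr; split; last by rewrite /Ex /Rintegral fr.
apply/integrableP; split; first exact/measurable_EFinP.
by under eq_integral do rewrite /= ger0_norm//; rewrite fr ltry.
Qed.

Lemma ge0_ExE f : L1 f -> (\int[P]_w (f w)%:E = (Ex f)%:E)%E.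
Proof. by move=> If; rewrite /Ex /Rintegral fineK//; exact: integrable_fin_num. Qed.

(** The hypothesis says that the positive and negative parts of [X], taken as densities, have the
    same image under [Y]; hence they integrate each of the two parts of [Y] equally. This is the
    tool that passes from events to random variables. *)
Lemma Ex_orthogonal X Y : measurable_fun setT Y -> L1 X -> L1 (fun w => X w * Y w) ->
  (forall S, measurable S -> Ex (fun w => X w * \1_(Y @^-1` S) w) = 0) ->
  Ex (fun w => X w * Y w) = 0.
Proof.
move=> mY IX IXY H.
pose pos (r : R) := Num.max r 0.
have mpos : measurable_fun setT pos by exact: measurable_maxr.
have pos0 r : 0 <= pos r by rewrite le_max lexx orbT.
have posB r : pos r - pos (- r) = r by rewrite /pos; case: (leP r 0) => r0; rewrite ?oppr_ge0 ?oppr_le0; case: (leP (- r) 0); lra.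
have mX := L1_measurable IX.
have poslen r : `|pos r| <= `|r| by rewrite /pos; case: (leP r 0) => r0; rewrite ?normr0.
have mposc f : measurable_fun setT f -> measurable_fun setT (pos \o f).
  by move=> mf; exact: measurableT_comp.
have Ipos f : L1 f -> L1 (pos \o f).
  move=> If; apply: (@L1_dominated _ (fun w => `|f w|)).
  - exact/mposc/L1_measurable.
  - by move=> w /=.
  - exact: L1_norm.
have mopp f : measurable_fun setT f -> measurable_fun setT (fun w => - f w).
  by move=> mf; exact: measurableT_comp.
have IXn : L1 (fun w => - X w) by rewrite (_ : (fun _ => _) = (fun w => -1 * X w)); [exact: L1Z|apply/funext => w; rewrite mulN1r].
have mind S : measurable S -> measurable (Y @^-1` S).
  by move=> mS; rewrite -[X in measurable X]setTI; exact: mY.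
have eqS S : measurable S ->
   (\int[P]_(w in Y @^-1` S) (pos (X w))%:E =
    \int[P]_(w in Y @^-1` S) (pos (- X w))%:E)%E.
  move=> mS.
  have Ii f : L1 f -> L1 (fun w => \1_(Y @^-1` S) w * f w).
    move=> If; apply: (@L1_bmul _ _ 1) => //; first exact/measurable_indic/mind.
    by move=> w; rewrite indicE; case: (_ \in _); rewrite ?normr1 ?normr0.
  have toE f : L1 f -> (\int[P]_(w in Y @^-1` S) (f w)%:E =
      (Ex (fun w => \1_(Y @^-1` S) w * f w))%:E)%E.
    move=> If; rewrite -ge0_ExE; last exact: Ii.
    rewrite integral_mkcond; apply: eq_integral => w _.
    by rewrite patchE indicE; case: ifPn => _; rewrite ?mul1r ?mul0r.
  rewrite (toE _ (Ipos _ IX)) (toE _ (Ipos _ IXn)); congr EFin.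
  apply/eqP; rewrite -subr_eq0 -ExB; [|exact/Ii/Ipos|exact/Ii/Ipos].
  apply/eqP; rewrite -[RHS](H _ mS); congr Ex; apply/funext => w /=.
  by rewrite -mulrBr posB mulrC.
have tr (f : R -> R) : measurable_fun setT f -> (forall r, 0 <= f r) ->
    (forall r, f r <= `|r|) ->
    Ex (fun w => f (Y w) * pos (X w)) = Ex (fun w => f (Y w) * pos (- X w)) /\
    L1 (fun w => f (Y w) * pos (X w)) /\ L1 (fun w => f (Y w) * pos (- X w)).
  move=> mf f0 fle; split.
    rewrite /Ex /Rintegral; congr fine.
    apply: ge0_integral_transfer => //; first exact: mposc.
    exact/mposc/mopp.
  have mfY : measurable_fun setT (f \o Y) by exact: measurableT_comp.
  split; apply: (@L1_dominated _ (fun w => `|X w * Y w|)); try exact: L1_norm.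
  - by apply: measurable_funM => //; exact: mposc.
  - move=> w; rewrite !normrM mulrC ler_pM//.
    by rewrite ger0_norm.
  - by apply: measurable_funM => //; exact/mposc/mopp.
  - move=> w; rewrite !normrM mulrC ler_pM//; last by rewrite ger0_norm.
    by rewrite (le_trans (poslen _))// normrN.
have [e1 [a1 b1]] := tr pos mpos pos0 (fun r => le_trans (ler_norm _) (poslen r)).
have [] := tr (fun r => pos (- r)).
- by apply: measurableT_comp.
- by [].
- by move=> r; rewrite -normrN; exact: le_trans (ler_norm _) (poslen _).
move=> e2 [a2 b2].
have -> : (fun w => X w * Y w) = (fun w =>
   (pos (Y w) * pos (X w) - pos (Y w) * pos (- X w)) -
   (pos (- Y w) * pos (X w) - pos (- Y w) * pos (- X w))).
  by apply/funext => w; rewrite -{1}(posB (X w)) -{1}(posB (Y w)); ring.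
by rewrite !ExB// ?e1 ?e2 ?subrr//; exact: L1B.
Qed.

End Expectation.

(** * Moments of a Gaussian variable *)

Section NormalMoments.
Context {R : realType} {d : measure_display} {T : measurableType d}
  (P : probability T R) (X : T -> R) (m s : R).
Hypotheses (mX : measurable_fun setT X) (s0 : 0 < s)
  (lawX : forall Y, measurable Y -> P (X @^-1` Y) = normal_prob m s Y).

Lemma normal_integral (f : R -> R) (k m' s' : R) :
  measurable_fun setT f -> (forall x, 0 <= f x) -> 0 <= k ->
  (forall x, f x * normal_pdf m s x = k * normal_pdf m' s' x) ->
  L1 P (f \o X) /\ Ex P (f \o X) = k.
Proof.
move=> mf f0 k0 fk; apply: ge0_L1_Ex; [exact: measurableT_comp|by move=> w /=|].
transitivity (\int[P]_w (f (X w) * 1)%:E)%E.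
  by apply: eq_integral => w _; rewrite mulr1.
rewrite (@ge0_integral_transfer _ _ _ _ _ P lebesgue_measure X (fun=> 1)
  id (normal_pdf m s))//.
- under eq_integral do rewrite fk EFinM.
  rewrite ge0_integralZl_EFin//.
    by rewrite integral_normal_pdf mule1.
    by move=> x _; rewrite lee_fin normal_pdf_ge0.
  by apply/measurable_EFinP; exact: measurable_normal_pdf.
- exact: measurable_normal_pdf.
- by move=> x; exact: normal_pdf_ge0.
- move=> E mE; rewrite integral_cst//.
    by rewrite mul1e; exact: lawX.
  by rewrite -[X in measurable X]setTI; exact: mX.
Qed.

Let U (x : R) := (x - m) / s.

Let mU : measurable_fun setT U.
Proof. by apply: measurable_funM => //; exact: measurable_funB. Qed.

Lemma normal_mgf (a : R) :
  L1 P (fun w => expR (a * U (X w))) /\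
  Ex P (fun w => expR (a * U (X w))) = expR (a ^+ 2 / 2).
Proof.
apply: (@normal_integral (fun x => expR (a * U x)) _ (m + a * s) s).
- apply: measurableT_comp => //; exact: measurable_funM.
- by move=> x; exact: expR_ge0.
- exact: expR_ge0.
- move=> x; rewrite !normal_pdfE ?gt_eqF// /normal_fun.
  rewrite !(mulrCA _ (normal_peak s)) -!expRD; congr (_ * expR _).
  by rewrite /U; field; rewrite gt_eqF.
Qed.

Lemma normal_square_mgf (b : R) : b < 1 / 2 ->
  L1 P (fun w => expR (b * U (X w) ^+ 2)) /\
  Ex P (fun w => expR (b * U (X w) ^+ 2)) = (Num.sqrt (1 - 2 * b))^-1.
Proof.
move=> b2; have b0 : 0 < 1 - 2 * b by lra.
set k := Num.sqrt _; have k0 : 0 < k by rewrite sqrtr_gt0.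
have kk : k ^+ 2 = 1 - 2 * b by rewrite sqr_sqrtr// ltW.
have sk0 : 0 < s / k by rewrite divr_gt0.
apply: (@normal_integral (fun x => expR (b * U x ^+ 2)) _ m (s / k)).
- apply: measurableT_comp => //; apply: measurable_funM => //.
  exact: measurable_funX.
- by move=> x; exact: expR_ge0.
- by rewrite invr_ge0 ltW.
- move=> x; rewrite !normal_pdfE ?gt_eqF// /normal_fun.
  rewrite [LHS]mulrCA [RHS]mulrA [k^-1 * _](_ : _ = normal_peak s); last first.
    rewrite /normal_peak -invfM; congr (_^-1).
    rewrite -[X in X * _]ger0_norm ?(ltW k0)// -sqrtr_sqr -sqrtrM ?sqr_ge0//.
    by congr (Num.sqrt _); field; rewrite gt_eqF.
  rewrite -expRD; congr (_ * expR _).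
  have -> : b = (1 - k ^+ 2) / 2 by rewrite kk; field.
  by rewrite /U; field; rewrite !gt_eqF.
Qed.

Let mUX : measurable_fun setT (U \o X).
Proof. exact: measurableT_comp. Qed.

(** Squaring [e^(u^2/8) >= 1 + u^2/8] gives [u^4 <= 64 e^(u^2/4)], and the exponential has mean
    [sqrt 2 <= 2]. Only the finiteness of the constant is used. *)
Let fourth : L1 P (fun w => U (X w) ^+ 4) /\ Ex P (fun w => U (X w) ^+ 4) <= 64 * 2.
Proof.
have [I1 E1] : L1 P (fun w => expR (1 / 4 * U (X w) ^+ 2)) /\
  Ex P (fun w => expR (1 / 4 * U (X w) ^+ 2)) = (Num.sqrt (1 - 2 * (1 / 4)))^-1.
  by apply: normal_square_mgf; lra.
have le4 w : U (X w) ^+ 4 <= 64 * expR (1 / 4 * U (X w) ^+ 2).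
  set u := U (X w).
  have -> : 1 / 4 * u ^+ 2 = u ^+ 2 / 8 + u ^+ 2 / 8 by field.
  rewrite expRD.
  have := expR_ge1Dx (u ^+ 2 / 8); set e := expR _ => h.
  have : 0 <= u ^+ 2 by exact: sqr_ge0.
  have -> : u ^+ 4 = u ^+ 2 * u ^+ 2 by rewrite -exprD.
  move: h; set v := u ^+ 2 => h v0; nra.
have I4 : L1 P (fun w => U (X w) ^+ 4).
  apply: L1_dominated (L1Z 64 I1); first exact: measurable_funX.
  by move=> w; rewrite ger0_norm// (_ : 4 = 2 * 2)%N// exprM sqr_ge0.
split=> //; apply: le_trans (Ex_le I4 (L1Z 64 I1) le4) _.
rewrite ExZ// E1 ler_pM2l//.
set q := Num.sqrt _.
have q0 : 0 < q by rewrite sqrtr_gt0; lra.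
have qq : q ^+ 2 = 1 / 2 by rewrite sqr_sqrtr; lra.
rewrite -[leRHS]invrK lef_pV2 ?posrE ?invr_gt0//.
have [//|ql] := leP 2^-1 q.
have : q ^+ 2 < 2^-1 ^+ 2 by rewrite ltr_pXn2r ?nnegrE// ltW.
by rewrite qq; lra.
Qed.

(** No differentiation under the integral: [e^(a U) >= 1 + a U] gives [1 + a E U <= e^(a^2/2)] for
    all [a], and small [a] of either sign force [E U = 0]. *)
Let ExU : L1 P (U \o X) /\ Ex P (U \o X) = 0.
Proof.
have IU : L1 P (U \o X).
  have [I1 _] := normal_mgf 1; have [I2 _] := normal_mgf (-1).
  apply: L1_dominated (L1D I1 I2) => // w /=.
  have := expR_ge1Dx (1 * U (X w)); have := expR_ge1Dx (-1 * U (X w)).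
  have := expR_ge0 (1 * U (X w)); have := expR_ge0 (-1 * U (X w)).
  by rewrite ler_norml; lra.
split=> //.
have le_a a : 1 + a * Ex P (U \o X) <= expR (a ^+ 2 / 2).
  have [I1 <-] := normal_mgf a.
  rewrite -{1}(Ex_cst P 1) -ExZ// -ExD//; [|exact: L1_cst|exact: L1Z].
  apply: Ex_le => //; first by apply: L1D; [exact: L1_cst|exact: L1Z].
  by move=> w; exact: expR_ge1Dx.
(* expR t <= 1 / (1 - t) turns the bound into a polynomial one *)
have le_b a : a ^+ 2 <= 1 -> a * Ex P (U \o X) <= a ^+ 2.
  move=> a1; have := le_a a; set x := a * _ => h.
  have := expR_ge1Dx (- (a ^+ 2 / 2)); rewrite expRN.
  set e := expR _ in h *; have e0 : 0 < e by exact: expR_gt0.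
  have a0 := sqr_ge0 a.
  move=> h2.
  have h3 : (1 - a ^+ 2 / 2) * e <= 1 by rewrite -ler_pdivlMr// div1r.
  nra.
apply/eqP; rewrite eq_le; apply/andP; split; rewrite leNgt; apply/negP => x0.
  pose a := Num.min 1 (Ex P (U \o X) / 2).
  have a0 : 0 < a by rewrite lt_min ltr01 divr_gt0.
  have a1 : a <= 1 by rewrite ge_min lexx.
  have a2 : a <= Ex P (U \o X) / 2 by rewrite ge_min lexx orbT.
  have : a * Ex P (U \o X) <= a ^+ 2 by apply: le_b; nra.
  by rewrite expr2 ler_pM2l//; lra.
pose a := Num.min 1 (- Ex P (U \o X) / 2).
have a0 : 0 < a by rewrite lt_min ltr01 divr_gt0 ?oppr_gt0.
have a1 : a <= 1 by rewrite ge_min lexx.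
have a2 : a <= - Ex P (U \o X) / 2 by rewrite ge_min lexx orbT.
have : - a * Ex P (U \o X) <= (- a) ^+ 2 by apply: le_b; nra.
by rewrite sqrrN expr2 mulNr -mulrN ler_pM2l//; lra.
Qed.

(** The same device with [e^(b U^2)]: [1 + b e <= (1 - 2 b)^(-1/2)] for small [b] of either sign
    forces the second moment [e] to be 1. *)
Let ExU2 : L1 P (fun w => U (X w) ^+ 2) /\ Ex P (fun w => U (X w) ^+ 2) = 1.
Proof.
have [I4 _] := fourth.
have I2 : L1 P (fun w => U (X w) ^+ 2).
  apply: L1_dominated (L1D (L1_cst P 1) I4); first exact: measurable_funX.
  move=> w; rewrite ger0_norm ?sqr_ge0//.
  have -> : U (X w) ^+ 4 = U (X w) ^+ 2 * U (X w) ^+ 2 by rewrite -exprD.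
  by move: (U (X w) ^+ 2) => v; nra.
split=> //; set e := Ex _ _.
have le_b b : b < 1 / 2 -> 1 + b * e <= (Num.sqrt (1 - 2 * b))^-1.
  move=> b2; have [I1 <-] := normal_square_mgf b2.
  rewrite -{1}(Ex_cst P 1) -ExZ// -ExD//; [|exact: L1_cst|exact: L1Z].
  apply: Ex_le => //; first by apply: L1D; [exact: L1_cst|exact: L1Z].
  by move=> w; exact: expR_ge1Dx.
have e0 : 0 <= e by apply: Ex_ge0 => w; exact: sqr_ge0.
have sq b : -1/4 <= b <= 1/4 -> (1 - 2 * b) * (1 + b * e) ^+ 2 <= 1 \/ 1 + b * e < 0.
  move=> /andP[b1 b2]; have [h|] := leP 0 (1 + b * e); last by right.
  have b0 : 0 < 1 - 2 * b by lra.
  have : 1 + b * e <= (Num.sqrt (1 - 2 * b))^-1 by apply: le_b; lra.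
  set k := Num.sqrt _; have k0 : 0 < k by rewrite sqrtr_gt0.
  have kk : k ^+ 2 = 1 - 2 * b by rewrite sqr_sqrtr// ltW.
  rewrite -div1r ler_pdivlMr// => h2; left.
  rewrite -kk -exprMn mulrC -[leRHS](expr1n _ 2) ler_pXn2r ?nnegrE//.
  by rewrite mulr_ge0// ltW.
apply/eqP; rewrite eq_le; apply/andP; split; rewrite leNgt; apply/negP => x0.
  (* Small enough that the first-order excess [2 b (e - 1)] beats the negative term [4 b^2 e] of the
     expanded product. *)
  pose b := Num.min (1/4) ((e - 1) / (4 * e)).
  have b0 : 0 < b by rewrite lt_min divr_gt0 ?divr_gt0// ?subr_gt0//; lra.
  have b1 : b <= 1/4 by rewrite ge_min lexx.
  have b2 : b * (4 * e) <= e - 1.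
    by rewrite -ler_pdivlMr ?ge_min ?lexx ?orbT//; lra.
  have [|h|h] := sq b; [apply/andP; split; lra| |nra].
  have h2 : b * (2 * (e - 1) - 4 * b * e) <= 0 by nra.
  have h3 : 0 < 2 * (e - 1) - 4 * b * e by nra.
  by have := mulr_gt0 b0 h3; rewrite ltNge h2.
pose b := - Num.min (1/4) ((1 - e) / 8).
have b0 : b < 0 by rewrite oppr_lt0 lt_min divr_gt0 ?divr_gt0// ?subr_gt0//; lra.
have b1 : -1/4 <= b.
  have : Num.min (1/4) ((1 - e) / 8) <= 1/4 by rewrite ge_min lexx.
  by rewrite /b; lra.
have b2 : - b <= (1 - e) / 8 by rewrite opprK ge_min lexx orbT.
have [|h|h] := sq b; [apply/andP; split; lra| |nra].
have h2 : b * (2 * (e - 1) - 4 * b * e) <= 0 by nra.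
have : 2 * (e - 1) - 4 * b * e < 0 by nra.
move=> h3; have : 0 < b * (2 * (e - 1) - 4 * b * e) by rewrite nmulr_rgt0.
by rewrite ltNge h2.
Qed.

Lemma normal_moments :
  [/\ L1 P X, Ex P X = m,
      L1 P (fun w => X w ^+ 2) /\ Ex P (fun w => X w ^+ 2) = m ^+ 2 + s ^+ 2 &
      L1 P (fun w => X w ^+ 4) /\
      Ex P (fun w => X w ^+ 4) <= 8 * (m ^+ 4 + 128 * s ^+ 4)].
Proof.
have [I1 E1] := ExU; have [I2 E2] := ExU2; have [I4 E4] := fourth.
have XE w : X w = m + s * U (X w) by rewrite /U; field; rewrite gt_eqF.
have e1 : X = fun w => m + s * (U \o X) w by apply/funext => w; exact: XE.
have e2 : (fun w => X w ^+ 2) = fun w => (m ^+ 2 + 2 * m * s * (U \o X) w) + s ^+ 2 * (U (X w) ^+ 2).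
  by apply/funext => w; rewrite [in LHS]XE /=; ring.
have J4 : L1 P (fun w => 8 * m ^+ 4 + 8 * s ^+ 4 * U (X w) ^+ 4).
  by apply: L1D; [exact: L1_cst|exact: L1Z].
have le4 w : X w ^+ 4 <= 8 * m ^+ 4 + 8 * s ^+ 4 * U (X w) ^+ 4.
  rewrite [in leLHS]XE; move: (U (X w)) => u.
  have -> : 8 * s ^+ 4 * u ^+ 4 = 8 * (s * u) ^+ 4 by ring.
  move: (s * u) => v.
  have -> : 8 * m ^+ 4 + 8 * v ^+ 4 = (m + v) ^+ 4 +
     (m - v) ^+ 2 * (6 * (m + v) ^+ 2 + (m - v) ^+ 2).
    by ring.
  have := sqr_ge0 (m - v); have := sqr_ge0 (m + v).
  by rewrite lerDl => p0 q0; rewrite mulr_ge0//; lra.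
have K4 : L1 P (fun w => X w ^+ 4).
  apply: L1_dominated J4; first exact: measurable_funX.
  by move=> w; rewrite ger0_norm// (_ : 4 = 2 * 2)%N// exprM sqr_ge0.
split.
- by rewrite e1; apply: L1D; [exact: L1_cst|exact: L1Z].
- by rewrite [in LHS]e1 ExD ?Ex_cst ?ExZ ?E1 ?mulr0 ?addr0//; [exact: L1_cst|exact: L1Z].
- have J : L1 P (fun w => m ^+ 2 + 2 * m * s * (U \o X) w).
    by apply: L1D; [exact: L1_cst|exact: L1Z].
  rewrite e2; split; first by apply: L1D => //; exact: L1Z.
  rewrite ExD//; last exact: L1Z.
  by rewrite ExD ?Ex_cst ?ExZ ?E1 ?E2 ?mulr0 ?addr0 ?mulr1//; [exact: L1_cst|exact: L1Z].
- split=> //; apply: le_trans (Ex_le K4 J4 le4) _.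
  rewrite ExD; [|exact: L1_cst|exact: L1Z].
  rewrite Ex_cst ExZ//.
  have : 0 <= s ^+ 4 by rewrite exprn_ge0// ltW.
  nra.
Qed.
End NormalMoments.

(** * Brownian increments: moments and independence of the past *)

Section BrownianIncrement.
Context {R : realType} {d : measure_display} {T : measurableType d}
  (P : probability T R) {n : nat} (F : R -> set (set T))
  (mu : 'cV[R]_n) (A : 'M[R]_n) (z : 'cV[R]_n) (B : R -> T -> 'cV[R]_n).
Hypotheses (HF : is_filtration F) (HB : brownian_motion P F mu A z B)
  (HA : sym_pos_def A).
Variables (s h : R).
Hypotheses (s0 : 0 <= s) (h0 : 0 < h) (h1 : h <= 1).

Lemma filtration_measurable (t : R) (G : set T) : F t G -> measurable G.
Proof. by have [_ Fm _] := HF; exact: Fm. Qed.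

Lemma measurable_wrt_measurable (t : R) (U : T -> R) :
  measurable_wrt (F t) U -> measurable_fun setT U.
Proof.
by move=> FU _ Y mY; rewrite setTI; exact: (@filtration_measurable t _ (FU _ mY)).
Qed.

Let b i w := (B (s + h) w - B s w) i 0.

Let sh : s < s + h. Proof. by rewrite ltrDl. Qed.
Let sh0 : 0 <= s + h. Proof. exact: le_trans s0 (ltW sh). Qed.

Lemma increment_measurable i : measurable_fun setT (b i).
Proof.
have [_ _ adB _ _] := HB.
rewrite (_ : b i = fun w => B (s + h) w i 0 - B s w i 0); last first.
  by apply/funext => w; rewrite /b !mxE.
by apply: measurable_funB; apply: measurable_wrt_measurable (adB _ _ i).
Qed.

Lemma increment_law (u : 'cV[R]_n) (Y : set R) : u != 0 -> measurable Y ->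
  P ((fun w => (u^T *m (B (s + h) w - B s w)) 0 0) @^-1` Y) =
  normal_prob (h * (u^T *m mu) 0 0) (Num.sqrt (h * qform A u u)) Y.
Proof.
move=> u0 mY; have [_ _ _ law _] := HB.
by have := law _ _ s0 sh u u0 Y mY; rewrite addrAC subrr add0r.
Qed.

(** Since [h <= 1], the drift part [h^4] of the fourth moment is absorbed and a bound of order [h^2]
    remains. *)
Lemma increment_linear_moments (u : 'cV[R]_n) : u != 0 ->
  let X w := (u^T *m (B (s + h) w - B s w)) 0 0 in
  let m := (u^T *m mu) 0 0 in
  [/\ L1 P X, Ex P X = h * m,
    L1 P (fun w => X w ^+ 2) /\ Ex P (fun w => X w ^+ 2) = h ^+ 2 * m ^+ 2 + h * qform A u u &
    L1 P (fun w => X w ^+ 4) /\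
    Ex P (fun w => X w ^+ 4) <= 8 * (m ^+ 4 + 128 * qform A u u ^+ 2) * h ^+ 2].
Proof.
move=> u0 X m.
have q0 : 0 < qform A u u by have [_ /(_ u u0)] := HA.
have hq0 : 0 < h * qform A u u by rewrite mulr_gt0.
have mX : measurable_fun setT X.
  rewrite (_ : X = fun w => \sum_j u j 0 * b j w).
    apply: measurable_sum => j; apply: measurable_funM => //.
    exact: increment_measurable.
  apply/funext => w; rewrite /X mxE; apply: eq_bigr => j _.
  by rewrite mxE.
have sq0 : 0 < Num.sqrt (h * qform A u u) by rewrite sqrtr_gt0.
have [I1 E1 [I2 E2] [I4 E4]] :=
  normal_moments mX sq0 (fun Y mY => increment_law u0 mY).
split=> //; first by split=> //; rewrite E2 sqr_sqrtr ?(ltW hq0)// exprMn.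
split=> //; apply: le_trans E4 _.
have -> : Num.sqrt (h * qform A u u) ^+ 4 = (h * qform A u u) ^+ 2.
  by rewrite (_ : 4 = 2 * 2)%N// exprM sqr_sqrtr// ltW.
rewrite -/m -[leRHS]mulrA ler_pM2l// [leRHS]mulrDl; apply: lerD; last by rewrite exprMn; lra.
rewrite exprMn mulrC ler_wpM2l//; first by rewrite (_ : 4 = 2 * 2)%N// exprM sqr_ge0.
rewrite (_ : h ^+ 4 = h ^+ 2 * h ^+ 2); last by rewrite -exprD.
by rewrite ler_piMl ?sqr_ge0// exprn_ile1// ltW.
Qed.

Let delta_neq0 i : delta_mx i 0 != 0 :> 'cV[R]_n.
Proof.
by apply/eqP => /colP/(_ i); rewrite !mxE !eqxx => /eqP; rewrite oner_eq0.
Qed.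

Let pair_neq0 i j : delta_mx i 0 + delta_mx j 0 != 0 :> 'cV[R]_n.
Proof.
apply/eqP => /colP/(_ i); rewrite !mxE !eqxx/= => /eqP.
by rewrite -natrD pnatr_eq0.
Qed.

Let delta_lin i (x : 'cV[R]_n) : ((delta_mx i 0 : 'cV[R]_n)^T *m x) 0 0 = x i 0.
Proof. by rewrite trmx_delta -rowE mxE. Qed.

Let qform_delta i j : qform A (delta_mx i 0) (delta_mx j 0) = A i j.
Proof. by rewrite /qform trmx_delta -rowE -colE !mxE. Qed.

Lemma increment_mean i : L1 P (b i) /\ Ex P (b i) = h * mu i 0.
Proof.
have [I1 E1 _ _] := increment_linear_moments (delta_neq0 i).
have e : (fun w => ((delta_mx i 0 : 'cV[R]_n)^T *m (B (s + h) w - B s w)) 0 0) = b i.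
  by apply/funext => w; rewrite delta_lin.
by move: I1 E1; rewrite e delta_lin.
Qed.

(** Polarisation: the laws are known for linear functionals only, so the mixed moment is obtained
    from the squares of [b_i], [b_j] and [b_i + b_j]. *)
Lemma increment_covariance i j : L1 P (fun w => b i w * b j w) /\
  Ex P (fun w => b i w * b j w) = h * A i j + h ^+ 2 * (mu i 0 * mu j 0).
Proof.
have sq k : L1 P (fun w => b k w ^+ 2) /\
    Ex P (fun w => b k w ^+ 2) = h ^+ 2 * mu k 0 ^+ 2 + h * A k k.
  have [_ _ [I2 E2] _] := increment_linear_moments (delta_neq0 k).
  have e : (fun w => ((delta_mx k 0 : 'cV[R]_n)^T *m (B (s + h) w - B s w)) 0 0 ^+ 2) =
      fun w => b k w ^+ 2 by apply/funext => w; rewrite delta_lin.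
  by move: I2 E2; rewrite e delta_lin qform_delta.
have [_ _ [I2 E2] _] := increment_linear_moments (pair_neq0 i j).
have [Ii Ei] := sq i; have [Ij Ej] := sq j.
have lin x : ((delta_mx i 0 + delta_mx j 0 : 'cV[R]_n)^T *m x) 0 0 = x i 0 + x j 0.
  by rewrite linearD/= !trmx_delta mulmxDl mxE -!rowE !mxE.
have e : (fun w => ((delta_mx i 0 + delta_mx j 0 : 'cV[R]_n)^T *m
    (B (s + h) w - B s w)) 0 0 ^+ 2) = fun w => (b i w + b j w) ^+ 2.
  by apply/funext => w; rewrite lin.
move: I2 E2; rewrite e lin !(qformDl, qformDr) !qform_delta => I2 E2.
have [sA _] := HA; have Aij : A j i = A i j by rewrite -[in LHS]sA mxE.
have -> : (fun w => b i w * b j w) =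
    fun w => 1 / 2 * ((b i w + b j w) ^+ 2 - b i w ^+ 2 - b j w ^+ 2).
  by apply/funext => w; field.
have I3 : L1 P (fun w => (b i w + b j w) ^+ 2 - b i w ^+ 2) by exact: L1B.
split; first by apply: L1Z; exact: L1B.
rewrite ExZ; last exact: L1B.
by rewrite !ExB// E2 Ei Ej Aij; field.
Qed.


Lemma increment_fourth_moment i : L1 P (fun w => b i w ^+ 4) /\
  Ex P (fun w => b i w ^+ 4) <= 8 * (mu i 0 ^+ 4 + 128 * A i i ^+ 2) * h ^+ 2.
Proof.
have [_ _ _ [I4 E4]] := increment_linear_moments (delta_neq0 i).
have e : (fun w => ((delta_mx i 0 : 'cV[R]_n)^T *m (B (s + h) w - B s w)) 0 0 ^+ 4) =
    fun w => b i w ^+ 4 by apply/funext => w; rewrite delta_lin.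
by move: I4 E4; rewrite e delta_lin qform_delta.
Qed.

Let mind i S : measurable S -> measurable (b i @^-1` S).
Proof.
by move=> mS; rewrite -[X in measurable X]setTI; exact: increment_measurable.
Qed.

(** Independence is given on rectangles only. Centring the indicator of [G] states it as an
    orthogonality, the shape in which [Ex_orthogonal] can replace the indicators by the increments
    themselves. *)
Lemma increment_rectangle G i j S S' : F s G -> measurable S -> measurable S' ->
  Ex P (fun w => (\1_G w - fine (P G)) * \1_(b i @^-1` S) w * \1_(b j @^-1` S') w) = 0.
Proof.
move=> FG mS mS'; have [_ _ _ _ indep] := HB.
have mG := filtration_measurable FG.
(* Sides [S] and [S'] in the coordinates [i] and [j], the whole line elsewhere; the intersection
   also covers [i = j]. *)
pose Ys k := (if k == i then S else setT) `&` (if k == j then S' else setT).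
have mYs k : measurable (Ys k).
  by apply: measurableI; case: ifP.
have := indep _ _ s0 sh G FG Ys mYs => /=.
set E := (X in P (G `&` X)) => EP.
have bE k w : B (s + h) w k 0 - B s w k 0 = b k w by rewrite /b !mxE.
have EE : E = (b i @^-1` S) `&` (b j @^-1` S').
  apply/seteqP; split => [w Ew|w [Si Sj] k].
    split; [have := Ew i | have := Ew j]; rewrite /Ys eqxx bE /=.
      by case.
    by case.
  by rewrite /Ys bE; split; case: eqP => // ->.
have mE : measurable E by rewrite EE; apply: measurableI; exact: mind.
have indE (C : set T) : measurable C -> L1 P \1_C.
  move=> mC; apply: (@L1_bounded _ _ _ _ _ 1) => //.
  by move=> w; rewrite indicE; case: (_ \in _); rewrite ?normr1 ?normr0.
transitivity (Ex P (fun w => \1_(G `&` E) w - fine (P G) * \1_E w)).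
  congr Ex; apply/funext => w; rewrite EE !indicI /=; ring.
rewrite ExB ?ExZ; try by [exact: indE|apply/L1Z/indE|apply/indE/measurableI].
apply/eqP; rewrite subr_eq0; apply/eqP.
apply: EFin_inj; rewrite EFinM !Ex_indic//; last exact: measurableI.
by rewrite EP fineK//; exact: fin_num_measure.
Qed.

Let bounded_indic (C : set T) w : `|\1_C w : R| <= 1.
Proof. by rewrite indicE; case: (_ \in _); rewrite ?normr1 ?normr0. Qed.

Let center_bounded G w : measurable G -> `|\1_G w - fine (P G) : R| <= 2.
Proof.
move=> mG; have := ler_normB (\1_G w : R) (fine (P G)).
have := bounded_indic G w.
have : `|fine (P G)| <= 1.
  rewrite ger0_norm ?fine_ge0// -lee_fin fineK ?fin_num_measure//.
  exact: probability_le1.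
lra.
Qed.

Lemma increment_indep_set G i : F s G ->
  Ex P (fun w => (\1_G w - fine (P G)) * b i w) = 0.
Proof.
move=> FG; have mG := filtration_measurable FG.
have mc : measurable_fun setT (fun w => \1_G w - fine (P G) : R) by apply: measurable_funB.
have [I1 _] := increment_mean i.
apply: Ex_orthogonal.
- exact: increment_measurable.
- by apply: (@L1_bounded _ _ _ _ _ 2) => // w; exact: center_bounded.
- by apply: (@L1_bmul _ _ _ _ _ _ 2) => // w; exact: center_bounded.
- move=> S mS; rewrite -[RHS](@increment_rectangle G i i S setT)//.
  by congr Ex; apply/funext => w; rewrite preimage_setT indicT/= mulr1.
Qed.

(** [Ex_orthogonal] is used twice: the outer application turns the factor [b i] into an indicator,
    the inner one the factor [b j], and a rectangle is left. *)
Lemma increment_indep_set2 G i j : F s G ->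
  Ex P (fun w => (\1_G w - fine (P G)) * (b i w * b j w)) = 0.
Proof.
move=> FG; have mG := filtration_measurable FG.
have mc : measurable_fun setT (fun w => \1_G w - fine (P G) : R) by apply: measurable_funB.
have [Ii _] := increment_mean i; have [Ij _] := increment_mean j.
have [Iij _] := increment_covariance i j.
have Ic f : L1 P f -> L1 P (fun w => (\1_G w - fine (P G)) * f w).
  by move=> If; apply: (@L1_bmul _ _ _ _ _ _ 2) => // w; exact: center_bounded.
rewrite (_ : (fun w => _) = (fun w => ((\1_G w - fine (P G)) * b j w) * b i w)); last first.
  by apply/funext => w; ring.
apply: Ex_orthogonal.
- exact: increment_measurable.
- exact: Ic.
- rewrite (_ : (fun w => _) = (fun w => (\1_G w - fine (P G)) * (b i w * b j w))).
    exact: Ic.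
  by apply/funext => w; ring.
- move=> S mS.
  rewrite (_ : (fun w => _) = (fun w => ((\1_G w - fine (P G)) * \1_(b i @^-1` S) w) * b j w)); last first.
    by apply/funext => w; ring.
  have mi : measurable_fun setT (\1_(b i @^-1` S) : T -> R) by exact/measurable_indic/mind.
  have Ii2 f : L1 P f -> L1 P (fun w => \1_(b i @^-1` S) w * f w).
    by move=> If; exact: (L1_bmul mi (bounded_indic _)).
  apply: Ex_orthogonal.
  + exact: increment_measurable.
  + apply: Ic; apply: (@L1_bounded _ _ _ _ _ 1) => // w; exact: bounded_indic.
  + rewrite (_ : (fun w => _) = (fun w => (\1_G w - fine (P G)) * (\1_(b i @^-1` S) w * b j w))).
      by apply: Ic; exact: Ii2.
    by apply/funext => w; ring.
  + by move=> S' mS'; exact: increment_rectangle.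
Qed.

(** The last extension, from events [G] to bounded [U]: applied to the preimages under [U], the
    hypothesis makes [Y - E Y] orthogonal to every event of [U], hence to [U]. *)
Let indep_ext Y U k : L1 P Y -> measurable_wrt (F s) U -> (forall w, `|U w| <= k) ->
  (forall G, F s G -> Ex P (fun w => (\1_G w - fine (P G)) * Y w) = 0) ->
  Ex P (fun w => U w * Y w) = Ex P U * Ex P Y.
Proof.
move=> IY FU Uk H.
have mU := measurable_wrt_measurable FU.
have IU : L1 P U by apply: (@L1_bounded _ _ _ _ _ k).
have Ic f : L1 P f -> L1 P (fun w => U w * f w) by move=> If; exact: (L1_bmul mU Uk).
have IYc : L1 P (fun w => Y w - Ex P Y) by apply: L1B => //; exact: L1_cst.
have : Ex P (fun w => (Y w - Ex P Y) * U w) = 0.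
  apply: Ex_orthogonal => //.
    by rewrite (_ : (fun w => _) = (fun w => U w * (Y w - Ex P Y))); [exact: Ic|apply/funext => w; ring].
  move=> S mS; have FG := FU _ mS; have mG := filtration_measurable FG.
  set G := U @^-1` S in FG mG *.
  have mi : measurable_fun setT (\1_G : T -> R) by exact/measurable_indic.
  have IG : L1 P \1_G by apply: (@L1_bounded _ _ _ _ _ 1) => //; exact: bounded_indic.
  have IGY : L1 P (fun w => \1_G w * Y w) by exact: (L1_bmul mi (bounded_indic _)).
  have := H G FG.
  rewrite (_ : (fun w => (\1_G w - _) * _) = (fun w => \1_G w * Y w - fine (P G) * Y w)); last first.
    by apply/funext => w; ring.
  rewrite (_ : (fun w => (_ - _) * \1_G w) = (fun w => \1_G w * Y w - Ex P Y * \1_G w)); last first.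
    by apply/funext => w; ring.
  rewrite !ExB ?ExZ//; try exact: L1Z.
  by rewrite -(Ex_indic _ mG)/= [Ex P Y * _]mulrC.
rewrite (_ : (fun w => (_ - _) * U w) = (fun w => U w * Y w - Ex P Y * U w)); last first.
  by apply/funext => w; ring.
rewrite ExB ?ExZ//; [|exact: Ic|exact: L1Z].
by move/eqP; rewrite subr_eq0 => /eqP ->; rewrite mulrC.
Qed.

Lemma increment_indep U k i : measurable_wrt (F s) U -> (forall w, `|U w| <= k) ->
  Ex P (fun w => U w * b i w) = Ex P U * (h * mu i 0).
Proof.
move=> FU Uk; have [Ii <-] := increment_mean i.
by apply: (indep_ext Ii FU Uk) => G FG; exact: increment_indep_set.
Qed.

Lemma increment_indep2 U k i j : measurable_wrt (F s) U -> (forall w, `|U w| <= k) ->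
  Ex P (fun w => U w * (b i w * b j w)) =
  Ex P U * (h * A i j + h ^+ 2 * (mu i 0 * mu j 0)).
Proof.
move=> FU Uk; have [Iij <-] := increment_covariance i j.
by apply: (indep_ext Iij FU Uk) => G FG; exact: increment_indep_set2.
Qed.
End BrownianIncrement.

(** * Continuous paths and the complementarity condition *)

Section ContinuousPaths.
Context {R : realType}.
Implicit Types (f g L : R -> R).

Lemma within_continuous_eps f x e :
  {within [set t : R | 0 <= t], continuous f} -> 0 <= x -> 0 < e ->
  exists2 d, 0 < d & forall y, 0 <= y -> `|x - y| < d -> `|f x - f y| < e.
Proof.
move=> /subspace_continuousP cf x0 e0.
have := cf x x0 => /cvgrPdist_lt/(_ e e0).
rewrite near_withinE => /nbhs_ballP[d /= d0 H].
by exists d => // y y0 xy; exact: (H y).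
Qed.

Lemma uniformly_continuous_on_segment f T e :
  {within [set t : R | 0 <= t], continuous f} -> 0 < e ->
  exists2 d, 0 < d & forall x y, 0 <= x <= T -> 0 <= y -> `|x - y| < d ->
    `|f x - f y| < e.
Proof.
move=> cf e0.
have e20 : 0 < e / 2 by rewrite divr_gt0.
have /compact_near_coveringP cov := @segment_compact R 0 T.
pose Q (d x : R) := forall y, 0 <= x -> 0 <= y -> `|x - y| < d -> `|f x - f y| < e.
have H x : `[0, T]%classic x -> \forall x' \near x & d \near at_right (0 : R), Q d x'.
  rewrite /= in_itv/= => /andP[x0 xT].
  have [d d0 Hd] := within_continuous_eps cf x0 e20.
  have d20 : 0 < d / 2 by rewrite divr_gt0.
  exists (ball x (d / 2), [set r | 0 < r < d / 2]) => /=.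
    split; first exact: nbhsx_ballx.
    exists (d / 2) => //= r /=; rewrite sub0r normrN => rd r0.
    by rewrite r0 -(ger0_norm (ltW r0)).
  move=> [x' r] /= [xx' /andP[r0 rd]] y x'0 y0 x'y.
  have h2 := Hd x' x'0; have h3 := Hd y y0.
  have xx'' : `|x - x'| < d / 2 by exact: xx'.
  have h1 : `|x - y| < d.
    by have := ler_distD x' x y; lra.
  have {}h2 : `|f x - f x'| < e / 2 by apply: h2; lra.
  have {}h3 := h3 h1.
  by have := ler_distD (f x) (f x') (f y); rewrite (distrC (f x') (f x)); lra.
have := cov _ (at_right (0 : R)) Q _ H.
rewrite near_withinE; case=> d /= d0 Hd.
have d20 : 0 < d / 2 by rewrite divr_gt0.
exists (d / 2) => // x y /andP[x0 xT] y0 xy.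
apply: (Hd (d / 2)) => //; last by rewrite /= in_itv/= x0 xT.
by rewrite /ball/= sub0r normrN ger0_norm ?ltW//; lra.
Qed.

Lemma segment_min f a b : {within [set t : R | 0 <= t], continuous f} ->
  0 <= a <= b ->
  exists2 c, a <= c <= b & forall t, a <= t <= b -> f c <= f t.
Proof.
move=> cf /andP[a0 ab].
have cf' : {within `[a, b], continuous f}.
  apply: continuous_subspaceW cf => x /=; rewrite in_itv/= => /andP[ax _].
  exact: le_trans ax.
have [c] := EVT_min ab cf'; rewrite in_itv/= => cab H.
by exists c => // t tab; apply: H; rewrite in_itv.
Qed.

Lemma segment_bounded f b : {within [set t : R | 0 <= t], continuous f} ->
  0 <= b -> exists k, forall t, 0 <= t <= b -> `|f t| <= k.
Proof.
move=> cf b0.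
have cf' : {within `[0, b], continuous f}.
  by apply: continuous_subspaceW cf => x /=; rewrite in_itv/= => /andP[].
have [c _ H1] := EVT_min b0 cf'; have [c' _ H2] := EVT_max b0 cf'.
exists (`|f c| + `|f c'|) => t tab.
have := H1 t; have := H2 t; rewrite !in_itv/= => /(_ tab) h2 /(_ tab) h1.
have := ler_norm (f c'); have := ler_norm (- f c); rewrite normrN => h3 h4.
by have := normr_ge0 (f c); have := normr_ge0 (f c'); rewrite ler_norml; lra.
Qed.

Lemma lebesgue_stieltjes_itvoc (f : cumulative R R) (a b : R) : a <= b ->
  lebesgue_stieltjes_measure f (`]a, b]%classic : set R) = (f b - f a)%:E.
Proof.
move=> ab; rewrite /lebesgue_stieltjes_measure/= /measure_extension/=.
rewrite measurable_mu_extE//; last exact: is_ocitv.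
exact: wlength_itv_bnd.
Qed.

(** Otherwise [g] has a positive minimum on [[s, t]], and the integral is at least that minimum
    times [L t - L s]. This is the only form in which complementarity is used: if [L_i] grows over
    an interval, then [Z_i] vanishes somewhere in it. *)
Lemma stieltjes_int_eq0 L g s t :
  {within [set t : R | 0 <= t], continuous L} ->
  {within [set t : R | 0 <= t], continuous g} ->
  L 0 = 0 -> (forall s t, 0 <= s -> s <= t -> L s <= L t) ->
  (forall t, 0 <= t -> 0 <= g t) ->
  stieltjes_int L g = 0%E -> 0 <= s -> s <= t -> L s < L t ->
  exists2 u, s <= u <= t & g u = 0.
Proof.
(* The default branch of [stieltjes_int] would make the hypothesis void; it is ruled out by checking
   that [ext0 L] is nondecreasing and right-continuous. *)
move=> cL cg L0 ndL g0; rewrite /stieltjes_int; case: pselect; last first.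
  case; split.
    move=> x y xy; rewrite /ext0; case: ltP => x0; case: ltP => y0 //.
    - by rewrite -L0; exact: ndL.
    - by have := le_lt_trans x0 (le_lt_trans xy y0); rewrite ltxx.
    - exact: ndL.
  move=> x; have [x0|x0] := ltP x 0.
    apply: (@cvg_trans _ (cst (0 : R) @ at_right x)).
      apply: near_eq_cvg; rewrite near_withinE.
      exists (- x); first by rewrite /= oppr_gt0.
      move=> y /=; rewrite distrC => xy _; rewrite /ext0.
      have -> // : y < 0.
      by have := le_lt_trans (ler_norm _) xy; lra.
    by rewrite /ext0 x0; exact: cvg_cst.
  apply/cvgrPdist_lt => e e0; rewrite near_withinE.
  have [d d0 Hd] := within_continuous_eps cL x0 e0.
  exists d => // y /= xy xlty; have y0 := le_trans x0 (ltW xlty).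
  rewrite /ext0 (ltNge x 0) x0 (ltNge y 0) y0 /=.
  exact: Hd.
move=> h; set LC := (X in lebesgue_stieltjes_measure X) => intg s0 st Lst.
have t0 := le_trans s0 st.
have [u ust umin] := segment_min cg (introT andP (conj s0 st)).
exists u => //; apply/eqP; rewrite eq_le g0 ?andbT; last by lra.
rewrite leNgt; apply/negP => gu0.
have stL : lebesgue_stieltjes_measure LC (`]s, t]%classic : set R) = (L t - L s)%:E.
  by rewrite lebesgue_stieltjes_itvoc//= /ext0 !ltNge s0 t0.
have m0 : measurable ([set t | 0 <= t] : set R).
  by rewrite [X in measurable X](_ : _ = `[0, +oo[%classic)//; apply/seteqP; split=> x /=; rewrite in_itv/= andbT.
have mg : measurable_fun ([set t | 0 <= t] : set R) g.
  exact: subspace_continuous_measurable_fun.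
suff : (0 < \int[lebesgue_stieltjes_measure LC]_(x in [set t | (0 <= t)%R]) (g x)%:E)%E.
  by rewrite intg ltxx.
have sub0 : `]s, t]%classic `<=` ([set t | 0 <= t] : set R).
  by move=> x /=; rewrite in_itv/= => /andP[sx _]; lra.
apply: (@lt_le_trans _ _ (\int[lebesgue_stieltjes_measure LC]_(x in `]s, t]%classic) (g x)%:E)%E); last first.
  apply: ge0_subset_integral => //; first exact/measurable_EFinP.
apply: (@lt_le_trans _ _ (\int[lebesgue_stieltjes_measure LC]_(x in `]s, t]%classic) (g u)%:E)%E).
  by rewrite integral_cst// [X in (_ * X)%E]stL -EFinM lte_fin mulr_gt0// subr_gt0.
apply: ge0_le_integral => //.
- by move=> x _; rewrite lee_fin ltW.
- apply/measurable_EFinP; apply: measurable_funS mg => //.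
- by move=> x /=; rewrite in_itv/= => /andP[sx xt]; rewrite lee_fin umin// (ltW sx).
Qed.

End ContinuousPaths.

(** * Test functions with global Taylor bounds *)

Section TestFunctions.
Context {R : realType}.
Implicit Types (f g : R -> R).

Section Derivatives.
Variables (x : R) (f g : R -> R) (a b : R).
Hypotheses (df : is_derive x 1 f a) (dg : is_derive x 1 g b).

Lemma is_derive_fun_cst (k : R) : is_derive x 1 (fun _ => k) 0.
Proof. exact: is_derive_cst. Qed.

Lemma is_derive_fun_id : is_derive x 1 (fun y : R => y) 1.
Proof. exact: is_derive_id. Qed.

Lemma is_derive_funD : is_derive x 1 (fun y => f y + g y) (a + b).
Proof. exact: is_deriveD. Qed.

Lemma is_derive_funB : is_derive x 1 (fun y => f y - g y) (a - b).
Proof. exact: is_deriveB. Qed.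

Lemma is_derive_funM : is_derive x 1 (fun y => f y * g y) (a * g x + f x * b).
Proof.
apply: (is_derive_eq (is_deriveM df dg)); rewrite /GRing.scale/=; ring.
Qed.

Lemma is_derive_funZ (k : R) : is_derive x 1 (fun y => k * f y) (k * a).
Proof. by apply: (is_derive_eq (is_deriveZ k df)). Qed.

Lemma is_derive_fun_expR : is_derive x 1 (fun y => expR (f y)) (a * expR (f x)).
Proof. by rewrite mulrC; exact: (is_derive1_comp (is_derive_expR (f x)) df). Qed.

Lemma is_derive_fun_ln : 0 < f x -> is_derive x 1 (fun y => ln (f y)) (a / f x).
Proof. by move=> f0; rewrite mulrC; exact: (is_derive1_comp (is_derive1_ln f0) df). Qed.

Lemma is_derive_funV : f x != 0 -> is_derive x 1 (fun y => (f y)^-1) (- a / f x ^+ 2).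
Proof.
move=> f0; apply: (is_derive_eq (is_deriveV f0 df)).
by rewrite /GRing.scale/= mulNr mulrC mulNr.
Qed.
End Derivatives.

(** The bounds hold on the whole half-line because a Gaussian increment may leave any bounded set in
    one step; the Lipschitz bound serves for large increments and for the reflection error. *)
Record taylor_bounded (g g1 g2 : R -> R) (K : R) : Prop := TaylorBounded {
  taylor_meas : measurable_fun [set v : R | 0 <= v] g;
  taylor_meas1 : measurable_fun [set v : R | 0 <= v] g1;
  taylor_meas2 : measurable_fun [set v : R | 0 <= v] g2;
  taylor_le1 : forall v : R, 0 <= v -> `|g1 v| <= K;
  taylor_le2 : forall v : R, 0 <= v -> `|g2 v| <= K;
  taylor_lip : forall v y : R, 0 <= v -> 0 <= y -> `|g y - g v| <= K * `|y - v|;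
  taylor_rem : forall v y : R, 0 <= v -> 0 <= y ->
    `|g y - g v - g1 v * (y - v) - g2 v / 2 * (y - v) ^+ 2| <= K * `|y - v| ^+ 3
}.

Lemma taylor_bounded_ge0 g g1 g2 K : taylor_bounded g g1 g2 K -> 0 <= K.
Proof. by case=> _ _ _ /(_ 0 (lexx 0)) h _ _ _; exact: le_trans h. Qed.

Lemma derive_bound_increment f (df : R -> R) (M v y : R) : 0 <= v -> 0 <= y ->
  (forall x : R, 0 <= x -> is_derive x 1 f (df x)) ->
  (forall x : R, 0 <= x -> `|x - v| <= `|y - v| -> `|df x| <= M) ->
  `|f y - f v| <= M * `|y - v|.
Proof.
move=> v0 y0 der bnd.
have mvt a b : 0 <= a -> a <= b ->
    exists2 c, a <= c <= b & f b - f a = df c * (b - a).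
  move=> a0 ab.
  have [||c cab e] := @MVT_segment _ f df a b ab.
  - move=> x; rewrite in_itv/= => /andP[ax _]; apply: der.
    exact: le_trans a0 (ltW ax).
  - apply: derivable_within_continuous => x; rewrite in_itv/= => /andP[ax _].
    by have [] := der x (le_trans a0 ax).
  - by exists c => //; move: cab; rewrite in_itv.
have [vy|/ltW yv] := leP v y.
  have [c /andP[vc cy] ->] := mvt v y v0 vy.
  rewrite normrM ler_wpM2r//; apply: bnd; first exact: le_trans vc.
  by rewrite !ger0_norm ?subr_ge0// lerB.
have [c /andP[yc cv] e] := mvt y v y0 yv.
rewrite distrC e normrM (distrC v) ler_wpM2r//; apply: bnd; first exact: le_trans yc.
by rewrite (distrC c) (distrC y) !ger0_norm ?subr_ge0// lerB.
Qed.

Lemma is_derive_measurable f (df : R -> R) :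
  (forall x : R, 0 <= x -> is_derive x 1 f (df x)) -> measurable_fun [set v : R | 0 <= v] f.
Proof.
move=> der.
have e : [set v : R | 0 <= v] = `[0, +oo[%classic.
  by apply/seteqP; split=> x /=; rewrite in_itv/= andbT.
rewrite e; apply: subspace_continuous_measurable_fun => //.
apply: derivable_within_continuous => x; rewrite in_itv/= andbT => x0.
by have [] := der x x0.
Qed.

(** The mean value inequality is applied in turn to [g2 - g2 v], to the first-order remainder of
    [g1] and to the second-order remainder of [g]. Each step costs one factor [|y - v|]; the
    factorials are given away. *)
Lemma taylor_boundedC3 (g g1 g2 g3 : R -> R) (K : R) :
  (forall x : R, 0 <= x -> is_derive x 1 g (g1 x)) ->
  (forall x : R, 0 <= x -> is_derive x 1 g1 (g2 x)) ->
  (forall x : R, 0 <= x -> is_derive x 1 g2 (g3 x)) ->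
  (forall x : R, 0 <= x -> `|g1 x| <= K) ->
  (forall x : R, 0 <= x -> `|g2 x| <= K) ->
  (forall x : R, 0 <= x -> `|g3 x| <= K) -> taylor_bounded g g1 g2 K.
Proof.
move=> d1 d2 d3 b1 b2 b3; split=> //.
- exact: is_derive_measurable d1.
- exact: is_derive_measurable d2.
- exact: is_derive_measurable d3.
- by move=> v y v0 y0; apply: derive_bound_increment => // x x0 _; exact: b1.
move=> v y v0 y0; set D := `|y - v|.
have D0 : 0 <= D by exact: normr_ge0.
have s2 (x : R) : 0 <= x -> `|x - v| <= D -> `|g2 x - g2 v| <= K * D.
  move=> x0 xD; apply: (@le_trans _ _ (K * `|x - v|)).
    by apply: derive_bound_increment => // u u0 _; exact: b3.
  by rewrite ler_wpM2l// (le_trans (normr_ge0 _) (b1 v v0)).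
pose f1 (x : R) := g1 x - g1 v - g2 v * (x - v).
have df1 (x : R) : 0 <= x -> is_derive x 1 f1 (g2 x - g2 v).
  move=> x0; have Hd := d2 x x0.
  have := is_derive_funB (is_derive_funB Hd (is_derive_fun_cst x (g1 v)))
    (is_derive_funZ (is_derive_funB (is_derive_fun_id x) (is_derive_fun_cst x v)) (g2 v)).
  by rewrite !subr0 mulr1.
have s1 (x : R) : 0 <= x -> `|x - v| <= D -> `|f1 x| <= K * D * D.
  move=> x0 xD; have f1v : f1 v = 0 by rewrite /f1; ring.
  rewrite -[f1 x]subr0 -f1v; apply: (@le_trans _ _ (K * D * `|x - v|)).
    apply: (derive_bound_increment v0 x0 df1) => u u0 ux.
    by apply: s2 => //; exact: le_trans ux xD.
  by rewrite ler_wpM2l// mulr_ge0// (le_trans (normr_ge0 _) (b1 v v0)).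
pose f0 (x : R) := g x - g v - g1 v * (x - v) - g2 v / 2 * (x - v) ^+ 2.
have df0 (x : R) : 0 <= x -> is_derive x 1 f0 (f1 x).
  move=> x0; have Hd := d1 x x0.
  have Hsub := is_derive_funB (is_derive_fun_id x) (is_derive_fun_cst x v).
  have := is_derive_funB (is_derive_funB (is_derive_funB Hd (is_derive_fun_cst x (g v)))
    (is_derive_funZ Hsub (g1 v))) (is_derive_funZ (is_derive_funM Hsub Hsub) (g2 v / 2)).
  by move=> h; apply: (is_derive_eq h); rewrite /f1; field.
have f0v : f0 v = 0 by rewrite /f0; ring.
suff h : `|f0 y| <= K * D ^+ 3 by exact: h.
rewrite -[f0 y]subr0 -f0v.
apply: le_trans (_ : K * D * D * D <= _); last by rewrite (_ : _ * D = K * D ^+ 3)//; ring.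
by apply: (derive_bound_increment v0 y0 df0) => u u0 uy; exact: s1.
Qed.

Lemma taylor_boundedD f f1 f2 Kf g g1 g2 Kg a : taylor_bounded f f1 f2 Kf ->
  taylor_bounded g g1 g2 Kg ->
  taylor_bounded (fun v => f v + a * g v) (fun v => f1 v + a * g1 v)
    (fun v => f2 v + a * g2 v) (Kf + `|a| * Kg).
Proof.
move=> [mf mf1 mf2 bf1 bf2 lf tf] [mg mg1 mg2 bg1 bg2 lg tg].
have nD (x y k k' : R) : `|x| <= k -> `|y| <= k' -> `|x + a * y| <= k + `|a| * k'.
  move=> h1 h2; apply: le_trans (ler_normD _ _) _; apply: lerD => //.
  by rewrite normrM ler_wpM2l.
split.
- by apply: measurable_funD => //; exact: measurable_funM.
- by apply: measurable_funD => //; exact: measurable_funM.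
- by apply: measurable_funD => //; exact: measurable_funM.
- by move=> v v0; apply: nD; [exact: bf1|exact: bg1].
- by move=> v v0; apply: nD; [exact: bf2|exact: bg2].
- move=> v y v0 y0; rewrite [leRHS]mulrDl -[X in _ <= _ + X]mulrA.
  rewrite (_ : _ - _ = (f y - f v) + a * (g y - g v)); last by ring.
  by apply: nD; [exact: lf|exact: lg].
- move=> v y v0 y0; rewrite [leRHS]mulrDl -[X in _ <= _ + X]mulrA.
  rewrite (_ : _ - _ = (f y - f v - f1 v * (y - v) - f2 v / 2 * (y - v) ^+ 2) +
    a * (g y - g v - g1 v * (y - v) - g2 v / 2 * (y - v) ^+ 2)); last by field.
  by apply: nD; [exact: tf|exact: tg].
Qed.

End TestFunctions.

(** * Measurability with respect to the filtration *)

Section Adaptedness.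
Context {R : realType} {d : measure_display} {T : measurableType d}
  (F : R -> set (set T)).
Hypothesis HF : is_filtration F.
Variable t : R.

(** Turns [F t] into the sigma-algebra of a measurable type, where the usual closure properties of
    measurable functions apply; generating adds no sets, as [F t] is already a sigma-algebra. *)
Lemma measurable_wrtE (X : T -> R) : measurable_wrt (F t) X <->
  measurable_fun (setT : set (g_sigma_algebraType (F t))) (X : g_sigma_algebraType (F t) -> R).
Proof.
have [sF _ _] := HF.
split=> [FX _ Y mY|mX Y mY].
  by rewrite setTI; apply: sub_sigma_algebra; exact: FX.
by rewrite -(sigma_algebra_id (sF t)) -[X in _ X]setTI; exact: mX.
Qed.

Lemma measurable_wrt_indic (G : set T) : F t G -> measurable_wrt (F t) (\1_G : T -> R).
Proof.
move=> FG; apply/measurable_wrtE; apply: measurable_indic.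
exact: sub_sigma_algebra.
Qed.

Lemma measurable_wrtM (X Y : T -> R) : measurable_wrt (F t) X ->
  measurable_wrt (F t) Y -> measurable_wrt (F t) (fun w => X w * Y w).
Proof.
move=> /measurable_wrtE mX /measurable_wrtE mY; apply/measurable_wrtE.
exact: measurable_funM.
Qed.

Lemma measurable_wrtD (X Y : T -> R) : measurable_wrt (F t) X ->
  measurable_wrt (F t) Y -> measurable_wrt (F t) (fun w => X w + Y w).
Proof.
move=> /measurable_wrtE mX /measurable_wrtE mY; apply/measurable_wrtE.
exact: measurable_funD.
Qed.

Lemma measurable_wrt_cst (k : R) : measurable_wrt (F t) (fun _ => k).
Proof. by apply/measurable_wrtE. Qed.

Lemma measurable_wrt_sum I (s : seq I) (X : I -> T -> R) :
  (forall i, measurable_wrt (F t) (X i)) ->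
  measurable_wrt (F t) (fun w => \sum_(i <- s) X i w).
Proof.
by move=> mX; apply/measurable_wrtE/measurable_sum => i; apply/measurable_wrtE.
Qed.

Lemma measurable_wrt_comp (g : R -> R) (X : T -> R) :
  measurable_fun [set v : R | 0 <= v] g -> (forall w, 0 <= X w) ->
  measurable_wrt (F t) X -> measurable_wrt (F t) (fun w => g (X w)).
Proof.
move=> mg X0 /measurable_wrtE mX; apply/measurable_wrtE.
apply: (measurable_comp _ _ mg mX).
  rewrite [X0 in measurable X0](_ : _ = `[0, +oo[%classic)//.
  by apply/seteqP; split=> x /=; rewrite in_itv/= andbT.
by move=> _ [w _ <-] /=; exact: X0.
Qed.

Lemma measurable_wrt_qform n (M : 'M[R]_n) (X Y : T -> 'cV[R]_n) :
  (forall i, measurable_wrt (F t) (fun w => X w i 0)) ->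
  (forall i, measurable_wrt (F t) (fun w => Y w i 0)) ->
  measurable_wrt (F t) (fun w => qform M (X w) (Y w)).
Proof.
move=> mX mY; rewrite (_ : (fun _ => _) = fun w => \sum_i \sum_j M i j * (X w i 0 * Y w j 0)).
  apply: measurable_wrt_sum => i; apply: measurable_wrt_sum => j.
  apply: measurable_wrtM; first exact: measurable_wrt_cst.
  exact: measurable_wrtM.
by apply/funext => w; rewrite qformE.
Qed.

Lemma measurable_wrt_mulmx m n (M : 'M[R]_(m, n)) (X : T -> 'cV[R]_n) :
  (forall i, measurable_wrt (F t) (fun w => X w i 0)) ->
  forall i, measurable_wrt (F t) (fun w => (M *m X w) i 0).
Proof.
move=> mX i; rewrite (_ : (fun _ => _) = fun w => \sum_j M i j * X w j 0).
  apply: measurable_wrt_sum => j.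
  by apply: measurable_wrtM; first exact: measurable_wrt_cst.
by apply/funext => w; rewrite mxE.
Qed.

End Adaptedness.

(** * Second-order expansion over one step *)

Section Remainder.
Context {R : realType}.

(** [p] and [q] stand for the linear and quadratic parts of the increment of [V], [r] for the size
    of the Brownian increment. If [r <= 1], replacing [(p + q)^2] by [p^2] costs only order [r^3];
    if [r > 1], every lower power is at most [r^3] and the Lipschitz bound is enough. *)
Lemma taylor_remainder_le (g g1 g2 : R -> R) (K v p q c1 r : R) :
  taylor_bounded g g1 g2 K -> 0 <= v -> 0 <= v + (p + q) -> 0 <= r ->
  `|p| <= c1 * r -> `|q| <= c1 * r ^+ 2 -> 0 <= c1 ->
  `|g (v + (p + q)) - g v - (g1 v * (p + q) + g2 v / 2 * p ^+ 2)| <=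
  K * (8 * c1 ^+ 3 + 4 * c1 ^+ 2 + 4 * c1) * r ^+ 3.
Proof.
move=> tg v0 vd0 r0 hp hq c10.
have K0 := taylor_bounded_ge0 tg.
have vpq : v + (p + q) - v = p + q by ring.
have r30 : 0 <= r ^+ 3 by rewrite exprn_ge0.
have g1K := taylor_le1 tg v0; have g2K := taylor_le2 tg v0.
have c20 : 0 <= c1 ^+ 2 by exact: sqr_ge0.
have c30 : 0 <= c1 ^+ 3 by exact: exprn_ge0.
have d0 := normr_ge0 (p + q).
have [r1|r1] := leP r 1.
  have dle : `|p + q| <= 2 * c1 * r.
    apply: le_trans (ler_normD _ _) _.
    have : c1 * r ^+ 2 <= c1 * r by rewrite ler_wpM2l// expr2 ler_piMl.
    lra.
  have := taylor_rem tg v0 vd0; rewrite vpq => h.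
  have h3 : `|p + q| ^+ 3 <= (2 * c1 * r) ^+ 3.
    by rewrite lerXn2r// nnegrE mulr_ge0// mulr_ge0.
  have h4 : `|g2 v / 2 * ((p + q) ^+ 2 - p ^+ 2)| <= K * (4 * c1 ^+ 2) * r ^+ 3.
    rewrite (_ : (p + q) ^+ 2 - p ^+ 2 = q * (p + (p + q))); last by ring.
    rewrite normrM (normrM q).
    have e1 : `|g2 v / 2| <= K by rewrite normrM (@ger0_norm _ (2^-1))//; lra.
    have e2 : `|p + (p + q)| <= 3 * c1 * r.
      by apply: le_trans (ler_normD _ _) _; lra.
    have e3 : `|q| * `|p + (p + q)| <= 4 * c1 ^+ 2 * r ^+ 3.
      apply: (@le_trans _ _ ((c1 * r ^+ 2) * (3 * c1 * r))).
        by apply: ler_pM.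
      rewrite (_ : _ * _ = 3 * (c1 ^+ 2 * r ^+ 3)); last by ring.
      rewrite -mulrA ler_wpM2r ?mulr_ge0//; lra.
    rewrite -[leRHS]mulrA; apply: ler_pM => //; exact: mulr_ge0.
  rewrite (_ : _ - _ = (g (v + (p + q)) - g v - g1 v * (p + q) - g2 v / 2 * (p + q) ^+ 2)
     + g2 v / 2 * ((p + q) ^+ 2 - p ^+ 2)); last by field.
  apply: le_trans (ler_normD _ _) _.
  have h5 : K * `|p + q| ^+ 3 <= K * (8 * c1 ^+ 3 * r ^+ 3).
    rewrite ler_wpM2l//; apply: le_trans h3 _.
    by rewrite (_ : _ ^+ 3 = 8 * c1 ^+ 3 * r ^+ 3)//; ring.
  have h6 : 0 <= K * (4 * c1) * r ^+ 3 by rewrite !mulr_ge0.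
  by nra.
have r2 : r ^+ 2 <= r ^+ 3 by rewrite exprS ler_peMl ?sqr_ge0// ltW.
have rr3 : r <= r ^+ 3.
  by apply: le_trans r2; rewrite expr2 ler_peMl// ltW.
have dle : `|p + q| <= 2 * c1 * r ^+ 3.
  apply: le_trans (ler_normD _ _) _.
  have : c1 * r ^+ 2 <= c1 * r ^+ 3 by rewrite ler_wpM2l.
  have : c1 * r <= c1 * r ^+ 3 by rewrite ler_wpM2l.
  lra.
have := taylor_lip tg v0 vd0; rewrite vpq => h.
have h1 : K * `|p + q| <= K * (2 * c1 * r ^+ 3) by rewrite ler_wpM2l.
have h2 : `|g1 v * (p + q)| <= K * (2 * c1 * r ^+ 3).
  by rewrite normrM; apply: ler_pM.
have p2 : p ^+ 2 <= c1 ^+ 2 * r ^+ 3.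
  rewrite -(real_normK (num_real p)); apply: (@le_trans _ _ ((c1 * r) ^+ 2)).
    by rewrite lerXn2r// nnegrE mulr_ge0.
  by rewrite exprMn ler_wpM2l.
have h3 : `|g2 v / 2 * p ^+ 2| <= K * (c1 ^+ 2 * r ^+ 3).
  rewrite normrM (@ger0_norm _ (p ^+ 2)) ?sqr_ge0//; apply: ler_pM => //; first exact: sqr_ge0.
  by rewrite normrM (@ger0_norm _ (2^-1))//; lra.
rewrite (_ : _ - _ = (g (v + (p + q)) - g v) - g1 v * (p + q) - g2 v / 2 * p ^+ 2); last by field.
apply: le_trans (ler_normB _ _) _.
have := ler_normB (g (v + (p + q)) - g v) (g1 v * (p + q)).
have h6 : 0 <= K * (8 * c1 ^+ 3) * r ^+ 3 by rewrite !mulr_ge0.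
have h7 : 0 <= K * (c1 ^+ 2) * r ^+ 3 by rewrite !mulr_ge0.
nra.
Qed.

Lemma sum_sqr_le (n : nat) (x : 'I_n -> R) :
  (\sum_i x i) ^+ 2 <= n%:R * \sum_i x i ^+ 2.
Proof.
rewrite expr2 big_distrl/=.
have -> : n%:R * \sum_i x i ^+ 2 = \sum_i \sum_j (x i ^+ 2 + x j ^+ 2) / 2.
  transitivity (\sum_i (x i ^+ 2 / 2 *+ n + \sum_j x j ^+ 2 / 2)); last first.
    apply: eq_bigr => i _; rewrite [RHS](eq_bigr (fun j => x i ^+ 2 / 2 + x j ^+ 2 / 2)).
      by rewrite big_split/= sumr_const card_ord.
    by move=> j _; rewrite mulrDl.
  rewrite big_split/= sumr_const card_ord sumrMnl -mulrnDl -big_split/= mulr_natl.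
  by congr (_ *+ _); apply: eq_bigr => i _; exact: splitr.
apply: ler_sum => i _; rewrite big_distrr/=; apply: ler_sum => j _.
rewrite ler_pdivlMr//; have := sqr_ge0 (x i - x j); lra.
Qed.
End Remainder.

(* The generator of the Brownian part applied to [x |-> g (x'Om x)], where [g1]
   and [g2] are the first two derivatives of [g]. *)
Definition generator {R : realType} {n : nat} (Om A : 'M[R]_n) (mu : 'cV[R]_n)
    (g1 g2 : R -> R) (x : 'cV[R]_n) : R :=
  g1 (qform Om x x) * (\tr (Om *m A) + 2 * qform Om x mu) +
  2 * g2 (qform Om x x) * qform A (Om *m x) (Om *m x).

Section OneStep.
Context {R : realType} {d : measure_display} {T : measurableType d}
  (P : probability T R) {n : nat} (F : R -> set (set T))
  (Rm : 'M[R]_n) (c : 'I_n -> R)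
  (mu : 'cV[R]_n) (A : 'M[R]_n) (z : 'cV[R]_n) (B Z : R -> T -> 'cV[R]_n).
Hypotheses (HR : reflection_M_matrix Rm) (c0 : forall i, 0 < c i)
  (symRC : (Rm *m diagC c)^T = Rm *m diagC c)
  (HA : sym_pos_def A)
  (HF : is_filtration F) (HB : brownian_motion P F mu A z B)
  (adZ : adapted F Z).
Let Om := invmx (Rm *m diagC c).
Let V (x : 'cV[R]_n) := qform Om x x.

Let Vge0 x : 0 <= V x. Proof. exact: Omega_psd. Qed.

Let cO := \sum_i \sum_j `|Om i j|.

Let cO0 : 0 <= cO.
Proof. by apply: sumr_ge0 => i _; apply: sumr_ge0. Qed.

Let cO_ge i j : `|Om i j| <= cO.
Proof.
rewrite /cO (bigD1 i)//= (bigD1 j)//= -addrA lerDl addr_ge0//.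
  exact: sumr_ge0.
by apply: sumr_ge0 => k _; apply: sumr_ge0.
Qed.

Lemma coord_bound (x : 'cV[R]_n) i M : 0 <= M -> V x <= M ->
  `|x i 0| <= 1 + (\sum_j c j) * M.
Proof.
move=> M0 xM; have := coord_sqr_le HR c0 symRC x i; rewrite -/Om -/(V x) => h.
have h2 : c i * V x <= (\sum_j c j) * M.
  apply: ler_pM => //; first exact: ltW.
  rewrite (bigD1 i)//= lerDl; apply: sumr_ge0 => j _; exact: ltW.
have := sqr_ge0 (`|x i 0| - 1); rewrite -(real_normK (num_real (x i 0))) in h.
have := normr_ge0 (x i 0); nra.
Qed.

Lemma Omega_coord_bound (x : 'cV[R]_n) i M : 0 <= M -> V x <= M ->
  `|(Om *m x) i 0| <= cO * (1 + (\sum_j c j) * M).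
Proof.
move=> M0 xM; rewrite mxE; apply: le_trans (ler_norm_sum _ _ _) _.
have X0 : 0 <= 1 + (\sum_j c j) * M.
  by rewrite addr_ge0// mulr_ge0// sumr_ge0// => j _; exact: ltW.
apply: (@le_trans _ _ (\sum_j `|Om i j| * (1 + (\sum_j c j) * M))).
  by apply: ler_sum => j _; rewrite normrM ler_wpM2l//; exact: coord_bound.
rewrite -big_distrl/= ler_wpM2r//.
by rewrite /cO [leRHS](bigD1 i)//= lerDl; apply: sumr_ge0 => k _; apply: sumr_ge0.
Qed.

(** On [C] the coefficients of the expansion are bounded and known at time [t], so independence
    evaluates the first- and second-order terms. The error [h^(3/2)] is small enough to be summed
    over a number of steps of order [1 / h]. *)
Lemma one_step (g g1 g2 : R -> R) (K M : R) : taylor_bounded g g1 g2 K -> 0 <= M ->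
  exists2 K1, 0 <= K1 & forall t h C, 0 <= t -> 0 < h -> h <= 1 -> F t C ->
    (forall w, C w -> V (Z t w) <= M) ->
    let f w := \1_C w * (g (V (Z t w + (B (t + h) w - B t w))) - g (V (Z t w)) -
               h * generator Om A mu g1 g2 (Z t w)) in
    L1 P f /\ `|Ex P f| <= K1 * (h * Num.sqrt h).
Proof.
move=> tg M0; have K0 := taylor_bounded_ge0 tg.
(* [aB] bounds the entries of [2 Om x] where [V <= M] and [bB] the second-order coefficients; [C2]
   and [C4] bound the second and fourth moments in units of [h] and [h^2], and [C5] the squared
   drift. *)
pose aB := 2 * (cO * (1 + (\sum_j c j) * M)).
have X0 : 0 <= 1 + (\sum_j c j) * M.
  by rewrite addr_ge0// mulr_ge0// sumr_ge0// => j _; exact: ltW.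
have aB0 : 0 <= aB by rewrite /aB !mulr_ge0.
pose c1 := aB + cO; have c10 : 0 <= c1 by rewrite addr_ge0.
pose C1 := K * (8 * c1 ^+ 3 + 4 * c1 ^+ 2 + 4 * c1).
have C10 : 0 <= C1 by rewrite /C1 mulr_ge0// !addr_ge0 ?mulr_ge0 ?exprn_ge0.
pose nR := n%:R : R.
pose C2 := \sum_i (A i i + mu i 0 ^+ 2).
pose C4 := \sum_i 8 * (mu i 0 ^+ 4 + 128 * A i i ^+ 2).
pose bB := K * cO + K * (aB * aB).
have bB0 : 0 <= bB by rewrite /bB addr_ge0 ?mulr_ge0.
pose C5 := \sum_i \sum_j bB * `|mu i 0 * mu j 0|.
have C50 : 0 <= C5.
  by apply: sumr_ge0 => i _; apply: sumr_ge0 => j _; rewrite mulr_ge0.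
have Aii i : 0 <= A i i.
  have [_ Apos] := HA.
  have d0 : (delta_mx i 0 : 'cV[R]_n) != 0.
    by apply/eqP => /colP/(_ i); rewrite !mxE !eqxx => /eqP; rewrite oner_eq0.
  by have := Apos _ d0; rewrite trmx_delta -rowE -colE !mxE => /ltW.
have C20 : 0 <= C2 by apply: sumr_ge0 => i _; rewrite addr_ge0// sqr_ge0.
have C40 : 0 <= C4.
  apply: sumr_ge0 => i _; rewrite mulr_ge0// addr_ge0//.
    by rewrite (_ : 4 = 2 * 2)%N// exprM sqr_ge0.
  by rewrite mulr_ge0// sqr_ge0.
exists (C1 * (nR * C2 + nR ^+ 3 * C4) + C5).
  by rewrite addr_ge0// mulr_ge0// addr_ge0// mulr_ge0// exprn_ge0.
move=> t h C t0 h0 h1 FC CM f.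
have Mmean := fun i => increment_mean HF HB HA t0 h0 h1 i.
have Mcov := fun i j => increment_covariance HF HB HA t0 h0 h1 i j.
have M4 := fun i => increment_fourth_moment HF HB HA t0 h0 h1 i.
have Ind1 := fun U k i => @increment_indep _ _ _ P _ F mu A z B HF HB HA t h t0 h0 h1 U k i.
have Ind2 := fun U k i j => @increment_indep2 _ _ _ P _ F mu A z B HF HB HA t h t0 h0 h1 U k i j.
pose b i w := (B (t + h) w - B t w) i 0.
have mb i : measurable_fun setT (b i) by exact: (increment_measurable HF HB t0 h0).
pose v w := V (Z t w); pose al i w := 2 * (Om *m Z t w) i 0.
pose alpha i w := \1_C w * (g1 (v w) * al i w).
pose beta i j w := \1_C w * (g1 (v w) * Om i j + g2 (v w) / 2 * (al i w * al j w)).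
have FZ i : measurable_wrt (F t) (fun w => Z t w i 0) by exact: adZ.
have Fv : measurable_wrt (F t) v by exact: measurable_wrt_qform.
have Fg1 : measurable_wrt (F t) (fun w => g1 (v w)).
  by apply: measurable_wrt_comp => //; [exact: taylor_meas1 tg|move=> w; exact: Vge0].
have Fg2 : measurable_wrt (F t) (fun w => g2 (v w)).
  by apply: measurable_wrt_comp => //; [exact: taylor_meas2 tg|move=> w; exact: Vge0].
have Fg : measurable_wrt (F t) (fun w => g (v w)).
  by apply: measurable_wrt_comp => //; [exact: taylor_meas tg|move=> w; exact: Vge0].
have Fal i : measurable_wrt (F t) (al i).
  apply: measurable_wrtM => //; first exact: measurable_wrt_cst.
  exact: measurable_wrt_mulmx.
have FCi : measurable_wrt (F t) (\1_C : T -> R) by exact: measurable_wrt_indic.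
have Falpha i : measurable_wrt (F t) (alpha i) by do 2 apply: measurable_wrtM => //.
have Fbeta i j : measurable_wrt (F t) (beta i j).
  apply: measurable_wrtM => //; apply: measurable_wrtD => //; apply: measurable_wrtM => //.
  - exact: measurable_wrt_cst.
  - by apply: measurable_wrtM => //; exact: measurable_wrt_cst.
  - exact: measurable_wrtM.
have mF X := @measurable_wrt_measurable _ _ _ _ HF t X.
have alB i w : C w -> `|al i w| <= aB.
  move=> Cw; rewrite /al normrM (@ger0_norm _ 2)// ler_wpM2l//.
  exact: Omega_coord_bound (CM w Cw).
have offC (x k : R) w : 0 <= k -> (C w -> `|x| <= k) -> `|\1_C w * x| <= k.
  move=> k0 H; rewrite indicE; have [Cw|nCw] := pselect (C w).
    by rewrite mem_set// mul1r; exact: H.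
  by rewrite memNset// mul0r normr0.
have alphaB i w : `|alpha i w| <= K * aB.
  apply: offC => [|Cw]; first exact: mulr_ge0.
  by rewrite normrM; apply: ler_pM => //; [exact: taylor_le1 tg _ (Vge0 _)|exact: alB].
have betaB i j w : `|beta i j w| <= bB.
  apply: offC => // Cw; apply: le_trans (ler_normD _ _) _; apply: lerD.
    by rewrite normrM; apply: ler_pM => //; exact: taylor_le1 tg _ (Vge0 _).
  rewrite normrM; apply: ler_pM => //.
    rewrite normrM (@ger0_norm _ (2^-1))//.
    have := taylor_le2 tg (Vge0 (Z t w)); have := normr_ge0 (g2 (v w)); rewrite /v; lra.
  by rewrite normrM; apply: ler_pM => //; exact: alB.
pose main w := \sum_i alpha i w * b i w + \sum_i \sum_j beta i j w * (b i w * b j w).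
have Ialpha i : L1 P (fun w => alpha i w * b i w).
  by apply: (L1_bmul (mF _ (Falpha i)) (alphaB i)); have [] := Mmean i.
have Ibeta i j : L1 P (fun w => beta i j w * (b i w * b j w)).
  by apply: (L1_bmul (mF _ (Fbeta i j)) (betaB i j)); have [] := Mcov i j.
have Ibeta' i : L1 P (fun w => \sum_j beta i j w * (b i w * b j w)) by exact: L1_sum.
have Imain : L1 P main by apply: L1D; exact: L1_sum.
have Emain : Ex P main = \sum_i Ex P (alpha i) * (h * mu i 0) +
    \sum_i \sum_j Ex P (beta i j) * (h * A i j + h ^+ 2 * (mu i 0 * mu j 0)).
  rewrite ExD; [|exact: L1_sum|exact: L1_sum].
  rewrite !Ex_sum//; congr (_ + _).
    by apply: eq_bigr => i _; exact: Ind1 (Falpha i) (alphaB i).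
  apply: eq_bigr => i _; rewrite Ex_sum//; apply: eq_bigr => j _.
  exact: Ind2 (Fbeta i j) (betaB i j).
have IAl i : L1 P (alpha i) by apply: (@L1_bounded _ _ _ _ _ (K * aB)) => //; exact: mF.
have IBe i j : L1 P (beta i j) by apply: (@L1_bounded _ _ _ _ _ bB) => //; exact: mF.
(* The generator is rewritten with the same coefficients [alpha] and [beta] as [main], so that the
   two expectations cancel term by term. *)
pose gen w := \sum_i mu i 0 * alpha i w + \sum_i \sum_j A i j * beta i j w.
have Igen2 : L1 P (fun w => \sum_i \sum_j A i j * beta i j w).
  by apply: L1_sum => i; apply: L1_sum => j; exact: L1Z.
have Igen1 : L1 P (fun w => \sum_i mu i 0 * alpha i w).
  by apply: L1_sum => i; exact: L1Z.
have Igen : L1 P gen by exact: L1D.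
have Egen : Ex P gen = \sum_i mu i 0 * Ex P (alpha i) + \sum_i \sum_j A i j * Ex P (beta i j).
  rewrite ExD// !Ex_sum//; last first.
  - by move=> i; apply: L1Z.
  - by move=> i; apply: L1_sum => j; exact: L1Z.
  congr (_ + _); first by apply: eq_bigr => i _; rewrite ExZ.
  apply: eq_bigr => i _; rewrite Ex_sum//; last by move=> j; exact: L1Z.
  by apply: eq_bigr => j _; rewrite ExZ.
have genE w : gen w = \1_C w * generator Om A mu g1 g2 (Z t w).
  rewrite /gen /generator -/(V _) -/(v w) (trace_sum Rm c HA) -/Om.
  have -> : qform Om (Z t w) mu = \sum_i (Om *m Z t w) i 0 * mu i 0.
    rewrite /qform mxE; apply: eq_bigr => i _; congr (_ * _).
    have : (Om *m Z t w)^T = (Z t w)^T *m Om by rewrite trmx_mul Omega_sym.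
    by move/matrixP/(_ 0 i); rewrite mxE.
  rewrite qformE.
  have -> : \sum_i mu i 0 * alpha i w = \1_C w * (g1 (v w) * (2 * (\sum_i (Om *m Z t w) i 0 * mu i 0))).
    rewrite !big_distrr/=; by apply: eq_bigr => i _; rewrite /alpha /al; ring.
  have -> : \sum_i \sum_j A i j * beta i j w =
     \1_C w * (g1 (v w) * \sum_i \sum_j Om i j * A i j) +
     \1_C w * (2 * g2 (v w) * \sum_i \sum_j A i j * ((Om *m Z t w) i 0 * (Om *m Z t w) j 0)).
    rewrite !big_distrr/= -big_split/=; apply: eq_bigr => i _.
    rewrite !big_distrr/= -big_split/=; apply: eq_bigr => j _.
    by rewrite /beta /al; field.
  by ring.
pose r w := \sum_i `|b i w|.
have r0 w : 0 <= r w by exact: sumr_ge0.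
pose V1 w := V (Z t w + (B (t + h) w - B t w)).
pose rem w := f w - (main w - h * gen w).
have remle w : `|rem w| <= C1 * r w ^+ 3.
  pose p := \sum_i al i w * b i w; pose q := \sum_i \sum_j Om i j * (b i w * b j w).
  have VE : V1 w = v w + (p + q).
    by have := V_increment symRC (Z t w) (B (t + h) w - B t w); rewrite -/Om -/(V _) -/(V _) -/(V1 w) -/(v w) => <-; rewrite addrC subrK.
  have remE : rem w = \1_C w * (g (v w + (p + q)) - g (v w) - (g1 (v w) * (p + q) + g2 (v w) / 2 * p ^+ 2)).
    rewrite /rem genE /f -/(V1 w) -/(v w) VE.
    have -> : main w = \1_C w * (g1 (v w) * (p + q) + g2 (v w) / 2 * p ^+ 2).
      have e1 : \sum_i alpha i w * b i w = \1_C w * (g1 (v w) * p).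
        by rewrite /p !big_distrr/=; apply: eq_bigr => i _; rewrite /alpha; ring.
      have pp : p ^+ 2 = \sum_i \sum_j al i w * b i w * (al j w * b j w).
        by rewrite expr2 {1}/p big_distrl/=; apply: eq_bigr => i _; rewrite big_distrr.
      have e2 : \sum_i \sum_j beta i j w * (b i w * b j w) =
          \1_C w * (g1 (v w) * q) + \1_C w * (g2 (v w) / 2 * p ^+ 2).
        rewrite pp /q !big_distrr/= -big_split/=; apply: eq_bigr => i _.
        rewrite !big_distrr/= -big_split/=; apply: eq_bigr => j _.
        by rewrite /beta; field.
      by rewrite /main e1 e2; ring.
    by ring.
  rewrite remE; apply: offC => [|Cw]; first by rewrite mulr_ge0// exprn_ge0.
  apply: (taylor_remainder_le tg) => //; try exact: Vge0.
  - by rewrite -VE; exact: Vge0.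
  - apply: (@le_trans _ _ (aB * r w)); last by rewrite ler_wpM2r// lerDl.
    apply: le_trans (ler_norm_sum _ _ _) _; rewrite big_distrr/=.
    by apply: ler_sum => i _; rewrite normrM ler_wpM2r// alB.
  - apply: (@le_trans _ _ (cO * r w ^+ 2)); last by rewrite ler_wpM2r ?sqr_ge0// lerDr.
    have -> : cO * r w ^+ 2 = \sum_i \sum_j cO * (`|b i w| * `|b j w|).
      move: cO => k; rewrite expr2 /r big_distrl/= big_distrr/=.
      by apply: eq_bigr => i _; rewrite !big_distrr.
    apply: le_trans (ler_norm_sum _ _ _) _; apply: ler_sum => i _.
    apply: le_trans (ler_norm_sum _ _ _) _; apply: ler_sum => j _.
    by rewrite normrM (normrM (b i w)) ler_wpM2r// mulr_ge0.
have mV1 : measurable_fun setT V1.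
  rewrite (_ : V1 = fun w => \sum_i \sum_j Om i j * ((Z t w i 0 + b i w) * (Z t w j 0 + b j w))).
    apply: measurable_sum => i; apply: measurable_sum => j.
    apply: measurable_funM => //; apply: measurable_funM; apply: measurable_funD => //; exact: mF.
  apply/funext => w; rewrite /V1 /V qformE; apply: eq_bigr => i _; apply: eq_bigr => j _.
  by rewrite /b !mxE.
have mgV1 : measurable_fun setT (fun w => g (V1 w)).
  apply: (measurable_comp _ _ (taylor_meas tg) mV1).
    rewrite [X in measurable X](_ : _ = `[0, +oo[%classic)//.
    by apply/seteqP; split=> x /=; rewrite in_itv/= andbT.
  by move=> _ [w _ <-] /=; exact: Vge0.
have fE w : f w = \1_C w * (g (V1 w) - g (v w)) - h * gen w by rewrite genE /f; ring.
have mf : measurable_fun setT f.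
  rewrite (_ : f = fun w => \1_C w * (g (V1 w) - g (v w)) - h * gen w); last exact/funext.
  apply: measurable_funB; last by apply: measurable_funM => //; exact: L1_measurable Igen.
  apply: measurable_funM; first exact: mF.
  by apply: measurable_funB => //; exact: mF.
have Img : L1 P (fun w => main w - h * gen w) by apply: L1B => //; exact: L1Z.
have mrem : measurable_fun setT rem by apply: measurable_funB => //; exact: L1_measurable Img.
have s0 : 0 < Num.sqrt h by rewrite sqrtr_gt0.
set s := Num.sqrt h in s0 *.
have ss : s * s = h by rewrite -expr2 sqr_sqrtr// ltW.
(* The cubic remainder is interpolated by [r^3 <= s r^2 + r^4 / s]; with [s = sqrt h] and moments of
   order [h] and [h^2], both terms have mean of order [h^(3/2)]. *)
pose dom w := C1 * (s * (nR * \sum_i b i w * b i w) + s^-1 * (nR ^+ 3 * \sum_i b i w ^+ 4)).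
have remdom w : `|rem w| <= dom w.
  apply: le_trans (remle w) _; rewrite /dom ler_wpM2l//.
  have h2 : r w ^+ 2 <= nR * \sum_i b i w * b i w.
    apply: le_trans (sum_sqr_le _) _; rewrite ler_wpM2l//; apply: ler_sum => i _.
    by rewrite real_normK ?num_real// expr2.
  have h4 : r w ^+ 4 <= nR ^+ 3 * \sum_i b i w ^+ 4.
    have -> : r w ^+ 4 = (r w ^+ 2) ^+ 2 by rewrite -exprM.
    apply: (@le_trans _ _ ((nR * \sum_i b i w ^+ 2) ^+ 2)).
      by rewrite lerXn2r ?nnegrE ?sqr_ge0//  mulr_ge0// sumr_ge0// => *; exact: sqr_ge0.
    rewrite exprMn (_ : nR ^+ 3 = nR ^+ 2 * nR); last by rewrite -exprSr.
    rewrite -mulrA ler_wpM2l ?sqr_ge0//.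
    apply: le_trans (sum_sqr_le _) _; rewrite ler_wpM2l//; apply: ler_sum => i _.
    by rewrite -exprM.
  apply: (@le_trans _ _ (s * r w ^+ 2 + s^-1 * r w ^+ 4)); last first.
    by apply: lerD; rewrite ler_wpM2l ?invr_ge0// ltW.
  set y := r w; have y0 : 0 <= y by exact: r0.
  have -> : s * y ^+ 2 + s^-1 * y ^+ 4 = s^-1 * (y ^+ 2 * (s ^+ 2 + y ^+ 2)) by field; rewrite gt_eqF.
  rewrite -[leLHS](mulKf (lt0r_neq0 s0)) ler_wpM2l ?invr_ge0 ?(ltW s0)//.
  rewrite (_ : s * y ^+ 3 = y ^+ 2 * (s * y)); last by ring.
  rewrite ler_wpM2l ?sqr_ge0//; have := sqr_ge0 (s - y); have : 0 <= s * y by rewrite mulr_ge0// ltW.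
  lra.
have Ibb i : L1 P (fun w => b i w * b i w) by have [] := Mcov i i.
have Ib4 i : L1 P (fun w => b i w ^+ 4) by have [] := M4 i.
have IS2 : L1 P (fun w => s * (nR * \sum_i b i w * b i w)) by do 2 apply: L1Z; exact: L1_sum.
have IS4 : L1 P (fun w => s^-1 * (nR ^+ 3 * \sum_i b i w ^+ 4)) by do 2 apply: L1Z; exact: L1_sum.
have Idom : L1 P dom by apply: L1Z; exact: L1D.
have Irem : L1 P rem by exact: L1_dominated mrem remdom Idom.
have f2E : f = fun w => rem w + (main w - h * gen w).
  by apply/funext => w; rewrite /rem; ring.
split; first by rewrite f2E; exact: L1D.
have Edom : Ex P dom <= C1 * (nR * C2 + nR ^+ 3 * C4) * (h * s).
  rewrite /dom ExZ; last exact: L1D.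
  rewrite -mulrA ler_wpM2l// ExD// !ExZ; try by [exact: L1_sum|apply: L1Z; exact: L1_sum].
  rewrite !Ex_sum// mulrDl; apply: lerD.
    have -> : nR * C2 * (h * s) = s * (nR * (C2 * h)) by ring.
    rewrite !ler_wpM2l// ?(ltW s0)// /C2 big_distrl/=; apply: ler_sum => i _.
    have [_ ->] := Mcov i i; rewrite mulrDl [h * _]mulrC lerD2l -expr2 mulrC.
    by rewrite ler_wpM2l ?sqr_ge0// expr2 ler_piMl// ltW.
  have -> : nR ^+ 3 * C4 * (h * s) = s^-1 * (nR ^+ 3 * (C4 * h ^+ 2)).
    by rewrite -ss; field; rewrite gt_eqF.
  rewrite !ler_wpM2l ?exprn_ge0 ?invr_ge0 ?(ltW s0)// /C4 big_distrl/=.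
  by apply: ler_sum => i _; have [_] := M4 i.
have s1 : s <= 1 by rewrite leNgt; apply/negP => s1; nra.
have hs : h <= s by rewrite -[leLHS]ss; nra.
have hle : h ^+ 2 <= h * s by rewrite expr2 ler_wpM2l// ltW.
(* What survives the cancellation is the squared drift in the second moments, of order [h^2]. *)
have -> : Ex P f = Ex P rem + h ^+ 2 * \sum_i \sum_j Ex P (beta i j) * (mu i 0 * mu j 0).
  have Ihgen : L1 P (fun w => h * gen w) by exact: L1Z.
  have -> : Ex P f = Ex P rem + Ex P (fun w => main w - h * gen w).
    by rewrite [in LHS]f2E (ExD Irem Img).
  rewrite (ExB Imain Ihgen) (ExZ _ Igen) Emain Egen; congr (_ + _).
  rewrite mulrDr !big_distrr/= opprD addrACA -sumrB big1; last by move=> i _; ring.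
  rewrite add0r -sumrB; apply: eq_bigr => i _; rewrite !big_distrr/= -sumrB.
  by apply: eq_bigr => j _; ring.
apply: le_trans (ler_normD _ _) _; rewrite mulrDl; apply: lerD.
  apply: le_trans (Ex_norm Irem) _; apply: le_trans Edom.
  by apply: Ex_le => //; exact: L1_norm.
rewrite normrM (@ger0_norm _ (h ^+ 2)) ?sqr_ge0// mulrC; apply: ler_pM => //; first exact: sqr_ge0.
apply: le_trans (ler_norm_sum _ _ _) _; apply: ler_sum => i _.
apply: le_trans (ler_norm_sum _ _ _) _; apply: ler_sum => j _.
rewrite normrM ler_wpM2r//; apply: le_trans (Ex_norm (IBe i j)) _.
rewrite -[leRHS](Ex_cst P); apply: Ex_le => //; [exact: L1_norm|exact: L1_cst].
Qed.
End OneStep.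

(** * A discrete Dynkin formula on a grid *)

Section Grid.
Context {R : realType}.

Definition mesh (tau : R) (N : nat) : R := tau / N.+1%:R.
Definition grid (s tau : R) (N k : nat) : R := s + k%:R * mesh tau N.

Lemma mesh_gt0 tau N : 0 < tau -> 0 < mesh tau N.
Proof. by move=> tau0; rewrite divr_gt0. Qed.

Lemma mesh_small tau e : 0 < tau -> 0 < e ->
  exists N0, forall N, (N0 <= N)%N -> mesh tau N < e.
Proof.
move=> tau0 e0; have te0 : 0 <= tau / e by rewrite ltW// divr_gt0.
exists (Num.bound (tau / e)) => N lN.
rewrite /mesh ltr_pdivrMr// mulrC -ltr_pdivrMr//.
apply: lt_le_trans (archi_boundP te0) _; rewrite ler_nat.
exact: leq_trans lN (leqnSn _).
Qed.

Lemma grid0 s tau N : grid s tau N 0 = s.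
Proof. by rewrite /grid mul0r addr0. Qed.

Lemma gridS s tau N k : grid s tau N k.+1 = grid s tau N k + mesh tau N.
Proof. by rewrite /grid -natr1 mulrDl mul1r addrA. Qed.

Lemma grid_last s tau N : grid s tau N N.+1 = s + tau.
Proof. by rewrite /grid /mesh mulrC divfK// pnatr_eq0. Qed.

Lemma grid_ge s tau N k : 0 < tau -> s <= grid s tau N k.
Proof. by move=> tau0; rewrite lerDl mulr_ge0// ltW// mesh_gt0. Qed.

Lemma grid_le s tau N k : 0 < tau -> (k <= N.+1)%N -> grid s tau N k <= s + tau.
Proof.
move=> tau0 kN; rewrite -(grid_last s tau N) lerD2l ler_wpM2r ?ler_nat//.
by rewrite ltW// mesh_gt0.
Qed.
End Grid.

Section Dynkin.
Context {R : realType} {d : measure_display} {T : measurableType d}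
  (P : probability T R) {n : nat} (F : R -> set (set T))
  (Rm : 'M[R]_n) (c : 'I_n -> R)
  (mu : 'cV[R]_n) (A : 'M[R]_n) (z : 'cV[R]_n) (B L Z : R -> T -> 'cV[R]_n).
Hypotheses (HR : reflection_M_matrix Rm) (c0 : forall i, 0 < c i)
  (symRC : (Rm *m diagC c)^T = Rm *m diagC c)
  (HA : sym_pos_def A) (HS : is_SRBM Rm mu A z P F B L Z).
Let Om := invmx (Rm *m diagC c).
Let V (x : 'cV[R]_n) := qform Om x x.
Let VZ t w := V (Z t w).
Let lam t w := \sum_i L t w i 0.

Let Vge0 x : 0 <= V x. Proof. exact: Omega_psd. Qed.

Let HF : is_filtration F. Proof. by case: HS => -[]. Qed.
Let HB : brownian_motion P F mu A z B. Proof. by case: HS => -[]. Qed.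
Let adZ : adapted F Z. Proof. by case: HS => _ []. Qed.
Let adL : adapted F L. Proof. by case: HS => _ _ _ []. Qed.
Let adB : adapted F B. Proof. by case: HB. Qed.
Let cZ : continuous_paths Z. Proof. by case: HS => _ []. Qed.
Let cL : continuous_paths L. Proof. by case: HS => _ _ _ []. Qed.
Let Z0 t w i : 0 <= t -> 0 <= Z t w i 0.
Proof. by case: HS => _ [_ _ h] _ _ _ /h; exact. Qed.
Let ndL s t w i : 0 <= s -> s <= t -> L s w i 0 <= L t w i 0.
Proof. by case: HS => _ _ _ _ /(_ w i) [_ h _]; exact: h. Qed.
Let L0 t w i : 0 <= t -> 0 <= L t w i 0.
Proof.
by case: HS => _ _ _ _ /(_ w i) [L00 h _] t0; rewrite -[leLHS]L00; exact: h.
Qed.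

Lemma reflected_zero s t w i : 0 <= s -> s <= t -> L s w i 0 < L t w i 0 ->
  exists2 u, s <= u <= t & Z u w i 0 = 0.
Proof.
case: HS => _ _ _ _ /(_ w i) [L00 h hint] s0 st Lst.
by have := stieltjes_int_eq0 (@cL w i) (@cZ w i) L00 h (fun u u0 => Z0 w i u0) hint s0 st Lst.
Qed.

Let c2 := \sum_i 2 / c i + \sum_i \sum_j `|Rm i j / c i|.

Let c20 : 0 <= c2.
Proof.
rewrite addr_ge0//; first by apply: sumr_ge0 => i _; rewrite divr_ge0// ltW.
by apply: sumr_ge0 => i _; apply: sumr_ge0.
Qed.

(** The cost of ignoring reflection over [[s, t]]. Both terms are small relative to the growth of
    [L]: in the first, [Z_i] is close to one of its zeros if [L_i] grows; the second is quadratic in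
    that growth. *)
Lemma reflection_gap s t w : 0 <= s -> s <= t ->
  `|VZ t w - V (Z s w + (B t w - B s w))| <=
  c2 * (\sum_i Z t w i 0 * (L t w i 0 - L s w i 0) + (lam t w - lam s w) ^+ 2).
Proof.
move=> s0 st; have t0 := le_trans s0 st.
case: HS => _ _ ZE _ _.
have -> : Z s w + (B t w - B s w) = Z t w - Rm *m (L t w - L s w).
  by rewrite !ZE// mulmxBr; apply/colP => i; rewrite !mxE; ring.
rewrite /VZ (V_reflection HR c0 symRC).
pose l i := L t w i 0 - L s w i 0.
have l0 i : 0 <= l i by rewrite subr_ge0 ndL.
have lE i : (L t w - L s w) i 0 = l i by rewrite !mxE.
have LamE : lam t w - lam s w = \sum_i l i by rewrite /lam -sumrB.
have lle i : l i <= \sum_i l i by rewrite (bigD1 i)//= lerDl; exact: sumr_ge0.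
apply: le_trans (ler_normB _ _) _; rewrite mulrDr; apply: lerD.
  rewrite ger0_norm; last first.
    rewrite mulr_ge0//; apply: sumr_ge0 => i _.
    by rewrite lE divr_ge0 ?mulr_ge0 ?Z0// ltW.
  rewrite !big_distrr/=; apply: ler_sum => i _; rewrite lE.
  have -> : 2 * (Z t w i 0 * l i / c i) = 2 / c i * (Z t w i 0 * l i) by field; rewrite gt_eqF.
  rewrite ler_wpM2r ?mulr_ge0 ?Z0//.
  rewrite /c2 (bigD1 i)//= -addrA lerDl addr_ge0//.
    by apply: sumr_ge0 => j _; rewrite divr_ge0// ltW.
  by apply: sumr_ge0 => j _; apply: sumr_ge0.
apply: le_trans (ler_norm_sum _ _ _) _.
apply: (@le_trans _ _ (\sum_i \sum_j `|Rm i j / c i| * (\sum_i l i) ^+ 2)).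
  apply: ler_sum => i _; apply: le_trans (ler_norm_sum _ _ _) _.
  apply: ler_sum => j _; rewrite normrM !lE ler_wpM2l//.
  by rewrite ger0_norm ?mulr_ge0// expr2; apply: ler_pM.
have e : \sum_i \sum_j `|Rm i j / c i| * (\sum_i l i) ^+ 2 =
    (\sum_i \sum_j `|Rm i j / c i|) * (\sum_i l i) ^+ 2.
  by rewrite big_distrl/=; apply: eq_bigr => i _; rewrite big_distrl.
rewrite e LamE ler_wpM2r ?sqr_ge0// /c2 lerDr.
by apply: sumr_ge0 => i _; rewrite divr_ge0// ltW.
Qed.

Lemma lam_le s t w : 0 <= s -> s <= t -> lam s w <= lam t w.
Proof. by move=> s0 st; apply: ler_sum => i _; exact: ndL. Qed.

Lemma lam_ge0 t w : 0 <= t -> 0 <= lam t w.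
Proof. by move=> t0; apply: sumr_ge0 => i _; exact: L0. Qed.

(** The step following grid time [k] counts only on this event, so the sum stops at the first grid
    time outside [D]. The event is known at that grid time, as [one_step] requires. *)
Definition alive (D : R -> set T) (G : set T) (s tau : R) (N k : nat) : set T :=
  [set w | G w /\ forall j, (j <= k)%N -> D (grid s tau N j) w].

Variables (D : R -> set T) (G : set T) (s tau M : R).
Hypotheses (s0 : 0 <= s) (tau0 : 0 < tau) (M0 : 0 <= M)
  (FG : F s G) (FD : forall t, 0 <= t -> F t (D t))
  (DV : forall t w, 0 <= t -> D t w -> VZ t w <= M)
  (DL : forall t w i, 0 <= t -> D t w -> L t w i 0 <= M).

Local Notation al := (alive D G s tau).
Local Notation t_ := (grid s tau).

Let t0 N k : 0 <= t_ N k.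
Proof. exact: le_trans s0 (grid_ge _ _ _ tau0). Qed.

Let tS N k : t_ N k <= t_ N k.+1.
Proof. by rewrite gridS lerDl ltW// mesh_gt0. Qed.

Lemma alive_measurable_wrt N k : F (t_ N k) (al N k).
Proof.
have [sF _ mono] := HF.
have tle j : (j <= k)%N -> t_ N j <= t_ N k.
  by move=> jk; rewrite lerD2l ler_wpM2r ?ler_nat// ltW// mesh_gt0.
have -> : al N k = G `&` \bigcap_(j in [set j | (j <= k)%N]) D (t_ N j).
  by apply/seteqP; split => w [].
pose Tt := g_sigma_algebraType (F (t_ N k)).
have mF (E : set T) : F (t_ N k) E -> measurable (E : set Tt).
  by move=> FE; exact: sub_sigma_algebra.
rewrite -(sigma_algebra_id (sF (t_ N k))).
apply: (@measurableI _ Tt).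
  by apply: mF; apply: mono FG => //; exact: grid_ge.
apply: (@bigcap_measurable _ Tt); first by exists 0%N.
move=> j /= jk; apply: mF; apply: mono (FD (t0 N j)) => //; exact: tle.
Qed.

Lemma aliveS N k : al N k.+1 `<=` al N k.
Proof. by move=> w [Gw H]; split=> // j jk; apply: H; exact: leq_trans jk _. Qed.

Lemma alive_D N k w : al N k w -> D (t_ N k) w.
Proof. by move=> [_]; apply. Qed.

Lemma alive_measurable N k : measurable (al N k).
Proof. exact: filtration_measurable HF _ _ (alive_measurable_wrt N k). Qed.

Variables (g g1 g2 : R -> R) (K Kg : R).
Hypotheses (tg : taylor_bounded g g1 g2 K) (gK : forall v, 0 <= v -> `|g v| <= Kg).

Let K0 : 0 <= K. Proof. exact: taylor_bounded_ge0 tg. Qed.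

Let D_ N k w := Z (t_ N k) w + (B (t_ N k.+1) w - B (t_ N k) w).
Let e_ N k w := \1_(al N k) w * (g (VZ (t_ N k.+1) w) - g (V (D_ N k w))).

Let e_gap N k w : `|e_ N k w| <= K * (c2 * (\sum_i Z (t_ N k.+1) w i 0 *
  (L (t_ N k.+1) w i 0 - L (t_ N k) w i 0) + (lam (t_ N k.+1) w - lam (t_ N k) w) ^+ 2)).
Proof.
apply: (@le_trans _ _ `|g (VZ (t_ N k.+1) w) - g (V (D_ N k w))|).
  rewrite /e_ normrM ler_piMl//.
  by rewrite indicE; case: (_ \in _); rewrite ?normr1 ?normr0.
apply: le_trans (taylor_lip tg _ _) _; try exact: Vge0.
by rewrite ler_wpM2l// reflection_gap.
Qed.

Let zM := 1 + (\sum_j c j) * M.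
Let C3 := K * (c2 * (zM + n%:R * M)).

Let zM0 : 0 <= zM.
Proof. by rewrite addr_ge0// mulr_ge0// sumr_ge0// => j _; exact: ltW. Qed.

Let nM0 : 0 <= n%:R * M. Proof. by rewrite mulr_ge0. Qed.

Let C30 : 0 <= C3. Proof. by rewrite !mulr_ge0// addr_ge0. Qed.

(* Summed over [k], both differences telescope, so the total reflection error
   is bounded uniformly in the grid. *)
Let e_telescope N k w : `|e_ N k w| <=
  C3 * (Num.min (lam (t_ N k.+1) w) (n%:R * M) - Num.min (lam (t_ N k) w) (n%:R * M)) +
  2 * Kg * (\1_(al N k) w - \1_(al N k.+1) w).
Proof.
have Kg0 : 0 <= Kg by exact: le_trans (gK (lexx 0)).
have lS := lam_le w (t0 N k) (tS N k).
have minS : 0 <= Num.min (lam (t_ N k.+1) w) (n%:R * M) - Num.min (lam (t_ N k) w) (n%:R * M).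
  by rewrite subr_ge0 le_min !ge_min lS lexx orbT.
(* Only the exit step can end outside [D], where [L] is uncontrolled; it costs at most [2 Kg]. When
   the step ends inside [D], [lam] is at most [n M] and the truncation by [Num.min] is inactive. *)
have [a1|na1] := pselect (al N k.+1 w); last first.
  have [a0|na0] := pselect (al N k w); last first.
    rewrite /e_ !indicE !memNset// mul0r normr0 subrr mulr0 addr0.
    by rewrite mulr_ge0.
  rewrite /e_ !indicE mem_set// memNset// mul1r subr0 mulr1.
  apply: le_trans (ler_normB _ _) _.
  have h1 : `|g (VZ (t_ N k.+1) w)| <= Kg by apply: gK; exact: Vge0.
  have h2 : `|g (V (D_ N k w))| <= Kg by apply: gK; exact: Vge0.
  have := mulr_ge0 C30 minS; lra.
have a0 := aliveS a1.
have -> : (\1_(al N k) w - \1_(al N k.+1) w : R) = 0.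
  by rewrite !indicE !mem_set// subrr.
rewrite mulr0 addr0.
have D1 := alive_D a1.
have lamle : lam (t_ N k.+1) w <= n%:R * M.
  rewrite -[n in n%:R]card_ord mulr_natl -sumr_const; apply: ler_sum => i _.
  exact: DL.
rewrite !min_l//; last exact: le_trans lamle.
apply: le_trans (e_gap N k w) _.
set dl := lam _ _ - lam _ _; have dl0 : 0 <= dl by rewrite subr_ge0.
rewrite /C3 -!mulrA ler_wpM2l// ler_wpM2l// mulrDl; apply: lerD.
  rewrite /dl /lam -sumrB big_distrr/=; apply: ler_sum => i _.
  rewrite ler_wpM2r ?subr_ge0 ?ndL//.
  apply: le_trans (ler_norm _) _.
  exact: (coord_bound HR c0 symRC i M0 (DV (t0 _ _) D1)).
rewrite expr2 ler_wpM2r//; apply: le_trans lamle.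
by rewrite /dl gerBl lam_ge0.
Qed.

Let E_ N w := \sum_(k < N.+1) e_ N k w.

Let E_bounded N w : `|E_ N w| <= C3 * (n%:R * M) + 2 * Kg.
Proof.
have Kg0 : 0 <= Kg by exact: le_trans (gK (lexx 0)).
apply: le_trans (ler_norm_sum _ _ _) _.
apply: le_trans (ler_sum _ (fun (k : 'I_N.+1) _ => e_telescope N k w)) _.
rewrite big_split/= -!big_distrr/=.
have tel (f : nat -> R) : \sum_(k < N.+1) (f k.+1 - f k) = f N.+1 - f 0%N.
  by rewrite -(big_mkord xpredT (fun k => f k.+1 - f k)) telescope_sumr.
rewrite (tel (fun k => Num.min (lam (t_ N k) w) (n%:R * M))).
have -> : \sum_(k < N.+1) (\1_(al N k) w - \1_(al N k.+1) w) = \1_(al N 0) w - \1_(al N N.+1) w :> R.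
  have := tel (fun k => - \1_(al N k) w); rewrite opprK addrC => <-.
  by apply: eq_bigr => k _; rewrite opprK addrC.
apply: lerD.
  rewrite ler_wpM2l//.
  have : Num.min (lam (t_ N N.+1) w) (n%:R * M) <= n%:R * M by rewrite ge_min lexx orbT.
  have : 0 <= Num.min (lam (t_ N 0) w) (n%:R * M) by rewrite le_min nM0 lam_ge0 ?t0.
  lra.
rewrite -[leRHS]mulr1 ler_wpM2l ?mulr_ge0//.
Qed.

Let gV_measurable (X : T -> 'cV[R]_n) :
  (forall i, measurable_fun setT (fun w => X w i 0)) ->
  measurable_fun setT (fun w => g (V (X w))).
Proof.
move=> mX; apply: (measurable_comp _ _ (taylor_meas tg)).
- rewrite [X in measurable X](_ : _ = `[0, +oo[%classic)//.
  by apply/seteqP; split=> x /=; rewrite in_itv/= andbT.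
- by move=> _ [w _ <-] /=; exact: Vge0.
- rewrite (_ : (fun _ => _) = fun w => \sum_i \sum_j Om i j * (X w i 0 * X w j 0)).
    apply: measurable_sum => i; apply: measurable_sum => j.
    by apply: measurable_funM => //; exact: measurable_funM.
  by apply/funext => w; rewrite /V qformE.
Qed.

Let E_measurable N : measurable_fun setT (E_ N).
Proof.
have mF t X := @measurable_wrt_measurable _ _ _ _ HF t X.
apply: measurable_sum => k; apply: measurable_funM.
  exact/measurable_indic/alive_measurable.
apply: measurable_funB; apply: gV_measurable => i; first exact: mF (adZ (t0 _ _) i).
rewrite (_ : (fun _ => _) = fun w => Z (t_ N k) w i 0 + (B (t_ N k.+1) w i 0 - B (t_ N k) w i 0)).
  apply: measurable_funD; first exact: mF (adZ (t0 _ _) i).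
  by apply: measurable_funB; exact: mF (adB (t0 _ _) i).
by apply/funext => w; rewrite /D_ !mxE.
Qed.

(** Uniform continuity on [[s, s + tau]]: on a fine grid each [Z_i] is within [eta] of a zero
    whenever [L_i] grows, and each [L_i] moves by at most [eta]. The total is then a constant times
    [eta] times the growth of [lam]. *)
Let E_cvg w : E_ N w @[N --> \oo] --> (0 : R).
Proof.
apply/cvgrPdist_le => e e0.
pose lT := lam (s + tau) w.
have sT0 : 0 <= s + tau by rewrite addr_ge0// ltW.
have lT0 : 0 <= lT by exact: lam_ge0.
pose Q := K * c2 * (1 + n%:R) * lT.
have Q0 : 0 <= Q by rewrite !mulr_ge0// addr_ge0.
pose eta := e / (Q + 1).
have eta0 : 0 < eta by rewrite divr_gt0// ltr_wpDl.
have UCZ i := uniformly_continuous_on_segment (s + tau) (@cZ w i) eta0.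
have UCL i := uniformly_continuous_on_segment (s + tau) (@cL w i) eta0.
have [dl dl0 Hdl] : exists2 dl, 0 < dl & forall i x y, 0 <= x <= s + tau -> 0 <= y -> `|x - y| < dl ->
    `|Z x w i 0 - Z y w i 0| < eta /\ `|L x w i 0 - L y w i 0| < eta.
  have /choice[dz Hdz] : forall i, exists dl, 0 < dl /\ forall x y, 0 <= x <= s + tau -> 0 <= y ->
      `|x - y| < dl -> `|Z x w i 0 - Z y w i 0| < eta /\ `|L x w i 0 - L y w i 0| < eta.
    move=> i; have [d1 d10 H1] := UCZ i; have [d2 d20 H2] := UCL i.
    exists (Num.min d1 d2); split; first by rewrite lt_min d10.
    move=> x y xs y0; rewrite lt_min => /andP[xy1 xy2].
    by split; [exact: H1|exact: H2].
  exists (\big[Num.min/1]_i dz i).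
    by apply/bigmin_gtP; split=> // i _; have [] := Hdz i.
  move=> i x y xs y0 xy; have [_ H] := Hdz i; apply: H => //.
  apply: lt_le_trans xy _; exact: bigmin_le_cond.
have [N0 HN0] := mesh_small tau0 dl0.
exists N0 => // N /= N0N.
rewrite sub0r normrN.
have hm := HN0 N N0N.
have m0 := mesh_gt0 N tau0.
apply: le_trans (ler_norm_sum _ _ _) _.
have step (k : 'I_N.+1) : `|e_ N k w| <= K * c2 * (1 + n%:R) * eta * (lam (t_ N k.+1) w - lam (t_ N k) w).
  apply: le_trans (e_gap N k w) _.
  have tk1 : t_ N k.+1 <= s + tau by exact: grid_le.
  have tk : t_ N k <= s + tau by exact: le_trans (tS N k) tk1.
  have dt : `|t_ N k.+1 - t_ N k| < dl by rewrite gridS addrAC subrr add0r gtr0_norm.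
  set dlam := lam _ _ - lam _ _.
  have dlam0 : 0 <= dlam by rewrite subr_ge0 lam_le.
  have -> : K * c2 * (1 + n%:R) * eta * dlam = K * (c2 * (eta * dlam + n%:R * eta * dlam)) by ring.
  rewrite ler_wpM2l// ler_wpM2l//; apply: lerD.
    rewrite /dlam /lam -sumrB big_distrr/=; apply: ler_sum => i _.
    have := ndL w i (t0 N k) (tS N k); rewrite le_eqVlt => /orP[/eqP ->|lt].
      by rewrite subrr !mulr0.
    rewrite ler_wpM2r ?subr_ge0 ?(ltW lt)//.
    have [u /andP[u1 u2] Zu] := reflected_zero (t0 N k) (tS N k) lt.
    have [] := Hdl i (t_ N k.+1) u.
    - by rewrite t0 tk1.
    - exact: le_trans (t0 N k) u1.
    - rewrite ger0_norm ?subr_ge0//; apply: le_lt_trans hm.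
      by move: u1; rewrite gridS; lra.
    by rewrite Zu subr0 ger0_norm ?Z0// => /ltW.
  rewrite expr2 ler_wpM2r// /dlam /lam -sumrB.
  rewrite -[n in n%:R]card_ord mulr_natl -sumr_const; apply: ler_sum => i _.
  have [] := Hdl i (t_ N k.+1) (t_ N k) _ _ dt; rewrite ?t0 ?tk1//.
  by move=> _ /ltW; apply: le_trans; exact: ler_norm.
apply: le_trans (ler_sum _ (fun k _ => step k)) _.
rewrite -big_distrr/=.
have -> : \sum_(k < N.+1) (lam (t_ N k.+1) w - lam (t_ N k) w) = lam (t_ N N.+1) w - lam (t_ N 0) w.
  by rewrite -(big_mkord xpredT (fun k => lam (t_ N k.+1) w - lam (t_ N k) w)) telescope_sumr.
rewrite grid_last grid0.
apply: (@le_trans _ _ (Q * eta)).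
  have -> : Q * eta = K * c2 * (1 + n%:R) * eta * lT by rewrite /Q; ring.
  have KC : 0 <= K * c2 * (1 + n%:R) * eta.
    by rewrite mulr_ge0 ?(ltW eta0)// mulr_ge0 ?mulr_ge0// addr_ge0.
  by rewrite ler_wpM2l// /lT gerBl lam_ge0.
rewrite /eta mulrA ler_pdivrMr ?ltr_wpDl// mulrC ler_pM2l// lerDl//.
Qed.

(** The one-step errors add up to order [sqrt (mesh)]; the reflection errors tend to 0 in mean by
    bounded convergence. *)
Lemma dynkin e : 0 < e -> exists N0, forall N, (N0 <= N)%N ->
  let S w := \sum_(k < N.+1) \1_(al N k) w * (g (VZ (t_ N k.+1) w) - g (VZ (t_ N k) w) -
     mesh tau N * generator Om A mu g1 g2 (Z (t_ N k) w)) in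
  L1 P S /\ `|Ex P S| <= e.
Proof.
move=> e0.
have [K1 K10 HK1] := one_step HR c0 symRC HA HF HB adZ tg M0.
have E0 := Ex_cvg0 P E_measurable E_bounded E_cvg.
have e20 : 0 < e / 2 by rewrite divr_gt0.
move/cvgrPdist_le : E0 => /(_ _ e20) [N1 _ HN1].
pose dl := (e / 2 / (K1 * tau + 1)) ^+ 2.
have den0 : 0 < K1 * tau + 1 by rewrite ltr_wpDl// mulr_ge0// ltW.
have dl0 : 0 < dl by rewrite exprn_gt0// divr_gt0.
have [N2 HN2] := mesh_small tau0 dl0.
have [N3 HN3] := mesh_small tau0 (@ltr01 R).
exists (N1 + N2 + N3)%N => N leN S.
have /HN1 : (N1 <= N)%N by apply: leq_trans leN; rewrite -addnA leq_addr.
rewrite sub0r normrN => hE.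
have /HN2 hm2 : (N2 <= N)%N by apply: leq_trans leN; rewrite addnAC leq_addl.
have /HN3 hm3 : (N3 <= N)%N by apply: leq_trans leN; rewrite leq_addl.
have m0 := mesh_gt0 N tau0.
pose f k w := \1_(al N k) w * (g (V (D_ N k w)) - g (VZ (t_ N k) w) -
     mesh tau N * generator Om A mu g1 g2 (Z (t_ N k) w)).
have Hf k : L1 P (f k) /\ `|Ex P (f k)| <= K1 * (mesh tau N * Num.sqrt (mesh tau N)).
  have := HK1 (t_ N k) (mesh tau N) (al N k) (t0 N k) m0 (ltW hm3) (alive_measurable_wrt N k).
  rewrite -gridS; apply => w aw.
  exact: DV (alive_D aw).
have SE : S = fun w => \sum_(k < N.+1) f k w + E_ N w.
  apply/funext => w; rewrite /S /E_ -big_split/=; apply: eq_bigr => k _.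
  by rewrite /f /e_; ring.
have IE : L1 P (E_ N) by apply: L1_bounded (E_bounded N); exact: E_measurable.
have If : L1 P (fun w => \sum_(k < N.+1) f k w) by apply: L1_sum => k; have [] := Hf k.
split; first by rewrite SE; exact: L1D.
rewrite SE ExD// Ex_sum; last by move=> k; have [] := Hf k.
apply: le_trans (ler_normD _ _) _; rewrite [leRHS]splitr; apply: lerD => //.
apply: le_trans (ler_norm_sum _ _ _) _.
apply: le_trans (ler_sum _ (fun (k : 'I_N.+1) _ => (Hf k).2)) _.
rewrite sumr_const card_ord -[leLHS]mulr_natl.
have -> : N.+1%:R * (K1 * (mesh tau N * Num.sqrt (mesh tau N))) = K1 * tau * Num.sqrt (mesh tau N).
  have : mesh tau N * N.+1%:R = tau by rewrite /mesh divfK// pnatr_eq0.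
  by move: (mesh tau N) => m mE; rewrite -[in RHS]mE; ring.
have sq : Num.sqrt (mesh tau N) <= e / 2 / (K1 * tau + 1).
  have -> : e / 2 / (K1 * tau + 1) = Num.sqrt dl.
    by rewrite /dl sqrtr_sqr ger0_norm// ltW// divr_gt0.
  by rewrite ler_wsqrtr// ltW.
apply: (@le_trans _ _ (K1 * tau * (e / 2 / (K1 * tau + 1)))).
  by rewrite ler_wpM2l// mulr_ge0// ltW.
rewrite mulrA ler_pdivrMr// mulrC ler_pM2l//; lra.
Qed.
Definition increments N w := \sum_(k < N.+1)
  \1_(al N k) w * (g (VZ (t_ N k.+1) w) - g (VZ (t_ N k) w)).

(** A Riemann sum for the expected time spent in [D] before the exit or the horizon [tau],
    restricted to [G]. *)
Definition occupation N := mesh tau N * \sum_(k < N.+1) Ex P \1_(al N k).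

Let gVZ_measurable t : 0 <= t -> measurable_fun setT (fun w => g (VZ t w)).
Proof.
move=> tt; apply: gV_measurable => i.
exact: measurable_wrt_measurable HF _ _ (adZ tt i).
Qed.

Lemma increments_L1 N : L1 P (increments N).
Proof.
apply: L1_sum => k; apply: (@L1_bounded _ _ _ _ _ (2 * Kg)).
  apply: measurable_funM; first exact/measurable_indic/alive_measurable.
  by apply: measurable_funB; exact: gVZ_measurable.
move=> w; rewrite normrM.
have h1 : `|g (VZ (t_ N k.+1) w)| <= Kg by apply: gK; exact: Vge0.
have h2 : `|g (VZ (t_ N k) w)| <= Kg by apply: gK; exact: Vge0.
have h3 : `|\1_(al N k) w : R| <= 1.
  by rewrite indicE; case: (_ \in _); rewrite ?normr1 ?normr0.
apply: (@le_trans _ _ `|g (VZ (t_ N k.+1) w) - g (VZ (t_ N k) w)|).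
  by rewrite ler_piMl.
by apply: le_trans (ler_normB _ _) _; lra.
Qed.

Lemma initial_L1 : L1 P (fun w => \1_G w * g (VZ s w)).
Proof.
apply: (@L1_bounded _ _ _ _ _ Kg).
  apply: measurable_funM; last exact: gVZ_measurable.
  exact/measurable_indic/(filtration_measurable HF FG).
move=> w; rewrite normrM.
have h1 : `|g (VZ s w)| <= Kg by apply: gK; exact: Vge0.
apply: le_trans h1; rewrite ler_piMl//.
by rewrite indicE; case: (_ \in _); rewrite ?normr1 ?normr0.
Qed.

Lemma increments0 N w : ~ G w -> increments N w = 0.
Proof.
move=> nG; rewrite /increments big1// => k _.
by rewrite indicE memNset ?mul0r// => -[].
Qed.

(** The killed sum telescopes up to a stopping index [k] chosen path by path. If the grid is
    exhausted, [k = N + 1] and membership in [D] is asserted only up to index [N]. *)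
Lemma stopped_value N w : G w -> exists2 k, (k <= N.+1)%N &
  [/\ g (VZ s w) + increments N w = g (VZ (t_ N k) w),
     (k = N.+1 /\ al N N w) \/ ~ D (t_ N k) w &
     forall j, (j < k)%N -> D (t_ N j) w].
Proof.
move=> Gw; rewrite /increments.
pose S m := \sum_(k < m) \1_(al N k) w * (g (VZ (t_ N k.+1) w) - g (VZ (t_ N k) w)).
have Sstep m : S m.+1 = S m + \1_(al N m) w * (g (VZ (t_ N m.+1) w) - g (VZ (t_ N m) w)).
  by rewrite /S big_ord_recr.
rewrite -/(S N.+1).
have H m : exists2 k, (k <= m)%N &
  [/\ g (VZ s w) + S m = g (VZ (t_ N k) w), k = m \/ ~ D (t_ N k) w &
     forall j, (j < k)%N -> D (t_ N j) w].
  elim: m => [|m [k km [Sk Hk Dk]]].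
    by exists 0%N => //; split; [rewrite /S big_ord0 addr0 grid0|left|].
  have [am|nam] := pselect (al N m w).
    have kE : k = m by case: Hk => // -[]; case: am => _; exact.
    exists m.+1 => //; split; [|by left|].
      by rewrite Sstep indicE mem_set// mul1r addrA Sk kE; ring.
    by move=> j jm; case: am => _; apply.
  exists k; first exact: leqW.
  rewrite Sstep indicE memNset// mul0r addr0; split=> //.
  right => Dtk; case: Hk => [kE|//]; apply: nam; split=> // j.
  by rewrite leq_eqVlt => /orP[/eqP ->|]; [rewrite -kE|rewrite -kE; exact: Dk].
have [k kN [Sk Hk Dk]] := H N.+1; exists k => //; split=> //.
case: Hk => [kE|]; [left|by right]; split=> //; split=> // j jN.
by apply: Dk; rewrite kE ltnS.
Qed.

Let al_indic_L1 N k : L1 P (\1_(al N k)).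
Proof.
apply: (@L1_bounded _ _ _ _ _ 1); first exact/measurable_indic/alive_measurable.
by move=> w; rewrite indicE; case: (_ \in _); rewrite ?normr1 ?normr0.
Qed.

Let mesh_sum N (x : R) : mesh tau N * \sum_(k < N.+1) x = x * tau.
Proof.
have mE : mesh tau N * N.+1%:R = tau by rewrite /mesh divfK// pnatr_eq0.
by rewrite sumr_const card_ord -[x *+ _]mulr_natl mulrA mE mulrC.
Qed.

Lemma occupation_le N : occupation N <= tau.
Proof.
have m0 := ltW (mesh_gt0 N tau0).
rewrite -[leRHS]mul1r -(mesh_sum N) /occupation; apply: ler_wpM2l => //.
apply: ler_sum => k _; rewrite -[leRHS](Ex_cst P).
apply: Ex_le; [by []|exact: L1_cst|move=> w].
by rewrite indicE; case: (_ \in _).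
Qed.

(** Markov's inequality for the exit time: the [alive] events decrease with the index, so each is at
    least as likely as the last one. *)
Lemma occupation_ge N : Ex P \1_(al N N) * tau <= occupation N.
Proof.
have m0 := ltW (mesh_gt0 N tau0).
rewrite -(mesh_sum N) /occupation; apply: ler_wpM2l => //; apply: ler_sum => k _.
apply: Ex_le => // w; rewrite !indicE.
have [[Gw aw]|na] := pselect (al N N w); last by rewrite (memNset na).
rewrite !mem_set//; split=> // j jk; apply: aw.
by rewrite (leq_trans jk)// -ltnS.
Qed.

Let gen_sum N w := \sum_(k < N.+1)
  mesh tau N * (\1_(al N k) w * generator Om A mu g1 g2 (Z (t_ N k) w)).

Let increments_split N w : increments N w = gen_sum N w +
  \sum_(k < N.+1) \1_(al N k) w * (g (VZ (t_ N k.+1) w) - g (VZ (t_ N k) w) -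
     mesh tau N * generator Om A mu g1 g2 (Z (t_ N k) w)).
Proof. by rewrite -big_split/=; apply: eq_bigr => k _; ring. Qed.

Let occ_sum N kappa : L1 P (fun w => \sum_(k < N.+1) mesh tau N * (\1_(al N k) w * kappa)) /\
  Ex P (fun w => \sum_(k < N.+1) mesh tau N * (\1_(al N k) w * kappa)) = kappa * occupation N.
Proof.
have I1 k : L1 P (fun w => mesh tau N * (\1_(al N k) w * kappa)).
  rewrite (_ : (fun _ => _) = fun w => (mesh tau N * kappa) * \1_(al N k) w).
    exact: L1Z.
  by apply/funext => w; ring.
split; first exact: L1_sum.
rewrite Ex_sum// /occupation mulrCA !big_distrr/=; apply: eq_bigr => k _.
rewrite (_ : (fun _ => _) = fun w => (mesh tau N * kappa) * \1_(al N k) w).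
  by rewrite ExZ// mulrA.
by apply/funext => w; ring.
Qed.

Lemma dynkin_le kappa e :
  (forall t w, 0 <= t -> D t w -> generator Om A mu g1 g2 (Z t w) <= kappa) ->
  0 < e -> exists N0, forall N, (N0 <= N)%N ->
  Ex P (increments N) <= kappa * occupation N + e.
Proof.
move=> Hk e0; have [N0 HN0] := dynkin e0; exists N0 => N lN.
have [IS ES] := HN0 N lN; set S := fun w => _ in IS ES.
have IE : increments N = fun w => gen_sum N w + S w.
  by apply/funext => w; exact: increments_split.
have Ig : L1 P (gen_sum N).
  rewrite (_ : gen_sum N = fun w => increments N w - S w).
    by apply: L1B => //; exact: increments_L1.
  by apply/funext => w; rewrite IE addrK.
have [Io Eo] := occ_sum N kappa.
rewrite IE ExD// -Eo; apply: lerD; last exact: le_trans (ler_norm _) ES.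
apply: Ex_le => // w; apply: ler_sum => k _.
apply: ler_wpM2l; first by rewrite ltW// mesh_gt0.
rewrite indicE.
have [aw|na] := pselect (al N k w); last by rewrite memNset// !mul0r.
by rewrite mem_set// !mul1r; apply: Hk => //; exact: alive_D aw.
Qed.

Lemma dynkin_ge kappa e :
  (forall t w, 0 <= t -> D t w -> kappa <= generator Om A mu g1 g2 (Z t w)) ->
  0 < e -> exists N0, forall N, (N0 <= N)%N ->
  kappa * occupation N - e <= Ex P (increments N).
Proof.
move=> Hk e0; have [N0 HN0] := dynkin e0; exists N0 => N lN.
have [IS ES] := HN0 N lN; set S := fun w => _ in IS ES.
have IE : increments N = fun w => gen_sum N w + S w.
  by apply/funext => w; exact: increments_split.
have Ig : L1 P (gen_sum N).
  rewrite (_ : gen_sum N = fun w => increments N w - S w).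
    by apply: L1B => //; exact: increments_L1.
  by apply/funext => w; rewrite IE addrK.
have [Io Eo] := occ_sum N kappa.
rewrite IE ExD// -Eo; apply: lerD; last first.
  by move: ES; rewrite ler_norml => /andP[].
apply: Ex_le => // w; apply: ler_sum => k _.
apply: ler_wpM2l; first by rewrite ltW// mesh_gt0.
rewrite indicE.
have [aw|na] := pselect (al N k w); last by rewrite memNset// !mul0r.
by rewrite mem_set// !mul1r; apply: Hk => //; exact: alive_D aw.
Qed.

End Dynkin.

(** * The three families of test functions *)

Section ConcreteTests.
Context {R : realType}.
Implicit Types f g : R -> R.

Definition bounded_ge0 f := exists K, forall v : R, 0 <= v -> `|f v| <= K.

Lemma bounded_ge0_cst k : bounded_ge0 (fun _ => k).
Proof. by exists `|k|. Qed.

Lemma bounded_ge0D f g : bounded_ge0 f -> bounded_ge0 g ->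
  bounded_ge0 (fun v => f v + g v).
Proof.
move=> [K HK] [K' HK']; exists (K + K') => v v0.
by apply: le_trans (ler_normD _ _) _; apply: lerD; [exact: HK|exact: HK'].
Qed.

Lemma bounded_ge0M f g : bounded_ge0 f -> bounded_ge0 g ->
  bounded_ge0 (fun v => f v * g v).
Proof.
move=> [K HK] [K' HK']; exists (K * K') => v v0.
by rewrite normrM; apply: ler_pM => //; [exact: HK|exact: HK'].
Qed.

Lemma taylor_bounded_ex g g1 g2 g3 :
  (forall x : R, 0 <= x -> is_derive x 1 g (g1 x)) ->
  (forall x : R, 0 <= x -> is_derive x 1 g1 (g2 x)) ->
  (forall x : R, 0 <= x -> is_derive x 1 g2 (g3 x)) ->
  bounded_ge0 g1 -> bounded_ge0 g2 -> bounded_ge0 g3 ->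
  exists K, taylor_bounded g g1 g2 K.
Proof.
move=> d1 d2 d3 [K1 b1] [K2 b2] [K3 b3].
have p1 : 0 <= K1 by exact: le_trans (b1 0 (lexx 0)).
have p2 : 0 <= K2 by exact: le_trans (b2 0 (lexx 0)).
have p3 : 0 <= K3 by exact: le_trans (b3 0 (lexx 0)).
exists (K1 + K2 + K3); apply: taylor_boundedC3 d1 d2 d3 _ _ _ => x x0.
- by have := b1 x x0; lra.
- by have := b2 x x0; lra.
- by have := b3 x x0; lra.
Qed.

Section ExpTest.
Variable a : R.
Hypothesis a0 : 0 <= a.
Definition exp_test (v : R) := expR (- a * v).
Definition exp_test1 (v : R) := - a * exp_test v.
Definition exp_test2 (v : R) := - a * exp_test1 v.

Lemma exp_test_le1 v : 0 <= v -> `|exp_test v| <= 1.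
Proof.
move=> v0; rewrite ger0_norm ?expR_ge0// -expR0 ler_expR.
by rewrite mulNr oppr_le0 mulr_ge0.
Qed.

Lemma exp_test_taylor : exists K, taylor_bounded exp_test exp_test1 exp_test2 K.
Proof.
have b0 : bounded_ge0 exp_test by exists 1; exact: exp_test_le1.
have bc := bounded_ge0_cst (- a).
have d0 (x : R) : is_derive x 1 exp_test (exp_test1 x).
  have := is_derive_fun_expR (is_derive_funZ (is_derive_fun_id x) (- a)).
  by rewrite mulr1.
have d1 (x : R) : is_derive x 1 exp_test1 (exp_test2 x) by exact: is_derive_funZ.
have d2 (x : R) : is_derive x 1 exp_test2 (- a * exp_test2 x) by exact: is_derive_funZ.
apply: (taylor_bounded_ex (fun x _ => d0 x) (fun x _ => d1 x) (fun x _ => d2 x)).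
- exact: bounded_ge0M.
- by do 2 apply: bounded_ge0M => //.
- by do 3 apply: bounded_ge0M => //.
Qed.
End ExpTest.

Section LnTest.
Variable e : R.
Hypothesis e0 : 0 < e.
Definition ln_test (v : R) := ln (v + e).
Definition ln_test1 (v : R) := (v + e)^-1.
Definition ln_test2 (v : R) := - (v + e)^-1 * (v + e)^-1.

Let y0 (v : R) : 0 <= v -> 0 < v + e.
Proof. by move=> v0; rewrite ltr_wpDl. Qed.

Let bnd_inv : bounded_ge0 ln_test1.
Proof.
exists e^-1 => v v0; rewrite /ln_test1 ger0_norm ?invr_ge0 ?(ltW (y0 v0))//.
by rewrite lef_pV2 ?posrE ?y0// lerDr.
Qed.

Let dshift (x : R) : is_derive x 1 (fun v => v + e) 1.
Proof.
by have := is_derive_funD (is_derive_fun_id x) (is_derive_fun_cst x e); rewrite addr0.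
Qed.

Let dinv (x : R) : 0 <= x -> is_derive x 1 ln_test1 (ln_test2 x).
Proof.
move=> x0; have yx := y0 x0; have := is_derive_funV (dshift x) (lt0r_neq0 yx).
by move=> h; apply: (is_derive_eq h); rewrite /ln_test2; field; rewrite gt_eqF.
Qed.

Lemma ln_test_taylor : exists K, taylor_bounded ln_test ln_test1 ln_test2 K.
Proof.
have d0 (x : R) : 0 <= x -> is_derive x 1 ln_test (ln_test1 x).
  move=> x0; have := is_derive_fun_ln (dshift x) (y0 x0).
  by rewrite /ln_test1 div1r.
have d2 (x : R) : 0 <= x -> is_derive x 1 ln_test2 (2 * (ln_test1 x * (ln_test1 x * ln_test1 x))).
  move=> x0; have h1 := dinv x0.
  have h := is_derive_funZ (is_derive_funM h1 h1) (-1).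
  have -> : ln_test2 = fun v => -1 * (ln_test1 v * ln_test1 v).
    by apply/funext => v; rewrite /ln_test2 /ln_test1 mulN1r mulNr.
  by apply: (is_derive_eq h); rewrite /ln_test2 /ln_test1; ring.
apply: (taylor_bounded_ex d0 dinv d2) => //.
- apply: bounded_ge0M => //.
  have [K HK] := bnd_inv; exists K => v v0.
  by rewrite normrN; exact: HK.
- apply: bounded_ge0M; first exact: bounded_ge0_cst.
  by do 2 apply: bounded_ge0M => //.
Qed.
End LnTest.

Section PowTest.
Variables (lam p e : R).
Hypotheses (lam0 : 0 <= lam) (p0 : 0 < p) (p1 : p <= 1) (e0 : 0 < e).
(** [pow_u] is [(v + e)^p] and [pow_w] is [(v + e)^(p - 1)], so that [pow_test] is
    [exp (- lam (v + e)^p)]; the shift keeps the derivatives bounded down to [v = 0]. *)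
Definition pow_u (v : R) := expR (p * ln (v + e)).
Definition pow_w (v : R) := expR ((p - 1) * ln (v + e)).
Definition pow_test (v : R) := expR (- lam * pow_u v).
Definition pow_test1 (v : R) := - (lam * p) * (pow_w v * pow_test v).
Definition pow_test2 (v : R) :=
  pow_test v * (lam * p * (1 - p) * (pow_w v * (v + e)^-1) +
                (lam * p) ^+ 2 * (pow_w v * pow_w v)).

Let y0 (v : R) : 0 <= v -> 0 < v + e.
Proof. by move=> v0; rewrite ltr_wpDl. Qed.

Lemma pow_uE v : 0 <= v -> pow_u v = (v + e) * pow_w v.
Proof.
move=> v0; transitivity (expR (ln (v + e)) * pow_w v).
  by rewrite /pow_u /pow_w -expRD; congr expR; ring.
by rewrite lnK// posrE y0.
Qed.

Lemma pow_test_le1 v : `|pow_test v| <= 1.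
Proof.
rewrite ger0_norm ?expR_ge0// -expR0 ler_expR mulNr oppr_le0.
by rewrite mulr_ge0// expR_ge0.
Qed.

Lemma pow_test_taylor : exists K, taylor_bounded pow_test pow_test1 pow_test2 K.
Proof.
have dshift (x : R) : is_derive x 1 (fun v => v + e) 1.
  by have := is_derive_funD (is_derive_fun_id x) (is_derive_fun_cst x e); rewrite addr0.
have dln (x : R) : 0 <= x -> is_derive x 1 (fun v => ln (v + e)) (x + e)^-1.
  by move=> x0; have := is_derive_fun_ln (dshift x) (y0 x0); rewrite div1r.
have du (x : R) : 0 <= x -> is_derive x 1 pow_u (p * pow_w x).
  move=> x0; have h := is_derive_fun_expR (is_derive_funZ (dln x x0) p).
  apply: (is_derive_eq h); rewrite -/(pow_u x) pow_uE//.
  by field; rewrite gt_eqF ?y0.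
have dw (x : R) : 0 <= x -> is_derive x 1 pow_w ((p - 1) * (pow_w x * (x + e)^-1)).
  move=> x0; have h := is_derive_fun_expR (is_derive_funZ (dln x x0) (p - 1)).
  by apply: (is_derive_eq h); rewrite -/(pow_w x); ring.
have d0 (x : R) : 0 <= x -> is_derive x 1 pow_test (pow_test1 x).
  move=> x0; have h := is_derive_fun_expR (is_derive_funZ (du x x0) (- lam)).
  by apply: (is_derive_eq h); rewrite -/(pow_test x) /pow_test1; ring.
have d1 (x : R) : 0 <= x -> is_derive x 1 pow_test1 (pow_test2 x).
  move=> x0; have h := is_derive_funZ (is_derive_funM (dw x x0) (d0 x x0)) (- (lam * p)).
  by apply: (is_derive_eq h); rewrite /pow_test1 /pow_test2; ring.
have dinv (x : R) : 0 <= x -> is_derive x 1 (fun v => (v + e)^-1) (- ((x + e)^-1 * (x + e)^-1)).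
  move=> x0; have yx := y0 x0; have h := is_derive_funV (dshift x) (lt0r_neq0 yx).
  by apply: (is_derive_eq h); field; rewrite gt_eqF.
pose g3 x := pow_test1 x * (lam * p * (1 - p) * (pow_w x * (x + e)^-1) +
                (lam * p) ^+ 2 * (pow_w x * pow_w x)) +
  pow_test x * (lam * p * (1 - p) * ((p - 1) * (pow_w x * (x + e)^-1) * (x + e)^-1 +
     pow_w x * (-1 * ((x + e)^-1 * (x + e)^-1))) +
    (lam * p) ^+ 2 * ((p - 1) * (pow_w x * (x + e)^-1) * pow_w x +
       pow_w x * ((p - 1) * (pow_w x * (x + e)^-1)))).
have d2 (x : R) : 0 <= x -> is_derive x 1 pow_test2 (g3 x).
  move=> x0.
  have h := is_derive_funM (d0 x x0) (is_derive_funD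
    (is_derive_funZ (is_derive_funM (dw x x0) (dinv x x0)) (lam * p * (1 - p)))
    (is_derive_funZ (is_derive_funM (dw x x0) (dw x x0)) ((lam * p) ^+ 2))).
  by apply: (is_derive_eq h); rewrite /g3; ring.
have bt : bounded_ge0 pow_test by exists 1 => v _; exact: pow_test_le1.
have bi : bounded_ge0 (fun v => (v + e)^-1).
  exists e^-1 => v v0; rewrite ger0_norm ?invr_ge0 ?(ltW (y0 v0))//.
  by rewrite lef_pV2 ?posrE ?y0// lerDr.
have bw : bounded_ge0 pow_w.
  exists (pow_w 0) => v v0; rewrite ger0_norm ?expR_ge0// ler_expR.
  by rewrite ler_wnM2l ?subr_le0// ler_ln ?posrE ?y0// lerD2r.
have bc := bounded_ge0_cst.
have b1 : bounded_ge0 pow_test1 by apply: bounded_ge0M => //; exact: bounded_ge0M.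
apply: (taylor_bounded_ex d0 d1 d2) => //.
- by apply: bounded_ge0M => //; apply: bounded_ge0D; apply: bounded_ge0M => //; exact: bounded_ge0M.
- apply: bounded_ge0D; apply: bounded_ge0M => //.
    by apply: bounded_ge0D; apply: bounded_ge0M => //; exact: bounded_ge0M.
  apply: bounded_ge0D; apply: bounded_ge0M => //; apply: bounded_ge0D;
    by repeat (apply: bounded_ge0M => //).
Qed.
End PowTest.
End ConcreteTests.

(** * Generator estimates in the variable v *)

Section GeneratorBounds.
Context {R : realType}.
Implicit Types (v Q m tr cp cm M : R).

(* v, Q and m stand for x'Om x, x'Om A Om x and 2 x'Om mu. *)

(** On [v <= r / a] the exponential is at least [e^-1], and the drift and the second-order term use
    up at most a quarter of [tr] each. The bound grows with [a] while the test function stays in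
    [[0, 1]], which leaves only time of order [1 / a] near the corner. *)
Lemma exp_generator_le tr (K0 : R) cp : 0 < tr -> 0 <= K0 -> 0 <= cp ->
  exists r C : R, [/\ 0 < r, 0 < C & exists a0, forall (a : R) v Q m, a0 <= a -> 1 <= a ->
    0 <= v -> v <= r / a -> 0 <= Q -> Q <= cp * v ->
    `|m| <= K0 * Num.sqrt v ->
    exp_test1 a v * (tr + m) + 2 * exp_test2 a v * Q <= - (C * a)].
Proof.
move=> tr0 K00 cp0.
pose r := Num.min 1 (tr / (8 * cp + 1)).
have den : 0 < 8 * cp + 1 by rewrite ltr_wpDl// mulr_ge0.
have r0 : 0 < r by rewrite lt_min ltr01 divr_gt0.
have r1 : r <= 1 by rewrite ge_min lexx.
have rtr : r * (8 * cp + 1) <= tr.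
  by rewrite -ler_pdivlMr// ge_min lexx orbT.
exists r, (expR (-1) * (tr / 2)); split => //.
  by rewrite mulr_gt0 ?expR_gt0// divr_gt0.
(* From this value of [a] on, [v <= 1 / a] gives [K0 sqrt v <= tr / 4]. *)
exists (16 * K0 ^+ 2 / tr ^+ 2) => a v Q m aa a1 v0 vr Q0 Qv hm.
have apos : 0 < a by lra.
have av : a * v <= r by rewrite mulrC -ler_pdivlMr.
rewrite /exp_test2 /exp_test1; set g := exp_test a v.
have g0 : expR (-1) <= g by rewrite ler_expR mulNr lerN2; lra.
have gpos : 0 < g by exact: expR_gt0.
have sv : K0 * Num.sqrt v <= tr / 4.
  have s0 := sqrtr_ge0 v; set s := Num.sqrt v in s0 *.
  have ss : s ^+ 2 = v by rewrite sqr_sqrtr.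
  have h1 : 16 * K0 ^+ 2 <= a * tr ^+ 2 by rewrite -ler_pdivrMr ?exprn_gt0.
  have h2 : (K0 * s) ^+ 2 <= (tr / 4) ^+ 2.
    rewrite exprMn ss.
    have : 16 * K0 ^+ 2 * v <= a * tr ^+ 2 * v by rewrite ler_wpM2r.
    have : a * tr ^+ 2 * v <= tr ^+ 2.
      by rewrite mulrAC ler_piMl ?sqr_ge0//; lra.
    have -> : (tr / 4) ^+ 2 = tr ^+ 2 / 16 by field.
    lra.
  by rewrite -(@ler_pXn2r _ 2)// ?nnegrE ?mulr_ge0 ?divr_ge0 ?(ltW tr0).
have hm2 : - (tr / 4) <= m by move: hm; rewrite ler_norml => /andP[h _]; lra.
have hQ : 2 * a * Q <= tr / 4.
  have : a * Q <= cp * r.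
    apply: (@le_trans _ _ (a * (cp * v))); first by rewrite ler_pM2l.
    by rewrite mulrCA ler_wpM2l.
  nra.
have -> : - a * g * (tr + m) + 2 * (- a * (- a * g)) * Q = - (g * a) * (tr + m - 2 * a * Q) by ring.
rewrite mulNr lerN2.
apply: (@le_trans _ _ (g * a * (tr / 2))).
  by rewrite mulrAC ler_wpM2r ?divr_ge0 ?(ltW tr0)// ler_wpM2r// ltW.
apply: ler_wpM2l; [by rewrite mulr_ge0// ltW|lra].
Qed.

(** With [s^2 = v + e], the part [- ln (v + e)] leaves a drift error [K0 / s], unbounded as [e]
    tends to 0. The generator of [exp (- s)] contains a negative multiple of [1 / s] that absorbs
    it. The part [ln (v + 1)] contributes a bounded amount, so [C] is uniform in [e]. *)
Lemma log_generator_le tr (K0 : R) cp M : 0 <= K0 -> 0 < cp -> 2 * cp <= tr -> 0 <= M ->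
  exists kappa C : R, 0 <= kappa /\ forall (e : R) v Q m, 0 < e -> e <= 1 ->
    0 <= v -> v <= M -> 0 <= Q -> Q <= cp * v -> `|m| <= K0 * Num.sqrt v ->
    (ln_test1 1 v + -1 * ln_test1 e v + kappa * pow_test1 1 (1 / 2) e v) * (tr + m) +
    2 * (ln_test2 1 v + -1 * ln_test2 e v + kappa * pow_test2 1 (1 / 2) e v) * Q <= C.
Proof.
move=> K00 cp0 trcp M0.
have tr0 : 0 < tr by lra.
pose g0 := expR (- Num.sqrt (M + 1)).
have g00 : 0 < g0 by exact: expR_gt0.
(* Solves [kappa g0 tr / 4 = K0], which cancels the error [K0 / s]; [g0] is a lower bound of
   [exp (- s)]. *)
pose kappa := 4 * K0 / (g0 * tr).
have kappa0 : 0 <= kappa by apply: divr_ge0; [exact: mulr_ge0|rewrite ltW// mulr_gt0].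
exists kappa, (tr + K0 + kappa * ((K0 + cp) / 2)); split => //.
move=> e v Q m e0 e1 v0 vM Q0 Qv hm.
have y0 : 0 < v + e by rewrite ltr_wpDl.
have v1 : 0 < v + 1 by rewrite ltr_wpDl.
pose s := expR (1 / 2 * ln (v + e)).
have s0 : 0 < s by exact: expR_gt0.
have ss : s ^+ 2 = v + e.
  by rewrite -expRM_natl mulrA mulrC -[RHS](lnK _) ?posrE//; congr expR; field.
have uE : pow_u (1 / 2) e v = s by [].
have wE : pow_w (1 / 2) e v = s^-1.
  by rewrite /pow_w /s -expRN; congr expR; field.
pose g := pow_test 1 (1 / 2) e v.
have gE : g = expR (- s) by rewrite /g /pow_test uE mulN1r.
have sE : s = Num.sqrt (v + e) by rewrite -ss sqrtr_sqr gtr0_norm.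
have g1 : g <= 1 by rewrite gE -expR0 ler_expR oppr_le0 ltW.
have g00g : g0 <= g by rewrite gE ler_expR lerN2 sE ler_wsqrtr//; lra.
have gpos : 0 < g by rewrite gE expR_gt0.
have sv : Num.sqrt v <= s by rewrite sE ler_wsqrtr//; lra.
have hms : `|m| <= K0 * s by apply: le_trans hm _; rewrite ler_wpM2l.
move: hms; rewrite ler_norml => /andP[hm1 hm2].
have sqv1 : Num.sqrt v <= v + 1.
  have h1 := sqrtr_ge0 v; have h2 : Num.sqrt v ^+ 2 = v by rewrite sqr_sqrtr.
  rewrite -[in leRHS]h2; have := sqr_ge0 (Num.sqrt v - 1); nra.
have hmv : m <= K0 * (v + 1).
  apply: le_trans (ler_norm _) _; apply: le_trans hm _; exact: ler_wpM2l.
set G1 := ln_test1 1 v + -1 * ln_test1 e v + kappa * pow_test1 1 (1 / 2) e v.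
set G2 := ln_test2 1 v + -1 * ln_test2 e v + kappa * pow_test2 1 (1 / 2) e v.
have E3 : pow_test1 1 (1 / 2) e v = - (s^-1 / 2) * g.
  by rewrite /pow_test1 wE -/g; field; rewrite gt_eqF.
have E4 : pow_test2 1 (1 / 2) e v = g * (s^-1 ^+ 3 + s^-1 ^+ 2) / 4.
  by rewrite /pow_test2 wE -/g -ss; field; rewrite gt_eqF.
have Qs : Q <= cp * s ^+ 2.
  by apply: le_trans Qv _; rewrite ler_pM2l// ss; lra.
have -> : G1 * (tr + m) + 2 * G2 * Q =
   ((v + 1)^-1 * (tr + m) - 2 * (v + 1)^-1 ^+ 2 * Q) +
   (- (s^-1 ^+ 2) * (tr + m) + 2 * s^-1 ^+ 4 * Q) +
   kappa * (g * (- (s^-1 / 2) * (tr + m) + (s^-1 ^+ 3 + s^-1 ^+ 2) / 2 * Q)).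
  rewrite /G1 /G2 E3 E4 /ln_test1 /ln_test2 -ss.
  by field; rewrite !gt_eqF.
have t1 : (v + 1)^-1 * (tr + m) - 2 * (v + 1)^-1 ^+ 2 * Q <= tr + K0.
  have h1 : (v + 1)^-1 * (tr + m) <= tr + K0.
    rewrite mulrC ler_pdivrMr//; nra.
  have : 0 <= 2 * (v + 1)^-1 ^+ 2 * Q by rewrite !mulr_ge0 ?invr_ge0 ?(ltW v1).
  lra.
set i := s^-1; have i0 : 0 < i by rewrite invr_gt0.
have is1 : i * s = 1 by rewrite mulVf// gt_eqF.
(* Here [2 cp <= tr] removes all terms of order [s^-2]; only the drift, of order [s^-1], is left. *)
have t2 : - i ^+ 2 * (tr + m) + 2 * i ^+ 4 * Q <= K0 * i.
  have h1 : i ^+ 4 * Q <= i ^+ 2 * cp.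
    apply: (@le_trans _ _ (i ^+ 4 * (cp * s ^+ 2))).
      by rewrite ler_wpM2l// exprn_ge0// ltW.
    have -> : i ^+ 4 * (cp * s ^+ 2) = i ^+ 2 * cp * (i * s) ^+ 2 by ring.
    by rewrite is1 expr1n mulr1.
  have h2 : - (i ^+ 2 * m) <= K0 * i.
    have : - (i ^+ 2 * m) <= i ^+ 2 * (K0 * s).
      by rewrite -mulrN ler_wpM2l ?sqr_ge0//; lra.
    have -> // : i ^+ 2 * (K0 * s) = K0 * i * (i * s) by ring.
    by rewrite is1 mulr1.
  have : i ^+ 2 * (2 * cp) <= i ^+ 2 * tr by rewrite ler_wpM2l ?sqr_ge0.
  lra.
(* The second-order part costs at most [cp / 2 <= tr / 4] out of the gain [tr / 2] in front of
   [1 / s], so [tr / 4] remains. *)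
have t3 : g * (- (i / 2) * (tr + m) + (i ^+ 3 + i ^+ 2) / 2 * Q) <= - (g0 * tr / 4 * i) + (K0 + cp) / 2.
  have h1 : (i ^+ 3 + i ^+ 2) / 2 * Q <= (i + 1) / 2 * cp.
    apply: (@le_trans _ _ ((i ^+ 3 + i ^+ 2) / 2 * (cp * s ^+ 2))).
      by rewrite ler_wpM2l// divr_ge0// addr_ge0// exprn_ge0// ltW.
    have -> : (i ^+ 3 + i ^+ 2) / 2 * (cp * s ^+ 2) = (i + 1) / 2 * cp * (i * s) ^+ 2 by ring.
    by rewrite is1 expr1n mulr1.
  have h2 : - (i / 2 * m) <= K0 / 2.
    have : - (i / 2 * m) <= i / 2 * (K0 * s).
      by rewrite -mulrN; apply: ler_wpM2l; [rewrite divr_ge0// ltW|lra].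
    have -> // : i / 2 * (K0 * s) = K0 / 2 * (i * s) by ring.
    by rewrite is1 mulr1.
  have h3 : - (i / 2) * (tr + m) + (i ^+ 3 + i ^+ 2) / 2 * Q <= - (tr / 4 * i) + (K0 + cp) / 2.
    have : i * (2 * cp) <= i * tr by rewrite ler_pM2l.
    lra.
  apply: (@le_trans _ _ (g * (- (tr / 4 * i) + (K0 + cp) / 2))).
    by rewrite ler_pM2l.
  have h4 : g0 * (tr / 4 * i) <= g * (tr / 4 * i).
    by rewrite ler_wpM2r// mulr_ge0 ?(ltW i0)// divr_ge0// ltW.
  have h5 : g * ((K0 + cp) / 2) <= (K0 + cp) / 2 by rewrite ler_piMl// divr_ge0// addr_ge0// ltW.
  lra.
have t4 : kappa * (g0 * tr / 4 * i) = K0 * i.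
  by rewrite /kappa; field; rewrite !gt_eqF.
have := ler_wpM2l kappa0 t3.
rewrite [X in _ <= X](_ : _ = - (K0 * i) + kappa * ((K0 + cp) / 2)); last first.
  by rewrite mulrDr mulrN t4.
lra.
Qed.

(** With [y = v + eta e] and [u = y^p], the generator is a positive factor times
    [2 (Q / y) (1 - p + lam p u) - tr - m]. The part [1 - p] beats [tr] by a margin [rho], and
    [lam p u] beats the drift. Since [e <= v], the shift by [eta e] lowers [Q / y] by a factor of at
    most [1 + eta]. *)
Lemma pow_generator_ge tr (K0 : R) cm M : 0 <= K0 -> 0 <= tr -> tr < 2 * cm -> 1 <= M ->
  exists lam p eta C : R, [/\ 0 < lam, 0 < p, p <= 1 & 0 < eta /\ eta <= 1 /\ 0 < C /\
    forall (e : R) v Q m, 0 < e -> e <= 1 -> e <= v -> v <= M ->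
    cm * v <= Q -> `|m| <= K0 * Num.sqrt v ->
    C <= pow_test1 lam p (eta * e) v * (tr + m) + 2 * pow_test2 lam p (eta * e) v * Q].
Proof.
move=> K00 tr0 trcm M1.
have cm0 : 0 < cm by lra.
(* p and eta are small enough for [2 cm (1 - p) / (1 + eta) >= tr + rho] *)
pose rho := (2 * cm - tr) / 4.
have rho0 : 0 < rho by rewrite divr_gt0// subr_gt0.
pose p := Num.min (1 / 2) (rho / (2 * cm)).
have p0 : 0 < p by rewrite lt_min; apply/andP; split; apply: divr_gt0 => //; lra.
have p12 : p <= 1 / 2 by rewrite ge_min lexx.
have pc : p * (2 * cm) <= rho by rewrite -ler_pdivlMr ?mulr_gt0// ge_min lexx orbT.
pose eta := Num.min 1 (rho / (tr + rho + 1)).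
have den : 0 < tr + rho + 1 by lra.
have eta0 : 0 < eta by rewrite lt_min ltr01 divr_gt0.
have eta1 : eta <= 1 by rewrite ge_min lexx.
have etac : eta * (tr + rho + 1) <= rho by rewrite -ler_pdivlMr// ge_min lexx orbT.
(* Gives [cm lam p = (K0 + 1) (M + 1)], more than the factor [K0 (M + 1)] of [u] in the bound on the
   drift. *)
pose lam := (K0 + 1) * (M + 1) / (cm * p).
have lam0 : 0 < lam by rewrite divr_gt0 ?mulr_gt0//; lra.
(* The product of lower bounds for the test function, [lam p], [y^(p - 1)] and the margin, over
   [y <= M + 1]; it does not involve [e]. *)
pose C := expR (- lam * expR (p * ln (M + 1))) * (lam * p) * (M + 1)^-1 * rho.
have M10 : 0 < M + 1 by lra.
have M1i : 0 < (M + 1)^-1 by rewrite invr_gt0.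
have C0 : 0 < C.
  by rewrite /C; apply: mulr_gt0 => //; apply: mulr_gt0 => //; rewrite mulr_gt0 ?expR_gt0// mulr_gt0.
exists lam, p, eta, C; split => //; first by lra.
do 3 split => //.
move=> e v Q m e0 e1 ev vM Qv hm.
have v0 : 0 < v by lra.
have ee0 : 0 < eta * e by rewrite mulr_gt0.
have y0 : 0 < v + eta * e by lra.
set y := v + eta * e in y0 *.
have yle : y <= v * (1 + eta) by rewrite /y mulrDr mulr1 lerD2l mulrC ler_pM2r.
have yM : y <= M + 1.
  by rewrite /y; apply: lerD => //; rewrite -[leRHS]mulr1; apply: ler_pM => //; rewrite ltW.
pose u := expR (p * ln y); pose w := pow_w p (eta * e) v.
have w0 : 0 < w by exact: expR_gt0.
have u0 : 0 < u by exact: expR_gt0.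
have uE : u = y * w by exact: (pow_uE p ee0 (ltW v0)).
pose g := pow_test lam p (eta * e) v.
have g0 : 0 < g by exact: expR_gt0.
have gge : expR (- lam * expR (p * ln (M + 1))) <= g.
  rewrite ler_expR ler_wnM2l ?oppr_le0 ?(ltW lam0)// ler_expR.
  by rewrite ler_pM2l// ler_ln ?posrE.
have wge : (M + 1)^-1 <= w.
  rewrite -[(M + 1)^-1]lnK ?posrE ?invr_gt0// ler_expR lnV ?posrE//.
  have h1 : ln y <= ln (M + 1) by rewrite ler_ln ?posrE.
  have h2 : 0 <= ln (M + 1) by apply: ln_ge0; lra.
  nra.
(* sqrt v <= (M + 1) u, since p <= 1/2 *)
have sqv : Num.sqrt v <= (M + 1) * u.
  have -> : Num.sqrt v = expR (1 / 2 * ln v).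
    rewrite -[RHS]ger0_norm ?expR_ge0// -sqrtr_sqr; congr Num.sqrt.
    by rewrite -expRM_natl mulrA mulrC -[LHS](lnK _) ?posrE//; congr expR; field.
  rewrite -[M + 1]lnK ?posrE// -expRD ler_expR.
  have h1 : ln v <= ln y by rewrite ler_ln ?posrE// /y; lra.
  have h2 : ln v <= ln (M + 1) by rewrite ler_ln ?posrE//; lra.
  have h3 : 0 <= ln (M + 1) by apply: ln_ge0; lra.
  nra.
have hm1 : m <= K0 * (M + 1) * u.
  apply: le_trans (ler_norm _) _; apply: le_trans hm _.
  by rewrite -mulrA ler_wpM2l.
have Q0 : 0 <= Q by apply: le_trans Qv; rewrite mulr_ge0// ltW.
have Qy : cm * y <= Q * (1 + eta).
  apply: (@le_trans _ _ (cm * v * (1 + eta))); first by rewrite -mulrA ler_pM2l.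
  by rewrite ler_wpM2r//; lra.
have -> : pow_test1 lam p (eta * e) v * (tr + m) + 2 * pow_test2 lam p (eta * e) v * Q =
   g * (lam * p) * w * (2 * (Q * y^-1) * ((1 - p) + lam * p * u) - tr - m).
  rewrite /pow_test1 /pow_test2 -/g -/w -/y uE; field; rewrite gt_eqF//.
set q := Q * y^-1.
have q0 : cm <= q * (1 + eta).
  by rewrite /q mulrAC ler_pdivlMr.
have q00 : 0 <= q by rewrite mulr_ge0// invr_ge0 ltW.
have k1 : tr + rho <= 2 * q * (1 - p).
  have h1 : tr + 2 * rho <= 2 * cm * (1 - p).
    by rewrite /rho in rho0 pc *; lra.
  have h2 : (tr + rho) * (1 + eta) <= tr + 2 * rho by nra.
  have h3 : (tr + rho) * (1 + eta) <= 2 * q * (1 - p) * (1 + eta).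
    apply: le_trans h2 _; apply: le_trans h1 _.
    have : cm * (1 - p) <= q * (1 + eta) * (1 - p) by rewrite ler_wpM2r//; lra.
    lra.
  by rewrite ler_pM2r// in h3; lra.
have k2 : m <= 2 * q * (lam * p * u).
  have h1 : K0 * (M + 1) * u <= cm * (lam * p * u).
    have -> : cm * (lam * p * u) = (K0 + 1) * (M + 1) * u.
      by rewrite /lam; field; rewrite !gt_eqF.
    by rewrite ler_pM2r// ler_pM2r//; lra.
  have h2 : cm <= 2 * q by nra.
  have h3 : cm * (lam * p * u) <= 2 * q * (lam * p * u).
    by apply: ler_wpM2r => //; exact: ltW (mulr_gt0 (mulr_gt0 lam0 p0) u0).
  lra.
apply: (@le_trans _ _ (g * (lam * p) * w * rho)).
  have lp := mulr_gt0 lam0 p0.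
  apply: ler_wpM2r; first exact: ltW.
  apply: ler_pM => //.
  - by rewrite mulr_ge0 ?expR_ge0// ltW.
  - exact: ltW.
  - by apply: ler_wpM2r => //; exact: ltW.
apply: ler_wpM2l; last by lra.
by rewrite mulr_ge0 ?(ltW w0)// mulr_ge0 ?(ltW g0)// mulr_ge0// ltW.
Qed.
End GeneratorBounds.

(** * From grid events to path events *)

Section ProbabilityLemmas.
Context {R : realType} {d : measure_display} {T : measurableType d}
  (P : probability T R).

Lemma probability_Ex (E : set T) (r : R) : measurable E ->
  (P E <= r%:E)%E = (Ex P \1_E <= r).
Proof. by move=> mE; rewrite -Ex_indic// lee_fin. Qed.

Lemma indic_L1 (E : set T) : measurable E -> L1 P \1_E.
Proof.
move=> mE; apply: (@L1_bounded _ _ _ _ _ 1) => //.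
by move=> w; rewrite indicE; case: (_ \in _); rewrite ?normr1 ?normr0.
Qed.

(** Fatou's lemma for events: the lower limit is an increasing union of tails, each contained in
    some late [E N]. *)
Lemma liminf_measure_le (E : nat -> set T) (r : R) N0 :
  (forall N, measurable (E N)) -> (forall N, (N0 <= N)%N -> Ex P \1_(E N) <= r) ->
  measurable (\bigcup_m \bigcap_(N in [set N | (m <= N)%N]) E N) /\
  (P (\bigcup_m \bigcap_(N in [set N | (m <= N)%N]) E N) <= r%:E)%E.
Proof.
move=> mE HE; pose W m := \bigcap_(N in [set N | (m <= N)%N]) E N.
have mW m : measurable (W m).
  by apply: bigcap_measurable => //; exists m => /=.
have mU : measurable (\bigcup_m W m) by exact: bigcup_measurable.
split=> //.
have W_nd : {homo W : n m / (n <= m)%N >-> (n <= m)%O}.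
  move=> a b ab; apply/subsetPset => w Ww N /= bN; apply: Ww => /=.
  exact: leq_trans ab bN.
have cv := @nondecreasing_cvg_mu _ _ _ P _ mW mU W_nd.
rewrite -(cvg_lim _ cv)//; apply: lime_le; first exact: cvgP cv.
apply: nearW => m /=.
apply: (@le_trans _ _ (P (E (maxn m N0)))).
  apply: le_measure; rewrite ?inE; [exact: mW|exact: mE|].
  by move=> w; apply => /=; exact: leq_maxl.
by rewrite probability_Ex//; apply: HE; exact: leq_maxr.
Qed.

(** [H] itself may fail to be measurable; the covers of measure [1 / (k + 1)] intersect in a null
    set containing it. *)
Lemma negligible_covers (H : set T) :
  (forall e : R, 0 < e -> exists C, [/\ measurable C, H `<=` C & (P C <= e%:E)%E]) ->
  P.-negligible H.
Proof.
move=> HC.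
have HC' (k : nat) : exists C, [/\ measurable C, H `<=` C & (P C <= (k.+1%:R^-1 : R)%:E)%E].
  by apply: HC; rewrite invr_gt0.
have /choice[C HCk] := HC'.
exists (\bigcap_k C k).
have mC : measurable (\bigcap_k C k) by apply: bigcapT_measurable => k; have [] := HCk k.
split=> //; last by move=> w Hw k _; have [_ + _] := HCk k; exact.
apply/eqP; rewrite eq_le measure_ge0 andbT; apply/lee_addgt0Pr => e e0.
rewrite add0e.
pose k := Num.bound e^-1.
have [mk _ Pk] := HCk k.
apply: (@le_trans _ _ (P (C k))).
  by apply: le_measure; rewrite ?inE// => w; apply.
apply: le_trans Pk _; rewrite lee_fin invf_ple ?posrE//.
apply: le_trans (ltW (archi_boundP _)) _; first by rewrite invr_ge0 ltW.
by rewrite ler_nat.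
Qed.
End ProbabilityLemmas.

Section GridNear.
Context {R : realType}.

Lemma grid_near (s tau t : R) N : 0 < tau -> s <= t <= s + tau ->
  exists2 k, (k <= N.+1)%N & `|t - grid s tau N k| <= mesh tau N.
Proof.
move=> tau0 /andP[st tst]; have m0 := mesh_gt0 N tau0.
have x0 : 0 <= (t - s) / mesh tau N by rewrite divr_ge0 ?subr_ge0// ltW.
have /andP[] := truncn_itv x0; set k := Num.truncn _ => k1 k2.
exists k.
  rewrite -(ler_nat R); apply: le_trans k1 _.
  rewrite ler_pdivrMr// mulrC /mesh divfK ?pnatr_eq0//; lra.
move: k1 k2; rewrite ler_pdivlMr// ltr_pdivrMr// -natr1 mulrDl mul1r => k1 k2.
by rewrite /grid ler_norml; lra.
Qed.
End GridNear.

Section WithinContinuous.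
Context {R : realType}.
Let D := [set t : R | 0 <= t].

Lemma within_continuousD (f g : R -> R) : {within D, continuous f} ->
  {within D, continuous g} -> {within D, continuous (fun t => f t + g t)}.
Proof. by move=> cf cg x; apply: cvgD; [exact: cf|exact: cg]. Qed.

Lemma within_continuousM (f g : R -> R) : {within D, continuous f} ->
  {within D, continuous g} -> {within D, continuous (fun t => f t * g t)}.
Proof. by move=> cf cg x; apply: cvgM; [exact: cf|exact: cg]. Qed.

Lemma within_continuous_cst (k : R) : {within D, continuous (fun _ : R => k)}.
Proof. by move=> x; exact: cvg_cst. Qed.

Lemma within_continuous_sum I (r : seq I) (f : I -> R -> R) :
  (forall i, {within D, continuous (f i)}) ->
  {within D, continuous (fun t => \sum_(i <- r) f i t)}.
Proof.
move=> cf; elim: r => [|i r IH].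
  rewrite (_ : (fun _ => _) = fun=> 0); first exact: within_continuous_cst.
  by apply/funext => t; rewrite big_nil.
rewrite (_ : (fun _ => _) = fun t => f i t + \sum_(i <- r) f i t).
  exact: within_continuousD.
by apply/funext => t; rewrite big_cons.
Qed.
End WithinContinuous.

(** * Localisation of the process *)

Section Corner.
Context {R : realType} {d : measure_display} {T : measurableType d}
  (P : probability T R) {n : nat} (F : R -> set (set T))
  (Rm : 'M[R]_n) (c : 'I_n -> R)
  (mu : 'cV[R]_n) (A : 'M[R]_n) (z : 'cV[R]_n) (B L Z : R -> T -> 'cV[R]_n).
Hypotheses (n0 : (0 < n)%N) (HR : reflection_M_matrix Rm) (c0 : forall i, 0 < c i)
  (symRC : (Rm *m diagC c)^T = Rm *m diagC c)
  (HA : sym_pos_def A) (HS : is_SRBM Rm mu A z P F B L Z).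
Let Om := invmx (Rm *m diagC c).
Let V (x : 'cV[R]_n) := qform Om x x.
Let VZ t w := V (Z t w).
Let tr := \tr (Om *m A).
Let drift0 := 2 * Num.sqrt (V mu).

Let Vge0 x : 0 <= V x. Proof. exact: Omega_psd. Qed.

Let HF : is_filtration F. Proof. by case: HS => -[]. Qed.
Let adZ : adapted F Z. Proof. by case: HS => _ []. Qed.
Let adL : adapted F L. Proof. by case: HS => _ _ _ []. Qed.
Let cZ : continuous_paths Z. Proof. by case: HS => _ []. Qed.
Let cL : continuous_paths L. Proof. by case: HS => _ _ _ []. Qed.
Let Zorthant t w : 0 <= t -> Z t w \in @orthant R n.
Proof. by case: HS => _ [_ _ h] _ _ _ t0; apply/mem_set => i; exact: h. Qed.
Let ndL s t w i : 0 <= s -> s <= t -> L s w i 0 <= L t w i 0.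
Proof. by case: HS => _ _ _ _ /(_ w i) [_ h _]; exact: h. Qed.

Let drift00 : 0 <= drift0. Proof. by rewrite mulr_ge0// sqrtr_ge0. Qed.

Let driftE x : `|2 * qform Om x mu| <= drift0 * Num.sqrt (V x).
Proof.
rewrite normrM ger0_norm// /drift0 -mulrA ler_pM2l//.
exact: drift_bound.
Qed.

Let VZ_Fmeas t : 0 <= t -> measurable_wrt (F t) (VZ t).
Proof. by move=> t0; apply: measurable_wrt_qform => // i; exact: adZ. Qed.

Let VZ_meas t : 0 <= t -> measurable_fun setT (VZ t).
Proof. by move=> t0; exact: measurable_wrt_measurable HF _ _ (VZ_Fmeas t0). Qed.

Let L_meas t i : 0 <= t -> measurable_fun setT (fun w => L t w i 0).
Proof. by move=> t0; exact: measurable_wrt_measurable HF _ _ (adL t0 i). Qed.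

Lemma VZ_continuous w : {within [set t : R | 0 <= t], continuous (fun t => VZ t w)}.
Proof.
rewrite (_ : (fun _ => _) = fun t => \sum_i \sum_j Om i j * (Z t w i 0 * Z t w j 0)).
  apply: within_continuous_sum => i; apply: within_continuous_sum => j.
  apply: within_continuousM; first exact: within_continuous_cst.
  by apply: within_continuousM; exact: cZ.
by apply/funext => t; rewrite /VZ /V qformE.
Qed.

(** The sets that play the role of [D]: the bounds on [V] confine the process to where the generator
    estimate holds, and the bound on [L] controls the reflection error. *)
Definition slab (a b M : R) (t : R) : set T :=
  [set w | [/\ a <= VZ t w, VZ t w <= b & forall i, L t w i 0 <= M]].

Lemma slab_F a b M t : 0 <= t -> F t (slab a b M t).
Proof.
move=> t0; have [sF _ _] := HF.
pose Tt := g_sigma_algebraType (F t).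
have mF (E : set T) : F t E -> measurable (E : set Tt).
  by move=> FE; exact: sub_sigma_algebra.
rewrite -(sigma_algebra_id (sF t)).
have -> : slab a b M t = VZ t @^-1` `[a, b]%classic `&`
    \bigcap_(i in [set: 'I_n]) ((fun w => L t w i 0) @^-1` `]-oo, M]%classic).
  apply/seteqP; split => w; rewrite /slab /= in_itv/=.
    by move=> [-> -> H]; split=> // i _ /=; rewrite in_itv/=.
  by move=> [/andP[-> ->] H]; split=> // i; have := H i I; rewrite /= in_itv.
apply: (@measurableI _ Tt); first by apply: mF; apply: VZ_Fmeas.
apply: (@fin_bigcap_measurable _ Tt) => //.
by move=> i _; apply: mF; exact: adL.
Qed.

Lemma slab_measurable a b M t : 0 <= t -> measurable (slab a b M t).
Proof. by move=> t0; exact: filtration_measurable HF _ _ (slab_F a b M t0). Qed.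

Let path_bound w (b : R) : 0 <= b ->
  exists M : nat, forall t, 0 <= t <= b -> VZ t w <= M%:R /\ forall i, L t w i 0 <= M%:R.
Proof.
move=> b0; have [k Hk] := segment_bounded (@VZ_continuous w) b0.
pose x := k + \sum_i `|L b w i 0|.
have k0 : 0 <= k by apply: le_trans (Hk 0 _); rewrite ?lexx.
have x0 : 0 <= x by rewrite addr_ge0// sumr_ge0.
exists (Num.bound x) => t tb; have xb := ltW (archi_boundP x0).
split.
  apply: le_trans xb; apply: le_trans (ler_norm _) _; apply: le_trans (Hk t tb) _.
  by rewrite lerDl sumr_ge0.
move=> i; apply: le_trans xb; have /andP[t0 tb'] := tb.
apply: le_trans (ndL w i t0 tb') _; apply: le_trans (ler_norm _) _.
by rewrite /x (bigD1 i)//= addrCA lerDl addr_ge0// sumr_ge0.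
Qed.

(** * The corner is avoided *)

Section Avoids.
Hypothesis trc : 2 * c_plus Om A <= tr.

Let cp0 : 0 < c_plus Om A. Proof. exact: c_plus_gt0. Qed.
Let tr0 : 0 < tr. Proof. by apply: lt_le_trans trc; rewrite mulr_gt0. Qed.

Let QE x : x \in @orthant R n -> 0 <= qform A (Om *m x) (Om *m x) /\
  qform A (Om *m x) (Om *m x) <= c_plus Om A * V x.
Proof.
move=> xS; have /andP[_ ->] := Omega_A_bounds HR c0 symRC HA xS; split=> //.
have [->|h] := eqVneq (Om *m x) 0; first by rewrite /qform mulmx0 mxE.
by have [_ /(_ _ h) /ltW] := HA.
Qed.

(** Only the countably many grid times of [[0, tau]] are inspected, in accordance with what the
    [alive] events see. *)
Definition stuck_at_corner (tau M : R) : set T := [set w | forall N k,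
  (k <= N.+1)%N -> VZ (grid 0 tau N k) w = 0 /\ forall i, L (grid 0 tau N k) w i 0 <= M].

(** A stuck path stays in [V <= r / a] up to time [tau], where the generator of a test function with
    values in [[0, 1]] is at most [- C a]. Hence [C a tau] times the probability is at most 2, and
    [a] is arbitrary. *)
Lemma stuck_negligible tau M : 0 < tau -> 0 <= M -> P.-negligible (stuck_at_corner tau M).
Proof.
move=> tau0 M0; apply: negligible_covers => e e0.
have [r [C [r0 C0 [a0 Ha]]]] := exp_generator_le tr0 drift00 (ltW cp0).
(* A sum that exceeds every lower bound required of [a]; the last term gives [2 <= a C tau e]. *)
pose a := `|a0| + 1 + r + 2 / (C * tau * e).
have den : 0 < C * tau * e by rewrite !mulr_gt0.
have q0 : 0 < 2 / (C * tau * e) by rewrite divr_gt0.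
have a0a : a0 <= a by have := ler_norm a0; rewrite /a; lra.
have a1 : 1 <= a by have := normr_ge0 a0; rewrite /a; lra.
have ra : r <= a by have := normr_ge0 a0; rewrite /a; lra.
have qa : 2 <= a * (C * tau * e).
  by rewrite -ler_pdivrMr//; have := normr_ge0 a0; rewrite /a; lra.
have apos : 0 < a by lra.
have ra1 : r / a <= 1 by rewrite ler_pdivrMr// mul1r.
have rap : 0 < r / a by rewrite divr_gt0.
have [K tg] := exp_test_taylor (ltW apos).
pose D t := slab 0 (r / a) M t.
have FT : F 0 setT.
  have [sF _ _] := HF; rewrite -(sigma_algebra_id (sF 0)).
  exact: (@measurableT _ (g_sigma_algebraType (F 0))).
have [Mx Mx1 MxM] : exists2 Mx, r / a <= Mx & M <= Mx by exists (1 + M); lra.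
have M10 : 0 <= Mx by lra.
have DV t w : 0 <= t -> D t w -> VZ t w <= Mx by move=> _ [_ h _]; lra.
have DL t w i : 0 <= t -> D t w -> L t w i 0 <= Mx by move=> _ [_ _ /(_ i)]; lra.
have gen t w : 0 <= t -> D t w ->
    generator Om A mu (exp_test1 a) (exp_test2 a) (Z t w) <= - (C * a).
  move=> t0 [_ Dv _]; have [Q0 Qc] := QE (Zorthant w t0).
  by apply: Ha => //; exact: Vge0.
have [N0 /(_ N0 (leqnn _)) HN] := dynkin_le HR c0 symRC HA HS (lexx 0) tau0 M10 FT
  (fun t t0 => @slab_F 0 (r / a) M t t0) DV DL tg (exp_test_le1 (ltW apos)) gen ltr01.
pose al := alive D setT 0 tau N0 N0.
have mal : measurable al.
  exact: (alive_measurable HS (lexx 0) tau0 FT (fun t t0 => @slab_F 0 (r / a) M t t0)).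
exists al; split=> //.
  move=> w Hw; split=> // j jN; have [V0 LM] := Hw N0 j (leqW jN).
  by split=> //; rewrite V0 // ltW.
rewrite probability_Ex//.
have inc_ge : -1 <= Ex P (increments Rm c Z D setT 0 tau (exp_test a) N0).
  have I1 := increments_L1 HR c0 symRC HS (lexx 0) tau0 FT
    (fun t t0 => @slab_F 0 (r / a) M t t0) tg (exp_test_le1 (ltW apos)) N0.
  rewrite -(Ex_cst P (-1)); apply: Ex_le => //; first exact: L1_cst.
  move=> w; have [k _ [E _ _]] := stopped_value Rm c Z D 0 tau (exp_test a) N0 (I : [set: T] w).
  have g1 : exp_test a (VZ 0 w) <= 1.
    by apply: le_trans (ler_norm _) _; apply: exp_test_le1; [exact: ltW|exact: Vge0].
  have g0 t : 0 <= exp_test a (VZ t w) by exact: expR_ge0.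
  have := g0 (grid 0 tau N0 k); rewrite -E; lra.
have occ := occupation_ge HS (lexx 0) tau0 FT (fun t t0 => @slab_F 0 (r / a) M t t0) N0.
set o := occupation _ _ _ _ _ _ in HN occ.
have h1 : C * a * (Ex P \1_al * tau) <= 2.
  have : C * a * (Ex P \1_al * tau) <= C * a * o by rewrite ler_pM2l// mulr_gt0.
  move: HN inc_ge; lra.
rewrite leNgt; apply/negP => he.
have h2 : C * a * (e * tau) < C * a * (Ex P \1_al * tau).
  by rewrite ltr_pM2l ?mulr_gt0// ltr_pM2r.
move: qa h1 h2; lra.
Qed.

(** The grid trace of [hitting_set]. As [V] and [L] obey their upper bounds at all grid times,
    [slab e M M] can only be left through [V < e]. *)
Let low_event (G : set T) (s tau M e : R) N : set T := G `&`
  (\bigcap_(j in [set j | (j <= N.+1)%N]) slab 0 M M (grid s tau N j)) `&`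
  (\bigcup_(j in [set j | (j <= N.+1)%N]) (VZ (grid s tau N j) @^-1` `]-oo, e[%classic)).

Let low_event_measurable G s tau M e N : 0 <= s -> 0 < tau -> measurable G ->
  measurable (low_event G s tau M e N).
Proof.
move=> s0 tau0 mG.
have t0 j : 0 <= grid s tau N j by exact: le_trans s0 (grid_ge _ _ _ tau0).
apply: measurableI; first apply: measurableI => //.
  apply: bigcap_measurable; first by exists 0%N.
  by move=> j _; exact: slab_measurable.
apply: bigcup_measurable => j _.
by rewrite -[X in measurable X]setTI; exact: VZ_meas.
Qed.

Definition hitting_set (s tau dl M : R) : set T := [set w | [/\ dl <= VZ s w,
  (forall t, s <= t <= s + tau -> VZ t w <= M /\ forall i, L t w i 0 <= M) &
  exists2 t, s <= t <= s + tau & Z t w = 0]].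

(** The test function is nonnegative, at most [gam] at the start and at least [X] where [V < e],
    while its mean grows by at most [|C| tau + 1]. So dipping below [e] has probability at most
    [(gam + |C| tau + 1) / X], where only [X] depends on [e]; [X] is chosen to make this [eta]. *)
Lemma hitting_negligible s tau dl M : 0 <= s -> 0 < tau -> 0 < dl -> 0 <= M ->
  P.-negligible (hitting_set s tau dl M).
Proof.
move=> s0 tau0 dl0 M0; apply: negligible_covers => eta eta0.
have [kappa [C [kappa0 HC]]] := log_generator_le drift00 cp0 trc M0.
pose gam := ln (1 + dl^-1) + kappa.
have gam0 : 0 <= gam by rewrite addr_ge0// ln_ge0// lerDl invr_ge0 ltW.
pose X := (gam + `|C| * tau + 1) / eta.
have X0 : 0 < X by rewrite divr_gt0// ltr_wpDl// addr_ge0// mulr_ge0// ltW.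
(* If [v < e] then [v + e < 2 e], so the logarithmic part is at least [ln (1 / (2 e)) = X]. *)
pose e := expR (- X) / 2.
have e0 : 0 < e by rewrite divr_gt0// expR_gt0.
have e12 : 2 * e <= 1.
  by rewrite /e mulrC divfK// -expR0 ler_expR oppr_le0 ltW.
have e1 : e <= 1 by lra.
pose g1v := fun v => ln_test1 1 v + -1 * ln_test1 e v + kappa * pow_test1 1 (1 / 2) e v.
pose g2v := fun v => ln_test2 1 v + -1 * ln_test2 e v + kappa * pow_test2 1 (1 / 2) e v.
pose g := fun v => ln_test 1 v + -1 * ln_test e v + kappa * pow_test 1 (1 / 2) e v.
have [K1 t1] := ln_test_taylor (@ltr01 R).
have [K2 t2] := ln_test_taylor e0.
have [K3 t3] : exists K, taylor_bounded (pow_test 1 (1 / 2) e) (pow_test1 1 (1 / 2) e) (pow_test2 1 (1 / 2) e) K.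
  by apply: pow_test_taylor => //; lra.
have tg := taylor_boundedD kappa (taylor_boundedD (-1) t1 t2) t3.
have lnB v a : 0 <= v -> 0 < a -> v + 1 <= a * (v + e) -> ln_test 1 v + -1 * ln_test e v <= ln a.
  move=> v0 a0 va; rewrite mulN1r lerBlDr /ln_test -lnM ?posrE//; last by rewrite ltr_wpDl.
  by rewrite ler_ln ?posrE// ?mulr_gt0// ltr_wpDl.
have lnge v b : 0 <= v -> 0 < b -> b * (v + e) <= v + 1 -> ln b <= ln_test 1 v + -1 * ln_test e v.
  move=> v0 b0 vb; rewrite mulN1r lerBrDr /ln_test -lnM ?posrE//; last by rewrite ltr_wpDl.
  by rewrite ler_ln ?posrE// ?mulr_gt0// ltr_wpDl.
have pw0 v : 0 <= kappa * pow_test 1 (1 / 2) e v by rewrite mulr_ge0// expR_ge0.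
have pw1 v : kappa * pow_test 1 (1 / 2) e v <= kappa.
  rewrite -[leRHS]mulr1 ler_wpM2l//; apply: le_trans (ler_norm _) _.
  exact: pow_test_le1.
have g0 v : 0 <= v -> 0 <= g v.
  by move=> v0; rewrite addr_ge0// -[leLHS]ln1 lnge//; lra.
have gK v : 0 <= v -> `|g v| <= ln e^-1 + kappa.
  move=> v0; rewrite ger0_norm ?g0//; apply: lerD => //; apply: lnB => //.
    by rewrite invr_gt0.
  rewrite mulrDr mulVf ?gt_eqF// lerD2r ler_peMl// invf_ge1//.
have gG v : dl <= v -> g v <= gam.
  move=> vdl; have v0 : 0 <= v by lra.
  apply: lerD => //; apply: lnB => //; first by rewrite ltr_wpDr// invr_ge0 ltW.
  rewrite mulrDl mul1r -addrA lerD2l.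
  have : 1 <= dl^-1 * v by rewrite mulrC ler_pdivlMr// mul1r.
  have : 0 <= dl^-1 * e by rewrite mulr_ge0 ?invr_ge0 ?ltW.
  by rewrite mulrDr; lra.
have glow v : 0 <= v -> v < e -> X <= g v.
  move=> v0 ve; have e20 : 0 < 2 * e by rewrite mulr_gt0.
  have XE : X = ln (2 * e)^-1.
    have -> : 2 * e = expR (- X) by rewrite /e mulrC divfK.
    by rewrite -expRN opprK expRK.
  have h : ln (2 * e)^-1 <= ln_test 1 v + -1 * ln_test e v.
    apply: lnge => //; first by rewrite invr_gt0.
    rewrite mulrC ler_pdivrMr//; nra.
  have := pw0 v; rewrite -XE in h; rewrite /g; lra.
pose G := [set w | dl <= VZ s w].
have GE : G = VZ s @^-1` `[dl, +oo[%classic.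
  by apply/seteqP; split => w; rewrite /G /= in_itv/= andbT.
have FG : F s G by rewrite GE; apply: VZ_Fmeas.
have mG := filtration_measurable HF FG.
pose D t := slab e M M t.
have FD t (t0 : 0 <= t) := @slab_F e M M t t0.
have DV t w : 0 <= t -> D t w -> VZ t w <= M by move=> _ [].
have DL t w i : 0 <= t -> D t w -> L t w i 0 <= M by move=> _ [].
have gen t w : 0 <= t -> D t w -> generator Om A mu g1v g2v (Z t w) <= C.
  move=> t0 [_ Dv _]; have [Q0 Qc] := QE (Zorthant w t0).
  by apply: HC => //; exact: Vge0.
have [N0 HN] := dynkin_le HR c0 symRC HA HS s0 tau0 M0 FG FD DV DL tg gK gen ltr01.
pose E := low_event G s tau M e.
have mE N : measurable (E N) by exact: low_event_measurable.
have PE N : (N0 <= N)%N -> Ex P \1_(E N) <= eta.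
  move=> lN; pose inc := increments Rm c Z D G s tau g N.
  have I1 : L1 P inc := increments_L1 HR c0 symRC HS s0 tau0 FG FD tg gK N.
  have I0 : L1 P (fun w => \1_G w * g (VZ s w)) := initial_L1 HR c0 symRC HS s0 FG tg gK.
  have t0 j : 0 <= grid s tau N j by exact: le_trans s0 (grid_ge _ _ _ tau0).
  have ineq w : X * \1_(E N) w <= \1_G w * g (VZ s w) + inc w.
    have [Gw|nG] := pselect (G w); last first.
      rewrite /inc (increments0 Rm c Z D s tau g N nG) !indicE !memNset//.
        by rewrite mulr0 mul0r addr0.
      by move=> -[[]].
    have [k kN [Ek Hk Dk]] := stopped_value Rm c Z D s tau g N Gw.
    rewrite [\1_G w]indicE mem_set// mul1r [X in _ <= X]Ek.
    rewrite indicE; have [Ew|nE] := pselect (E N w); last first.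
      by rewrite memNset// mulr0; apply: g0; exact: Vge0.
    rewrite mem_set// mulr1; apply: glow; first exact: Vge0.
    case: Ew => -[_ Bd] [j /= jN]; rewrite in_itv/= => Vj.
    (* Either the stopping point is outside the slab, hence has [V < e], or no dip occurs up to
       index [N] and the dip of the event is at [N + 1], which is the stopping index. *)
    case: Hk => [[kE [_ aw]]|nD]; last first.
      rewrite ltNge; apply/negP => Vk; apply: nD.
      by have [_ b1 b2] := Bd k kN; split.
    have [jN'|Nj] := leqP j N.
      by have [+ _ _] := aw j jN'; rewrite leNgt Vj.
    by rewrite kE (_ : N.+1 = j)//; apply/eqP; rewrite eqn_leq Nj.
  have IE : L1 P (fun w => X * \1_(E N) w) by apply: L1Z; exact: indic_L1.
  have := Ex_le IE (L1D I0 I1) ineq.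
  rewrite ExZ; last exact: indic_L1.
  rewrite ExD//.
  have h1 : Ex P (fun w => \1_G w * g (VZ s w)) <= gam.
    rewrite -[leRHS](Ex_cst P); apply: Ex_le => //; first exact: L1_cst.
    move=> w; rewrite indicE; have [Gw|nG] := pselect (G w).
      by rewrite mem_set// mul1r; exact: gG.
    by rewrite memNset// mul0r.
  have h2 := HN N lN.
  have h3 : C * occupation P D G s tau N <= `|C| * tau.
    apply: (@le_trans _ _ (`|C| * occupation P D G s tau N)).
      rewrite ler_wpM2r ?ler_norm//.
      rewrite mulr_ge0 ?(ltW (mesh_gt0 _ tau0))//.
      by apply: sumr_ge0 => k _; apply: Ex_ge0 => w; rewrite indicE.
    by rewrite ler_wpM2l//; exact: (occupation_le HS s0 tau0 FG FD).
  move=> h4; have h5 : X * Ex P \1_(E N) <= gam + `|C| * tau + 1 by rewrite /inc in h4; lra.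
  have h6 : X * eta = gam + `|C| * tau + 1 by rewrite /X divfK// gt_eqF.
  by rewrite -h6 ler_pM2l in h5.
have [mU PU] := liminf_measure_le mE PE.
eexists; split; [exact: mU| |exact: PU].
(* By continuity [V < e] near the hitting time [t], so every sufficiently fine grid sees the dip and
   the path lies in the lower limit of the events. *)
move=> w [Gw Bd [t st Zt]].
have VZt : VZ t w = 0 by rewrite /VZ Zt /V /qform mulmx0 mxE.
have t0 : 0 <= t by case/andP: st => h _; exact: le_trans h.
have [dd dd0 Hdd] := within_continuous_eps (@VZ_continuous w) t0 e0.
have [N1 HN1] := mesh_small tau0 dd0.
exists N1 => // N /= lN.
have g_t0 j : 0 <= grid s tau N j by exact: le_trans s0 (grid_ge _ _ _ tau0).
split.
  split=> // j /= jN.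
  have [b1 b2] : VZ (grid s tau N j) w <= M /\ forall i, L (grid s tau N j) w i 0 <= M.
    by apply: Bd; rewrite grid_ge//= grid_le.
  by split=> //; exact: Vge0.
have [k kN hk] := grid_near N tau0 st.
exists k => //=; rewrite in_itv/=.
have := Hdd (grid s tau N k) (g_t0 k) (le_lt_trans hk (HN1 N lN)).
by rewrite VZt sub0r normrN ger0_norm//; exact: Vge0.
Qed.

(** Either [Z] is off the corner at some rational time before the hit, and [hitting_negligible]
    applies from there, or [V] vanishes at all rational times up to the hit and the path is stuck
    from time 0. Both alternatives are countable unions over rational data and integer bounds. *)
Theorem avoids_corner : P.-negligible (hits_corner Z).
Proof.
pose q (i j : nat) : R := i%:R / j.+1%:R.
have q0 i j : 0 <= q i j by rewrite divr_ge0.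
pose bad := (\bigcup_i \bigcup_j \bigcup_k \bigcup_m \bigcup_M
  hitting_set (q i j) m.+1%:R k.+1%:R^-1 M%:R) `|`
  (\bigcup_m \bigcup_M stuck_at_corner m.+1%:R^-1 M%:R).
apply: (@negligibleS _ _ _ P bad); last first.
  apply: negligibleU.
    do 5 (apply: negligible_bigcup => ?).
    by apply: hitting_negligible => //; rewrite ?invr_gt0 ?ltr0n.
  do 2 (apply: negligible_bigcup => ?).
  by apply: stuck_negligible => //; rewrite ?invr_gt0 ?ltr0n.
move=> w [t [t0 Zt]].
have [[i [j [qt Vq]]]|H] := pselect (exists i j, q i j <= t /\ VZ (q i j) w <> 0).
  left; exists i => //; exists j => //.
  have Vpos : 0 < VZ (q i j) w by rewrite lt_neqAle Vge0 andbT eq_sym; apply/eqP.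
  exists (Num.bound (VZ (q i j) w)^-1) => //; set k := Num.bound _.
  have tb : 0 <= t - q i j by rewrite subr_ge0.
  exists (Num.bound (t - q i j)) => //; set m := Num.bound _.
  have [M HM] := path_bound w (addr_ge0 (q0 i j) (ler0n R m.+1)).
  exists M => //; split.
  - rewrite invf_ple ?posrE ?ltr0n//.
    apply: le_trans (ltW (archi_boundP _)) _; first by rewrite invr_ge0 ltW.
    by rewrite ler_nat.
  - by move=> u /andP[u1 u2]; apply: HM; rewrite u2 (le_trans (q0 i j) u1).
  - exists t => //; rewrite qt/=.
    have := archi_boundP tb; rewrite -/m => h.
    have : (m%:R : R) <= m.+1%:R by rewrite ler_nat.
    lra.
right; pose m := Num.bound t^-1.
have mt : m.+1%:R^-1 <= t.
  rewrite invf_ple ?posrE ?ltr0n//.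
  apply: le_trans (ltW (archi_boundP _)) _; first by rewrite invr_ge0 ltW.
  by rewrite ler_nat.
have [M HM] := path_bound w (ltW t0).
exists m => //; exists M => // N k kN.
have tau0 : 0 < m.+1%:R^-1 :> R by rewrite invr_gt0.
have gk0 := grid_ge (0 : R) N k tau0.
have gkt : grid 0 m.+1%:R^-1 N k <= t.
  by apply: le_trans (grid_le (0 : R) tau0 kN) _; rewrite add0r.
have [|_ HL] := HM (grid 0 m.+1%:R^-1 N k); first by rewrite gk0.
split; last exact: HL.
apply: contrapT => nV; apply: H.
(* The grid point is [k / ((m + 1) (N + 1))]; the predecessor compensates the successor in the
   denominator of [q]. *)
exists k, (m.+1 * N.+1).-1%N.
have -> : q k (m.+1 * N.+1).-1%N = grid 0 m.+1%:R^-1 N k.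
  by rewrite /q prednK ?muln_gt0// /grid /mesh add0r natrM invfM.
by [].
Qed.

End Avoids.

(** * The corner is hit *)

Section Hits.
Hypotheses (tr0 : 0 <= tr) (trc : tr < 2 * c_minus Om A).

Let large_L (s b : R) : set T := [set w | exists i, b < L s w i 0].

Let large_L_measurable s b : 0 <= s -> measurable (large_L s b).
Proof.
move=> s0.
have -> : large_L s b = \bigcup_(i in [set: 'I_n]) ((fun w => L s w i 0) @^-1` `]b, +oo[%classic).
  apply/seteqP; split => w.
    by move=> [i Hi]; exists i => //=; rewrite in_itv/= andbT.
  by move=> [i _] /=; rewrite in_itv/= andbT => h; exists i.
apply: fin_bigcup_measurable => // i _.
by rewrite -[X in measurable X]setTI; exact: L_meas.
Qed.

Let large_L_small s e : 0 <= s -> 0 < e -> exists2 b, 0 <= b & Ex P \1_(large_L s b) <= e.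
Proof.
move=> s0 e0.
pose W (k : nat) := large_L s k%:R.
have mW k : measurable (W k) by exact: large_L_measurable.
have W0 : \bigcap_k W k = set0.
  rewrite -subset0 => w Ww.
  have [M HM] := path_bound w s0.
  have [i Hi] := Ww M I.
  have [|_ /(_ i)] := HM s; first by rewrite s0 lexx.
  by rewrite leNgt Hi.
have mI : measurable (\bigcap_k W k) by exact: bigcapT_measurable.
have Wd : {homo W : n m / (n <= m)%N >-> (m <= n)%O}.
  move=> a b ab; apply/subsetPset => w [i Hi]; exists i.
  by apply: le_lt_trans Hi; rewrite ler_nat.
have fin : (P (W 0%N) < +oo)%E by rewrite ltey_eq fin_num_measure.
have cv := @nonincreasing_cvg_mu _ _ _ P _ fin mW mI Wd.
rewrite W0 measure0 in cv.
have cv' : Ex P \1_(W k) @[k --> \oo] --> (0 : R).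
  rewrite (_ : (fun k => Ex P \1_(W k)) = fine \o (P \o W)); first exact: fine_cvg cv.
  by apply/funext => k /=; rewrite -Ex_indic.
move/cvgrPdist_le : cv' => /(_ e e0) [k _ Hk].
exists k%:R => //.
have := Hk k (leqnn k); rewrite sub0r normrN; apply: le_trans; exact: ler_norm.
Qed.

(** Starting the estimate at time 1 makes the hit occur at a positive time, even if [z] is the
    corner. The state at that time is only known to be finite, so a level of positive probability
    has to be selected. *)
Let some_level : exists2 m : R, 1 <= m & 0 < Ex P \1_[set w | VZ 1 w <= m].
Proof.
pose W (k : nat) := [set w | VZ 1 w <= k.+1%:R].
have mW k : measurable (W k).
  rewrite (_ : W k = VZ 1 @^-1` `]-oo, k.+1%:R]%classic).
    by rewrite -[X in measurable X]setTI; exact: VZ_meas.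
  by apply/seteqP; split => w; rewrite /W /= in_itv.
have [[k Hk]|H] := pselect (exists k, 0 < Ex P \1_(W k)).
  by exists k.+1%:R => //; rewrite ler1n.
have W0 k : P (W k) = 0%E.
  rewrite -Ex_indic//; congr EFin; apply/eqP; rewrite eq_le; apply/andP; split.
    by rewrite leNgt; apply/negP => h; apply: H; exists k.
  by apply: Ex_ge0 => w; rewrite indicE.
have : P.-negligible (\bigcup_k W k).
  by apply: negligible_bigcup => k; exists (W k); split; [exact: mW|exact: W0|].
have -> : \bigcup_k W k = setT.
  apply/seteqP; split => // w _; exists (Num.bound (VZ 1 w)) => //=.
  apply: le_trans (ltW (archi_boundP (Vge0 _))) _; by rewrite ler_nat.
move=> /negligibleP => /(_ measurableT).
move=> PT0; have PT : P setT = 1%E by exact: probability_setT.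
by move: PT; rewrite [LHS]PT0 => /eqP; rewrite eq_sym onee_eq0.
Qed.

Let dip (tau e : R) N : set T :=
  \bigcup_(j in [set j | (j <= N.+1)%N]) (VZ (grid 1 tau N j) @^-1` `]-oo, e[%classic).

Let dip_measurable tau e N : 0 < tau -> measurable (dip tau e N).
Proof.
move=> tau0.
have t0 j : 0 <= grid 1 tau N j by exact: le_trans ler01 (grid_ge _ _ _ tau0).
apply: bigcup_measurable => j _.
by rewrite -[X in measurable X]setTI; exact: VZ_meas.
Qed.

(** On [G] the test function starts above [ga], an exit through [V > M] leaves it below [gb < ga],
    and its mean cannot decrease by more than an error [q]. Not having left by time [tau] and having
    a large [L] each have probability at most [q]. As [(ga - gb) pG = 4 q], at least [q] is left for
    the dips, with [q] and [tau] independent of [e]. *)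
Lemma dip_probability : exists tau q : R, [/\ 0 < tau, 0 < q &
  forall e, 0 < e -> e <= 1 / 2 -> exists N, q <= Ex P \1_(dip tau e N)].
Proof.
have arith (I0 Inc D pg a b x al bL k : R) : I0 + Inc <= (D + b * pg) + (al + bL) ->
    a * pg <= I0 -> x - k <= Inc -> bL <= k -> al <= k -> 0 <= x ->
    (a - b) * pg = 4 * k -> k <= D by lra.
have le1_half (a b x k : R) : 0 < b -> b <= a -> a <= 1 -> 0 <= x -> x <= 1 -> k = (a - b) * x / 4 -> k <= 1 by nra.
have [m0 m01 pG0] := some_level.
set G := [set w | VZ 1 w <= m0] in pG0; set pG := Ex P \1_G in pG0.
pose M := m0 + 1.
have M1 : 1 <= M by rewrite /M; lra.
have [lam [p [eta [C [lam0 p0 p1 [eta0 [eta1 [C0 HC]]]]]]]] :=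
  pow_generator_ge drift00 tr0 trc M1.
(* The shift satisfies [eta e <= 1/2], so a start below [m0] gives an argument of at most
   [m0 + 1/2], while above [M = m0 + 1] it exceeds [M]: the gap between [ga] and [gb] is uniform in
   [e]. *)
pose ga := expR (- lam * expR (p * ln (m0 + 1 / 2))).
pose gb := expR (- lam * expR (p * ln M)).
have gab : gb < ga.
  rewrite ltr_expR ltr_nM2l ?oppr_lt0// ltr_expR ltr_pM2l//.
  by rewrite ltr_ln ?posrE /M; lra.
pose q := (ga - gb) * pG / 4.
have q0 : 0 < q by rewrite divr_gt0// mulr_gt0// subr_gt0.
have q1 : q <= 1.
  have pG1 : pG <= 1.
    have mG : measurable G.
      rewrite (_ : G = VZ 1 @^-1` `]-oo, m0]%classic); last first.
        by apply/seteqP; split => w; rewrite /G /= in_itv.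
      by rewrite -[X in measurable X]setTI; exact: VZ_meas.
    by rewrite -probability_Ex//; exact: probability_le1.
  have ga1 : ga <= 1.
    by rewrite -expR0 ler_expR mulNr oppr_le0 mulr_ge0 ?expR_ge0// ltW.
  exact: (le1_half ga gb pG q (expR_gt0 _) (ltW gab) ga1 (ltW pG0) pG1 erefl).
(* The mean increment is at most 1 and the error at most [q <= 1], so [C tau] times the probability
   of still being alive is at most 2, and that probability is at most [q]. *)
pose tau := 2 / (C * q).
have tau0 : 0 < tau by rewrite divr_gt0// mulr_gt0.
have st0 : 0 <= 1 + tau by lra.
have [b b0 Hb] := large_L_small st0 q0.
exists tau, q; split=> // e e0 e12.
have ee0 : 0 < eta * e by rewrite mulr_gt0.
have ee1 : eta * e <= 1 / 2.
  by apply: le_trans e12; rewrite ler_piMl// ltW.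
have [g [K [[tg g0 g1] [ga_le gb_ge]]]] : exists (g : R -> R) K,
    [/\ taylor_bounded g (pow_test1 lam p (eta * e)) (pow_test2 lam p (eta * e)) K,
       (forall v, 0 <= g v) & (forall v, g v <= 1)] /\
    (forall v, 0 <= v -> v <= m0 -> ga <= g v) /\ (forall v, M < v -> g v <= gb).
  have [K tg] := pow_test_taylor (ltW lam0) p1 ee0.
  exists (pow_test lam p (eta * e)), K; split; [split=> //|split].
  - by move=> v; exact: expR_ge0.
  - by move=> v; apply: le_trans (ler_norm _) (pow_test_le1 p (eta * e) (ltW lam0) v).
  - move=> v v0 vm; rewrite ler_expR ler_nM2l ?oppr_lt0// ler_expR ler_pM2l//.
    by rewrite ler_ln ?posrE; lra.
  - move=> v vM; rewrite ler_expR ler_nM2l ?oppr_lt0// ler_expR ler_pM2l//.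
    by rewrite ler_ln ?posrE; lra.
have gK v (v0 : 0 <= v) : `|g v| <= 1 by rewrite ger0_norm.
pose D t := slab e M b t.
pose Mx := M + b.
have Mx0 : 0 <= Mx by rewrite /Mx; lra.
have FG : F 1 G.
  rewrite (_ : G = VZ 1 @^-1` `]-oo, m0]%classic); first exact: VZ_Fmeas.
  by apply/seteqP; split => w; rewrite /G /= in_itv.
have mG := filtration_measurable HF FG.
have FD t (t0 : 0 <= t) := @slab_F e M b t t0.
have DV t w : 0 <= t -> D t w -> VZ t w <= Mx by move=> _ [_ h _]; rewrite /Mx; lra.
have DL t w i : 0 <= t -> D t w -> L t w i 0 <= Mx by move=> _ [_ _ /(_ i)]; rewrite /Mx; lra.
have gen t w : 0 <= t -> D t w ->
    C <= generator Om A mu (pow_test1 lam p (eta * e)) (pow_test2 lam p (eta * e)) (Z t w).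
  move=> t0 [De DM _].
  have /andP[Qc _] := Omega_A_bounds HR c0 symRC HA (Zorthant w t0).
  by apply: HC => //; lra.
have [N /(_ N (leqnn _)) HN] := dynkin_ge HR c0 symRC HA HS ler01 tau0 Mx0 FG FD DV DL tg gK gen q0.
exists N.
pose inc := increments Rm c Z D G 1 tau g N.
have I1 : L1 P inc := increments_L1 HR c0 symRC HS ler01 tau0 FG FD tg gK N.
have I0 : L1 P (fun w => \1_G w * g (VZ 1 w)) := initial_L1 HR c0 symRC HS ler01 FG tg gK.
pose al := alive D G 1 tau N N.
have mal : measurable al by exact: (alive_measurable HS ler01 tau0 FG FD).
have t0 j : 0 <= grid 1 tau N j by exact: le_trans ler01 (grid_ge _ _ _ tau0).
have mdip := dip_measurable e N tau0.
have mL := large_L_measurable b st0.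
have ind0 (E : set T) w : 0 <= \1_E w :> R by rewrite indicE.
have gb0 : 0 <= gb by exact: expR_ge0.
have ineq w : \1_G w * g (VZ 1 w) + inc w <=
    (\1_(dip tau e N) w + gb * \1_G w) + (\1_al w + \1_(large_L (1 + tau) b) w).
  have [Gw|nG] := pselect (G w); last first.
    rewrite /inc (increments0 Rm c Z D 1 tau g N nG) [\1_G w]indicE memNset//.
    by rewrite mul0r mulr0 !addr0 !addr_ge0.
  have [k kN [Ek0 Hk Dk]] := stopped_value Rm c Z D 1 tau g N Gw.
  have Ek : g (VZ 1 w) + inc w = g (VZ (grid 1 tau N k) w) := Ek0.
  rewrite [\1_G w]indicE mem_set// mul1r [leLHS]Ek mulr1.
  have d0 := ind0 (dip tau e N) w; have a0 := ind0 al w.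
  have l0 := ind0 (large_L (1 + tau) b) w.
  case: Hk => [[_ aw]|nD].
    have h : \1_al w = 1 :> R by rewrite indicE mem_set.
    by apply: le_trans (g1 _) _; rewrite h addrCA lerDl !addr_ge0.
  have [Ve|Ve] := ltP (VZ (grid 1 tau N k) w) e.
    have h : \1_(dip tau e N) w = 1 :> R.
      by rewrite indicE mem_set//; exists k => //=; rewrite in_itv.
    by apply: le_trans (g1 _) _; rewrite h -addrA lerDl !addr_ge0.
  have [VM|VM] := ltP M (VZ (grid 1 tau N k) w).
    apply: le_trans (gb_ge _ VM) _.
    by rewrite -addrA addrCA lerDl addr_ge0// addr_ge0.
  have h : \1_(large_L (1 + tau) b) w = 1 :> R.
    rewrite indicE mem_set//; apply: contrapT => nL; apply: nD; split=> // i.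
    rewrite leNgt; apply/negP => bL; apply: nL; exists i.
    by apply: lt_le_trans bL _; apply: ndL => //; exact: grid_le.
  by apply: le_trans (g1 _) _; rewrite h addrA lerDr !addr_ge0.
have Id := indic_L1 P mdip; have Ia := indic_L1 P mal.
have Il := indic_L1 P mL; have Ig := indic_L1 P mG.
have I2 : L1 P (fun w => \1_(dip tau e N) w + gb * \1_G w) by apply: L1D => //; exact: L1Z.
have I3 : L1 P (fun w => \1_al w + \1_(large_L (1 + tau) b) w) by exact: L1D.
have := Ex_le (L1D I0 I1) (L1D I2 I3) ineq.
rewrite (ExD I0 I1) (ExD I2 I3) (ExD Id (L1Z gb Ig)) (ExD Ia Il) (ExZ gb Ig) => main.
have low : ga * pG <= Ex P (fun w => \1_G w * g (VZ 1 w)).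
  rewrite /pG -(ExZ ga Ig); apply: Ex_le => //; first exact: L1Z.
  move=> w; rewrite indicE; have [Gw|nG] := pselect (G w).
    rewrite mem_set// mulr1 mul1r; apply: ga_le => //; exact: Vge0.
  by rewrite memNset// mulr0 mul0r.
have occ := occupation_ge HS ler01 tau0 FG FD N.
set o := occupation _ _ _ _ _ _ in HN occ.
have ub : Ex P inc <= 1.
  rewrite -(Ex_cst P 1); apply: Ex_le => //; first exact: L1_cst.
  move=> w; have [Gw|nG] := pselect (G w); last first.
    by rewrite /inc (increments0 Rm c Z D 1 tau g N nG).
  have [k _ [Ek _ _]] := stopped_value Rm c Z D 1 tau g N Gw.
  have Ek' : g (VZ 1 w) + inc w = g (VZ (grid 1 tau N k) w) := Ek.
  by apply: le_trans (g1 (VZ (grid 1 tau N k) w)); rewrite -Ek' lerDr.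
have a_le : Ex P \1_al <= q.
  have h1 : C * (Ex P \1_al * tau) <= 2.
    apply: (@le_trans _ _ (C * o)); first by rewrite ler_pM2l.
    rewrite lerBlDr in HN; apply: le_trans HN _; rewrite -/inc.
    by rewrite (_ : 2 = 1 + 1)//; exact: lerD.
  have h2 : C * (Ex P \1_al * tau) = 2 * (Ex P \1_al / q).
    by rewrite /tau; field; rewrite !gt_eqF.
  rewrite h2 -[leRHS]mulr1 ler_pM2l// ler_pdivrMr// mul1r in h1.
  exact: h1.
have o0 : 0 <= C * o.
  rewrite mulr_ge0 ?(ltW C0)// /o mulr_ge0 ?(ltW (mesh_gt0 _ tau0))//.
  by apply: sumr_ge0 => k _; apply: Ex_ge0 => w; rewrite indicE.
have q4 : (ga - gb) * pG = 4 * q by rewrite /q; field.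
exact: arith main low HN Hb a_le o0 q4.
Qed.

(** The events of a dip below [1 / (k + 2)] at some grid time of [[1, 1 + tau]] decrease in [k] and
    keep probability at least [q]. On their intersection the continuous path of [V] attains its
    minimum over that interval, and the minimum is 0. *)
Theorem hits_corner_not_negligible : ~ P.-negligible (hits_corner Z).
Proof.
have [tau [q [tau0 q0 Hq]]] := dip_probability.
move=> [N0 [mN0 PN0 hN0]].
pose ek (k : nat) : R := (k.+2%:R)^-1.
have ek0 k : 0 < ek k by rewrite invr_gt0.
have ek12 k : ek k <= 1 / 2 by rewrite div1r lef_pV2 ?posrE// ler_nat.
pose W k := \bigcup_N dip tau (ek k) N.
have mdip k N : measurable (dip tau (ek k) N) by exact: dip_measurable.
have mW k : measurable (W k) by exact: bigcupT_measurable.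
have mI : measurable (\bigcap_k W k) by exact: bigcapT_measurable.
have Wd : {homo W : n m / (n <= m)%N >-> (m <= n)%O}.
  move=> a b ab; apply/subsetPset => w [N _ [j jN]] /=; rewrite in_itv/= => h.
  exists N => //; exists j => //=; rewrite in_itv/=.
  by apply: lt_le_trans h _; rewrite lef_pV2 ?posrE// ler_nat ltnS.
have fin : (P (W 0%N) < +oo)%E by rewrite ltey_eq fin_num_measure.
have cv := @nonincreasing_cvg_mu _ _ _ P _ fin mW mI Wd.
have qW k : (q%:E <= P (W k))%E.
  have [N HN] := Hq (ek k) (ek0 k) (ek12 k).
  apply: (@le_trans _ _ (P (dip tau (ek k) N))); first by rewrite -Ex_indic.
  by apply: le_measure; rewrite ?inE//; exact: bigcup_sup.
have qI : (q%:E <= P (\bigcap_k W k))%E.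
  rewrite -(cvg_lim _ cv)//; apply: lime_ge; first exact: cvgP cv.
  exact: nearW.
have sub : \bigcap_k W k `<=` N0.
  move=> w Ww; apply: hN0.
  have seg : 0 <= (1 : R) <= 1 + tau by rewrite ler01 lerDl ltW.
  have [u /andP[u1 u2] Hu] := segment_min (@VZ_continuous w) seg.
  exists u; split; first by lra.
  apply: (V0_eq0 HR c0 symRC); apply/eqP; rewrite eq_le Vge0 andbT.
  apply/ler_addgt0Pr => e e0; rewrite add0r.
  pose k := Num.bound e^-1.
  have [N _ [j /= jN]] := Ww k I; rewrite in_itv/= => h.
  have h1 : VZ u w <= VZ (grid 1 tau N j) w.
    by apply: Hu; rewrite grid_ge//= grid_le.
  apply: le_trans h1 _; apply: le_trans (ltW h) _.
  rewrite invf_ple ?posrE ?ltr0n//.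
  apply: le_trans (ltW (archi_boundP _)) _; first by rewrite invr_ge0 ltW.
  by rewrite ler_nat -/k; exact: leq_trans (leqnSn _) (leqnSn _).
have : (P (\bigcap_k W k) <= 0)%E.
  by rewrite -PN0; apply: le_measure; rewrite ?inE.
by move=> /(le_trans qI); rewrite lee_fin leNgt q0.
Qed.
End Hits.
End Corner.

Theorem theorem3p4 (R : realType) (n : nat) (mu : 'cV[R]_n) (A Rm : 'M[R]_n)
    (c : 'I_n -> R) :
  (0 < n)%N ->
  sym_pos_def A ->
  reflection_M_matrix Rm ->
  (forall i, 0 < c i) ->
  (Rm *m diagC c)^T = Rm *m diagC c ->
  let Omega := invmx (Rm *m diagC c) in
  (* (i) *)
  (2 * c_plus Omega A <= \tr (Omega *m A) ->
     forall z : 'cV[R]_n, z \in orthant ->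
     forall (d : measure_display) (T : measurableType d) (P : probability T R)
       (F : R -> set (set T)) (B L Z : R -> T -> 'cV[R]_n),
     is_SRBM Rm mu A z P F B L Z -> P.-negligible (hits_corner Z)) /\
  (* (ii) *)
  (0 <= \tr (Omega *m A) < 2 * c_minus Omega A ->
     forall z : 'cV[R]_n, z \in orthant ->
     forall (d : measure_display) (T : measurableType d) (P : probability T R)
       (F : R -> set (set T)) (B L Z : R -> T -> 'cV[R]_n),
     is_SRBM Rm mu A z P F B L Z -> ~ P.-negligible (hits_corner Z)).
Proof.
move=> n0 HA HR c0 symRC Omega; split.
  move=> trc z _ d T P F B L Z HS.
  exact: avoids_corner n0 HR c0 symRC HA HS trc.
move=> /andP[tr0 trc] z _ d T P F B L Z HS.
exact: hits_corner_not_negligible HR c0 symRC HA HS tr0 trc.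
Qed.
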